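(* Let $X$ be a uniformly locally finite metric space and assume that $X$ satisfies the coarse Baum-Connes conjecture with coefficients. Then $X$ is both Roe rigid and uniform Roe rigid.
   Context: A metric space $(X,d)$ is uniformly locally finite (u.l.f.) if $\sup_{x\in X}|\{y\in X: d(x,y)\le r\}|<\infty$ for all $r>0$, and uniformly discrete if $\inf_{x\ne y}d(x,y)>0$. Coarse notions. A map $f:(X,d)\to(Y,\partial)$ is coarse if for all $s>0$ there is $r>0$ such that $d(x,y)<s$ implies $\partial(f(x),f(y))<r$; it is expanding if for all $r>0$ there is $s>0$ such that $d(x,y)>s$ implies $\partial(f(x),f(y))>r$. It is a coarse equivalence if it is coarse, expanding and $\sup_{y\in Y}\partial(y,f(X))<\infty$. $X$ and $Y$ are (bijectively) coarsely equivalent if there is a (bijective) coarse equivalence $X\to Y$. Roe algebras. Fix an infinite dimensional separable Hilbert space $H_X$. For $a\in\mathcal B(\ell_2(X,H_X))$ let $a_{xy}=e_{yy}ae_{xx}\in\mathcal B(H_X)$, where $e_{xx}$ is the projection onto $\delta_x\otimes H_X$, and let $\mathrm{prop}(a)=\sup\{d(x,y):a_{xy}\neq0\}$. The Roe algebra $\mathrm{C}^*(X)$ is the norm closure of the set of all $a$ with $\mathrm{prop}(a)<\infty$ and all $a_{xy}$ compact. The uniform Roe algebra $\mathrm{C}^*_u(X)$ is the norm closure of the finite propagation operators in $\mathcal B(\ell_2(X))$. A u.l.f. metric space $X$ is Roe rigid (resp. uniform Roe rigid) if $X$ is coarsely equivalent to every u.l.f. metric space $Y$ such that $\mathrm{C}^*(X)$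 and $\mathrm{C}^*(Y)$ (resp. $\mathrm{C}^*_u(X)$ and $\mathrm{C}^*_u(Y)$) are $*$-isomorphic. Baum-Connes for groupoids. Let $G$ be a locally compact, $\sigma$-compact, Hausdorff groupoid with a Haar system, with source $s$ and range $r$. A $G$-C*-algebra is a $C_0(G^{(0)})$-algebra $A$ with an isomorphism $\alpha:s^*A\to r^*A$ of $C_0(G)$-algebras satisfying $\alpha_{gh}=\alpha_g\alpha_h$ for composable $g,h$. Put $K^{top}_*(G,A)=\varinjlim_Z KK^G_*(C_0(Z),A)$ (Le Gall's equivariant KK-theory), the limit being over the $G$-compact $G$-invariant closed subsets $Z$ of a universal proper $G$-space $\underline{E}G$. The assembly map $\mu_{r,A}:K^{top}_*(G,A)\to K_*(A\rtimes_rG)$ is induced by the composition of the reduced descent $KK^G_*(C_0(Z),A)\to KK_*(C_0(Z)\rtimes_rG,A\rtimes_rG)$ with the Kasparov product by the class in $K_0(C_0(Z)\rtimes_rG)$ of the projection determined by a cutoff function on $Z$. $G$ satisfies the Baum-Connes conjecture for $A$ if $\mu_{r,A}$ is an isomorphism, and the Baum-Connes conjecture with coefficients if this holds for all $G$-C*-algebras $A$. Coarse groupoid. For a u.l.f. metric space $(X,d)$ let $\Delta_R=\{(x,y)\in X\times X:d(x,y)\le R\}$ and $G(X)=\bigcup_{R>0}\overline{\Delta_R}\subset\beta(X\times X)$ (Stone-Čech compactification). The structure maps of the pair groupoid $X\times X$ extend uniquely continuously to $G(X)$, making it a principal, étale, locally compact, $\sigma$-compact Hausdorff groupoid with unit space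 $\beta X$. There is a second countable étale groupoid $G'$ with $G(X)=\beta X\rtimes G'$, and the assembly map of $G(X)$ with coefficients in $A$ agrees with that of $G'$ with coefficients in $A$. A uniformly discrete u.l.f. metric space $X$ satisfies the coarse Baum-Connes conjecture with coefficients if $G(X)$ satisfies the Baum-Connes conjecture with coefficients. A general u.l.f. metric space satisfies it if it is bijectively coarsely equivalent to a uniformly discrete metric space which satisfies it. *)

(* Defs.v *)
From HB Require Import structures.
From mathcomp Require Import all_boot all_order all_algebra finmap.
From mathcomp Require Import complex.
From mathcomp Require Import all_classical all_reals all_analysis.

Set Implicit Arguments.
Unset Strict Implicit.
Unset Printing Implicit Defensive.

Import Order.TTheory GRing.Theory Num.Theory.
Import numFieldNormedType.Exports.

Local Open Scope classical_set_scope.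
Local Open Scope ring_scope.

(* R[i] packed as a numClosedFieldType, so that the normed topology that the
   library puts on every numClosedFieldType is inferred on it. *)
Definition Cplx (R : realType) : numClosedFieldType := R[i]%C.

Section CoarseGeometry.
Variable R : realType.

Definition ulf (X : metricType R) : Prop :=
  forall r : R, 0 < r ->
    exists N : nat, forall x : X, ([set y : X | mdist x y <= r] #<= `I_N)%card.

Definition uniformly_discrete (X : metricType R) : Prop :=
  exists2 e : R, 0 < e & forall x y : X, x <> y -> e <= mdist x y.

Variables X Y : metricType R.

Definition coarse_map (f : X -> Y) : Prop :=
  forall s : R, 0 < s -> exists2 r : R, 0 < r &
    forall x y : X, mdist x y < s -> mdist (f x) (f y) < r.

Definition expanding_map (f : X -> Y) : Prop :=
  forall r : R, 0 < r -> exists2 s : R, 0 < s &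
    forall x y : X, s < mdist x y -> r < mdist (f x) (f y).

Definition dist_to_set (y : Y) (A : set Y) : \bar R :=
  ereal_inf [set (mdist y z)%:E | z in A].

Definition coarse_equivalence (f : X -> Y) : Prop :=
  [/\ coarse_map f, expanding_map f &
      (ereal_sup [set dist_to_set y (range f) | y in [set: Y]] < +oo)%E].

Definition coarsely_equivalent : Prop :=
  exists f : X -> Y, coarse_equivalence f.

Definition bij_coarsely_equivalent : Prop :=
  exists2 f : X -> Y, bijective f & coarse_equivalence f.

End CoarseGeometry.

Section EllTwo.
Variables (R : realType) (I : choiceType).
Local Notation C := (Cplx R).
Local Notation vec := (I -> C).
Local Notation op := (vec -> vec).

Definition finite_sets_filter : set_system {fset I} :=
  filter_from [set: {fset I}] (fun A => [set B | (A `<=` B)%fset]).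

Definition usum (F : I -> C) : C :=
  lim ((\sum_(i <- J) F i) @[J --> finite_sets_filter]).

Definition ell2 : set vec :=
  [set f | cvg ((\sum_(i <- J) `|f i| ^+ 2 : C) @[J --> finite_sets_filter])].

Definition l2norm (f : vec) : C := sqrtC (usum (fun i => `|f i| ^+ 2)).

Definition l2dot (f g : vec) : C := usum (fun i => f i * (g i)^*).

(* Vectors of l2(I) are functions I -> C, so an operator is a map on all
   functions; requiring the value 0 off l2(I) makes equality of maps coincide
   with equality of operators on l2(I). *)
Definition bounded_op : set op :=
  [set T | [/\ forall f, ~ ell2 f -> T f = 0,
               forall f, ell2 f -> ell2 (T f),
               forall (c : C) f g, ell2 f -> ell2 g ->
                 T (c *: f + g) = c *: T f + T g &
               exists M : C, forall f, ell2 f ->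
                 l2norm (T f) <= M * l2norm f]].

Definition op_adjoint (S T : op) : Prop :=
  forall f g, ell2 f -> ell2 g -> l2dot (T f) g = l2dot f (S g).

Definition norm_closure (A : set op) : set op :=
  [set T | bounded_op T /\
     forall e : C, 0 < e -> exists2 S, A S &
       forall f, ell2 f -> l2norm (T f - S f) <= e * l2norm f].

Definition compact_op (T : op) : Prop :=
  forall u : nat -> vec, (forall n, ell2 (u n) /\ l2norm (u n) <= 1) ->
    exists k : nat -> nat, {homo k : m n / (m < n)%N} /\
      exists2 g : vec, ell2 g & l2norm (T (u (k n)) - g) @[n --> \oo] --> (0 : C).

(* For p : I -> X, l2(I) is the direct sum of the subspaces l2(p^-1(x)), and
   block T x y is e_yy T e_xx. *)
Variables (X : metricType R) (p : I -> X).

Definition fiber_proj (x : X) : op := fun f i => if p i == x then f i else 0.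

Definition block (T : op) (x y : X) : op :=
  fun f => fiber_proj y (T (fiber_proj x f)).

Definition propagation (T : op) : \bar R :=
  ereal_sup [set t | exists x y : X,
    (exists2 f, ell2 f & block T x y f <> 0) /\ t = (mdist x y)%:E].

End EllTwo.

(* The coefficient space H_X is l2(nat); l2(X, H_X) is l2(X * nat). *)
Definition roe_algebra (R : realType) (X : metricType R) :
    set ((X * nat -> Cplx R) -> (X * nat -> Cplx R)) :=
  norm_closure [set T | [/\ bounded_op T,
    (propagation (fst : X * nat -> X) T < +oo)%E &
    forall x y : X, compact_op (block (fst : X * nat -> X) T x y)]].

Definition uniform_roe_algebra (R : realType) (X : metricType R) :
    set ((X -> Cplx R) -> (X -> Cplx R)) :=
  norm_closure [set T | bounded_op T /\ (propagation (@id X) T < +oo)%E].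

Arguments roe_algebra {R} X.
Arguments uniform_roe_algebra {R} X.

Definition star_isomorphic (R : realType) (I J : choiceType)
    (A : set ((I -> Cplx R) -> (I -> Cplx R)))
    (B : set ((J -> Cplx R) -> (J -> Cplx R))) : Prop :=
  exists2 phi, set_bij A B phi &
    forall S T (c : Cplx R), A S -> A T ->
      [/\ phi (fun f => c *: S f + T f) = (fun f => c *: phi S f + phi T f),
          phi (S \o T) = phi S \o phi T &
          op_adjoint S T -> op_adjoint (phi S) (phi T)].

Definition roe_rigid (R : realType) (X : metricType R) : Prop :=
  forall Y : metricType R, ulf Y ->
    star_isomorphic (roe_algebra X) (roe_algebra Y) -> coarsely_equivalent X Y.

Definition uniform_roe_rigid (R : realType) (X : metricType R) : Prop :=
  forall Y : metricType R, ulf Y ->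
    star_isomorphic (uniform_roe_algebra X) (uniform_roe_algebra Y) ->
    coarsely_equivalent X Y.

Record cstarAlg (R : realType) := CStarAlg {
  cs_car :> completeNormedModType (Cplx R);
  cmul : cs_car -> cs_car -> cs_car;
  cstar : cs_car -> cs_car;
  cmulA : associative cmul;
  cmulPl : forall (c : Cplx R) a b d, cmul (c *: a + b) d = c *: cmul a d + cmul b d;
  cmulPr : forall (c : Cplx R) a b d, cmul d (c *: a + b) = c *: cmul d a + cmul d b;
  cstarK : involutive cstar;
  cstarP : forall (c : Cplx R) a b, cstar (c *: a + b) = c^* *: cstar a + cstar b;
  cstarM : forall a b, cstar (cmul a b) = cmul (cstar b) (cstar a);
  cnormM : forall a b, `|cmul a b| <= `|a| * `|b|;
  cnormS : forall a, `|cmul (cstar a) a| = `|a| ^+ 2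
}.

Record hilbMod (R : realType) (A : cstarAlg R) := HilbMod {
  hm_car :> completeNormedModType (Cplx R);
  hact : hm_car -> A -> hm_car;
  ip : hm_car -> hm_car -> A;
  hactPl : forall (c : Cplx R) x y a, hact (c *: x + y) a = c *: hact x a + hact y a;
  hactPr : forall (c : Cplx R) x a b, hact x (c *: a + b) = c *: hact x a + hact x b;
  hactA : forall x a b, hact (hact x a) b = hact x (cmul a b);
  ipP : forall (c : Cplx R) x y z, ip x (c *: y + z) = c *: ip x y + ip x z;
  ipM : forall x y a, ip x (hact y a) = cmul (ip x y) a;
  ipC : forall x y, cstar (ip x y) = ip y x;
  ip_pos : forall x, exists b, ip x x = cmul (cstar b) b;
  ip_norm : forall x, `|x| ^+ 2 = `|ip x x|
}.

Section HilbertModules.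
Variables (R : realType) (A : cstarAlg R) (E : hilbMod A).

Definition adjoints (T S : E -> E) : Prop :=
  forall x y, ip (T x) y = ip x (S y).

Definition adjointable (T : E -> E) : Prop := exists S, adjoints T S.

(* K(E), the norm closure of the span of the operators z |-> x <y, z> *)
Definition compact_adj (T : E -> E) : Prop :=
  forall e : Cplx R, 0 < e ->
    exists (n : nat) (x y : 'I_n -> E), forall z,
      `|T z - \sum_(i < n) hact (x i) (ip (y i) z)| <= e * `|z|.

Definition countably_generated : Prop :=
  exists u : nat -> E,
    closure [set x | exists (n : nat) (a : 'I_n -> A),
                x = \sum_(i < n) hact (u i) (a i)] = [set: E].

End HilbertModules.

(* C_0(Z) for a closed subset Z of a locally compact space W; its elements are
   represented by functions on W, two of which are identified when they agree
   on Z. *)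
Definition C0 (R : realType) (W : topologicalType) (Z : set W) :
    set (W -> Cplx R) :=
  [set f | {within Z, continuous f} /\
     forall e : Cplx R, 0 < e -> compact (Z `&` [set z | e <= `|f z|])].

Definition C0_span (R : realType) (Y : topologicalType) (A : cstarAlg R)
    (act : (Y -> Cplx R) -> A -> A) (P : set (Y -> Cplx R)) : set A :=
  [set a | exists (n : nat) (f : 'I_n -> Y -> Cplx R) (b : 'I_n -> A),
     (forall i, C0 setT (f i) /\ P (f i)) /\ a = \sum_(i < n) act (f i) (b i)].

(* c0act is a nondegenerate *-homomorphism from C_0(Y) to the centre of the
   multiplier algebra. *)
Record c0Alg (R : realType) (Y : topologicalType) := C0Alg {
  c0_alg :> cstarAlg R;
  c0act : (Y -> Cplx R) -> c0_alg -> c0_alg;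
  c0act_linl : forall (c : Cplx R) f h a, C0 setT f -> C0 setT h ->
    c0act (fun y => c * f y + h y) a = c *: c0act f a + c0act h a;
  c0act_linr : forall (c : Cplx R) f a b, C0 setT f ->
    c0act f (c *: a + b) = c *: c0act f a + c0act f b;
  c0actA : forall f h a, C0 setT f -> C0 setT h ->
    c0act (fun y => f y * h y) a = c0act f (c0act h a);
  c0act_mul : forall f a b, C0 setT f ->
    c0act f (cmul a b) = cmul (c0act f a) b /\
    c0act f (cmul a b) = cmul a (c0act f b);
  c0act_star : forall f a, C0 setT f ->
    cstar (c0act f a) = c0act (fun y => (f y)^*) (cstar a);
  c0act_nondeg : closure (C0_span c0act setT) = [set: c0_alg]
}.

(* The fibre of A at y is A_y = A / I_y, where I_y is the closure of
   {f in C_0(Y) | f y = 0} A.  Elements of A_y are represented by elements of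
   A, and alg_lt y a e says that the norm of a in A_y is < e.  The fibre at y
   of a Hilbert A-module E is E_y = E (x)_A A_y, and mod_lt y x e says that
   the norm of x in E_y is < e; likewise op_lt for the operator on E_y induced
   by T. *)
Section Fibres.
Variables (R : realType) (Y : topologicalType) (A : c0Alg R Y).

Definition fibre_ideal (y : Y) : set A :=
  closure (C0_span (@c0act _ _ A) [set f | f y = 0]).

Definition alg_lt (y : Y) (a : A) (e : Cplx R) : Prop :=
  exists2 b, fibre_ideal y b & `|a - b| < e.

Variable E : hilbMod A.

Definition mod_lt (y : Y) (x : E) (e : Cplx R) : Prop :=
  alg_lt y (ip x x) (e ^+ 2).

Definition op_lt (y : Y) (T : E -> E) (e : Cplx R) : Prop :=
  exists2 d : Cplx R, 0 < d < e &
    forall x t, 0 < t -> mod_lt y x t -> mod_lt y (T x) (d * t).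

End Fibres.

(* Sections of the pull-back along q : G -> Y of a bundle over Y, whose fibres
   V_y are quotients of V with norms given by lt (lt y v e iff the norm of v
   in V_y is < e).  A section is represented by a map G -> V.  It is
   continuous if it is locally approximated in norm by (the sections given by)
   elements of P.  For A a C_0(Y)-algebra, the C*-algebra q^*A is
   c0_section q (@alg_lt A) setT modulo eq_fib, and for E a Hilbert A-module
   K(q^*E) = q^*K(E) is c0_section q (@op_lt A E) (@compact_adj A E). *)
Section BundleSections.
Variables (R : realType) (G Y : topologicalType) (V : zmodType).
Variables (q : G -> Y) (lt : Y -> V -> Cplx R -> Prop) (P : set V).

Definition eq_fib (y : Y) (v w : V) : Prop :=
  forall e : Cplx R, 0 < e -> lt y (v - w) e.

Definition continuous_section (s : G -> V) : Prop :=
  forall (g0 : G) (e : Cplx R), 0 < e ->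
    exists2 v, P v & \forall g \near g0, lt (q g) (s g - v) e.

Definition c0_section (s : G -> V) : Prop :=
  continuous_section s /\
  forall e : Cplx R, 0 < e ->
    exists2 K : set G, compact K & forall g, ~ K g -> lt (q g) (s g) e.

Definition cc_section (s : G -> V) : Prop :=
  continuous_section s /\
  exists2 K : set G, compact K & forall g, ~ K g -> s g = 0.

End BundleSections.

Notation eq_alg A := (eq_fib (@alg_lt _ _ A)).
Notation eq_mod E := (eq_fib (@mod_lt _ _ _ E)).

(* Structure maps only; everything below is applied to etale groupoids with
   the Haar system of counting measures.  gmul g h is meaningful when
   src g = rng h. *)
Record groupoid := Groupoid {
  arr : topologicalType;
  obj : topologicalType;
  src : arr -> obj;
  rng : arr -> obj;
  gmul : arr -> arr -> arr;
  ginv : arr -> arr;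
  gunit : obj -> arr
}.

Record gSpace (G : groupoid) := GSpace {
  gs_car :> topologicalType;
  anchor : gs_car -> obj G;
  gact : arr G -> gs_car -> gs_car
}.

Section GSpaces.
Variables (R : realType) (G : groupoid).

(* Proper G-spaces are locally compact, sigma-compact and Hausdorff, the class
   in which a universal one exists for every sigma-compact etale groupoid. *)
Definition proper_gspace (W : gSpace G) : Prop :=
  [/\ hausdorff_space W,
      forall z : W, exists2 K : set W, nbhs z K & compact K,
      exists2 K : nat -> set W, (forall n, compact (K n)) & \bigcup_n K n = setT,
      [/\ continuous (@anchor G W),
          {within [set p : arr G * W | src p.1 = anchor p.2],
             continuous (fun p => gact p.1 p.2)},
          forall (g : arr G) (z : W), src g = anchor z ->
            anchor (gact g z) = rng g,
          forall z : W, gact (gunit (anchor z)) z = z &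
          forall (g h : arr G) (z : W), src g = rng h -> src h = anchor z ->
            gact (gmul g h) z = gact g (gact h z)] &
      forall K : set (W * W), compact K ->
        compact [set p : arr G * W |
                   src p.1 = anchor p.2 /\ K (gact p.1 p.2, p.2)]].

Definition equivariant (Y W : gSpace G) (f : Y -> W) : Prop :=
  (forall y, anchor (f y) = anchor y) /\
  (forall (g : arr G) y, src g = anchor y -> f (gact g y) = gact g (f y)).

Definition g_homotopic (Y W : gSpace G) (f h : Y -> W) : Prop :=
  exists H : R * Y -> W,
    [/\ {within `[0, 1] `*` setT, continuous H},
        forall t, t \in `[0, 1] -> equivariant (fun y => H (t, y)),
        forall y, H (0, y) = f y &
        forall y, H (1, y) = h y].

Definition universal_proper (W : gSpace G) : Prop :=
  [/\ proper_gspace W,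
      forall Y : gSpace G, proper_gspace Y ->
        exists2 f : Y -> W, continuous f & equivariant f &
      forall (Y : gSpace G) (f h : Y -> W), proper_gspace Y ->
        continuous f -> equivariant f -> continuous h -> equivariant h ->
        g_homotopic f h].

Definition g_compact (W : gSpace G) (Z : set W) : Prop :=
  [/\ closed Z,
      forall (g : arr G) z, src g = anchor z -> Z z -> Z (gact g z) &
      exists2 K : set W, compact K /\ K `<=` Z &
        forall z, Z z -> exists (g : arr G) (k : W),
          [/\ K k, src g = anchor k & z = gact g k]].

End GSpaces.

(* The isomorphism alpha : s^*A -> r^*A is given by its fibres
   alpha_g : A_(s g) -> A_(r g); gaut g is a lift of alpha_g to a map on
   representatives, normalized by gaut g 0 = 0. *)
Record gAlg (R : realType) (G : groupoid) := GAlg {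
  ga_alg :> c0Alg R (obj G);
  gaut : arr G -> ga_alg -> ga_alg;
  gaut0 : forall g, gaut g 0 = 0;
  gautP : forall g (c : Cplx R) a b,
    eq_alg ga_alg (rng g) (gaut g (c *: a + b)) (c *: gaut g a + gaut g b);
  gautM : forall g a b,
    eq_alg ga_alg (rng g) (gaut g (cmul a b)) (cmul (gaut g a) (gaut g b));
  gautS : forall g a,
    eq_alg ga_alg (rng g) (gaut g (cstar a)) (cstar (gaut g a));
  gaut_inj : forall g a b,
    eq_alg ga_alg (src g) a b <-> eq_alg ga_alg (rng g) (gaut g a) (gaut g b);
  gaut_surj : forall g b, exists a, eq_alg ga_alg (rng g) (gaut g a) b;
  gaut_comp : forall g h a, src g = rng h ->
    eq_alg ga_alg (rng g) (gaut (gmul g h) a) (gaut g (gaut h a));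
  gaut_sec : forall s : arr G -> ga_alg,
    c0_section (@src G) (@alg_lt _ _ ga_alg) setT s ->
    c0_section (@rng G) (@alg_lt _ _ ga_alg) setT (fun g => gaut g (s g))
}.

(* An equivariant Kasparov C_0(Z)-A-bimodule for Z a closed invariant subset of a G-space W:
   module, unitary V : s^*E -> r^*E (through lifts V_g : E_(s g) -> E_(r g) to
   representatives), grading operator, representation of C_0(Z), operator F. *)
Record kCycle (R : realType) (G : groupoid) (W : gSpace G) (A : gAlg R G) :=
  KCycle {
  kE :> hilbMod A;
  kV : arr G -> kE -> kE;
  kgr : kE -> kE;
  krep : (W -> Cplx R) -> kE -> kE;
  kF : kE -> kE
}.

Section KKTheory.
Variables (R : realType) (G : groupoid) (W : gSpace G).
Local Notation C := (Cplx R).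

Section Cycles.
Variables (A : gAlg R G) (Z : set W) (E : kCycle W A).

Definition unitary_action : Prop :=
  [/\ forall g, kV g (0 : E) = 0,
      forall g (c : C) (x y : E),
        eq_mod E (rng g) (kV g (c *: x + y)) (c *: kV g x + kV g y),
      forall g (x y : E),
        eq_alg A (rng g) (ip (kV g x) (kV g y)) (gaut g (ip x y)) &
      forall g (x : E) (a : A),
        eq_mod E (rng g) (kV g (hact x a)) (hact (kV g x) (gaut g a))] /\
  [/\ forall g (y : E), exists x : E, eq_mod E (rng g) (kV g x) y,
      forall g h (x : E), src g = rng h ->
        eq_mod E (rng g) (kV (gmul g h) x) (kV g (kV h x)) &
      forall s : arr G -> E, c0_section (@src G) (@mod_lt _ _ _ E) setT s ->
        c0_section (@rng G) (@mod_lt _ _ _ E) setT (fun g => kV g (s g))].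

Definition equivariant_rep : Prop :=
  [/\ forall f h, C0 Z f -> C0 Z h -> {in Z, f =1 h} ->
        forall x : E, krep f x = krep h x,
      forall (c : C) f h (x : E), C0 Z f -> C0 Z h ->
        krep (fun z => c * f z + h z) x = c *: krep f x + krep h x,
      forall f h (x : E), C0 Z f -> C0 Z h ->
        krep (fun z => f z * h z) x = krep f (krep h x) &
      forall f, C0 Z f ->
        adjoints (krep f : E -> E) (krep (fun z => (f z)^*))] /\
  [/\ forall (phi : obj G -> C) f (x : E) (a : A), C0 setT phi -> C0 Z f ->
        krep (fun z => phi (anchor z) * f z) (hact x a) =
        krep f (hact x (c0act phi a)) &
      forall g f h (x : E), C0 Z f -> C0 Z h ->
        (forall z, Z z -> anchor z = rng g -> h z = f (gact (ginv g) z)) ->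
        eq_mod E (rng g) (kV g (krep f x)) (krep h (kV g x))].

(* odd = false: KK_0, Z/2-graded modules and odd F; odd = true: KK_1, ungraded
   modules. *)
Definition grading (odd : bool) : Prop :=
  [/\ adjoints (@kgr _ _ _ _ E) (@kgr _ _ _ _ E),
      forall x : E, kgr (kgr x) = x,
      forall g (x : E), eq_mod E (rng g) (kV g (kgr x)) (kgr (kV g x)),
      forall f (x : E), C0 Z f -> krep f (kgr x) = kgr (krep f x) &
      if odd then forall x : E, kgr x = x
      else forall x : E, kF (kgr x) = - kgr (kF x)].

Definition is_cycle (odd : bool) : Prop :=
  [/\ countably_generated E, unitary_action, equivariant_rep, grading odd &
      exists2 F' : E -> E, adjoints (@kF _ _ _ _ E) F' &
      forall f : W -> C, C0 Z f ->
      [/\ compact_adj (fun x : E => krep f (kF x - F' x)),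
          compact_adj (fun x : E => krep f (kF (kF x) - x)),
          compact_adj (fun x : E => krep f (kF x) - kF (krep f x)) &
          (* b (V s^*F V^* - r^*F) is in r^*K(E) for every elementary tensor
             b = phi (x) f of r^*C_0(Z) = C_0(G) (x)_(C_0(G^0)) C_0(Z) *)
          forall phi : arr G -> C, C0 setT phi ->
            c0_section (@rng G) (@op_lt _ _ _ E) (@compact_adj _ _ E)
              (fun g (x : E) =>
                 phi g *: krep f (kV g (kF (kV (ginv g) x)) - kF x))]].

End Cycles.

(* D with the *-homomorphisms ev t, 0 <= t <= 1, is the G-C*-algebra
   A[0,1] = C([0,1], A) with its evaluation maps. *)
Definition is_cylinder (A D : gAlg R G) (ev : R -> D -> A) : Prop :=
  [/\ forall t, t \in `[0, 1] ->
        [/\ forall (c : C) a b, ev t (c *: a + b) = c *: ev t a + ev t b,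
            forall a b, ev t (cmul a b) = cmul (ev t a) (ev t b),
            forall a, ev t (cstar a) = cstar (ev t a),
            forall f a, C0 setT f -> ev t (c0act f a) = c0act f (ev t a) &
            forall g a, eq_alg A (rng g) (ev t (gaut g a)) (gaut g (ev t a))],
      forall a, {within `[0, 1], continuous (fun t => ev t a)},
      forall a b, (forall t, t \in `[0, 1] -> ev t a = ev t b) -> a = b &
      forall f : R -> A, {within `[0, 1], continuous f} ->
        exists a, forall t, t \in `[0, 1] -> ev t a = f t].

(* E0 is unitarily equivalent to the push-forward E (x)_phi A of E along the
   surjective *-homomorphism phi : D -> A; q is x |-> x (x) 1. *)
Definition is_pushforward (A D : gAlg R G) (phi : D -> A) (Z : set W)
    (E : kCycle W D) (E0 : kCycle W A) : Prop :=
  exists q : E -> E0,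
    [/\ forall (c : C) x y, q (c *: x + y) = c *: q x + q y,
        forall x a, q (hact x a) = hact (q x) (phi a),
        forall x y, ip (q x) (q y) = phi (ip x y) &
        forall y, exists x, q x = y] /\
    [/\ forall g x, eq_mod E0 (rng g) (q (kV g x)) (kV g (q x)),
        forall x, q (kgr x) = kgr (q x),
        forall f x, C0 Z f -> q (krep f x) = krep f (q x) &
        forall x, q (kF x) = kF (q x)].

(* KK^G_j(C_0(Z), A), j = 0, 1, is the quotient of
   {E | is_cycle Z E odd} by kk_eq Z odd. *)
Definition kk_eq (A : gAlg R G) (Z : set W) (odd : bool)
    (E0 E1 : kCycle W A) : Prop :=
  exists (D : gAlg R G) (ev : R -> D -> A) (E : kCycle W D),
    [/\ is_cylinder ev, is_cycle Z E odd,
        is_pushforward (ev 0) Z E E0 & is_pushforward (ev 1) Z E E1].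

(* For Z `<=` Z', the map KK^G_*(C_0(Z), A) -> KK^G_*(C_0(Z'), A) induced by
   the restriction C_0(Z') -> C_0(Z) does not change the underlying kCycle,
   as a function in C0 Z' is also in C0 Z.  The inductive limit
   K^top_*(G, A) is therefore the quotient of the set of pairs (Z, E) such
   that ktop_cycle Z E odd by ktop_eq. *)
Definition ktop_cycle (A : gAlg R G) (Z : set W) (E : kCycle W A)
    (odd : bool) : Prop := g_compact Z /\ is_cycle Z E odd.

Definition ktop_eq (A : gAlg R G) (odd : bool) (Z0 : set W) (E0 : kCycle W A)
    (Z1 : set W) (E1 : kCycle W A) : Prop :=
  exists Z : set W,
    [/\ g_compact Z, Z0 `<=` Z, Z1 `<=` Z & kk_eq Z odd E0 E1].

End KKTheory.

Definition ptG : groupoid :=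
  @Groupoid (discrete_topology unit) (discrete_topology unit)
    id id (fun g _ => g) id id.

Definition pt : gSpace ptG := @GSpace ptG (discrete_topology unit) id (fun _ z => z).

(* A gAlg over the trivial groupoid is just a C*-algebra B, and
   K_*(B) = KK_*(C, B) is the quotient of {E | k_cycle E odd} by k_eq. *)
Definition k_cycle (R : realType) (B : gAlg R ptG) (E : kCycle pt B)
  (odd : bool) : Prop := is_cycle setT E odd.

Definition k_eq (R : realType) (B : gAlg R ptG) (odd : bool)
  (E0 E1 : kCycle pt B) : Prop := kk_eq setT odd E0 E1.

Section CrossedProduct.
Variables (R : realType) (G : groupoid) (A : gAlg R G).
Local Notation C := (Cplx R).

(* Gamma_c(G, r^*A) *)
Definition cc_alg : set (arr G -> A) :=
  cc_section (@rng G) (@alg_lt _ _ A) setT.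

Definition cross_mul (f h : arr G -> A) (g : arr G) : A :=
  \sum_(k \in [set k | rng k = rng g]) cmul (f k) (gaut k (h (gmul (ginv k) g))).

Definition cross_star (f : arr G -> A) (g : arr G) : A :=
  gaut g (cstar (f (ginv g))).

(* the A-valued inner product of L^2(G, A), as the section x |-> <f, h>(x) *)
Definition L2_ip (f h : arr G -> A) (x : obj G) : A :=
  cross_mul (cross_star f) h (gunit x).

(* the reduced norm of f is <= c: left convolution by f has norm <= c on
   L^2(G, A) *)
Definition reduced_norm_le (f : arr G -> A) (c : C) : Prop :=
  forall h, cc_alg h -> forall t e : C, 0 < t -> c ^+ 2 * t < e ->
    (forall x, alg_lt x (L2_ip h h x) t) ->
    forall x, alg_lt x (L2_ip (cross_mul f h) (cross_mul f h) x) e.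

(* B is the reduced crossed product of A by G: the completion of
   Gamma_c(G, r^*A), embedded by iota, for the reduced norm *)
Definition is_reduced_crossed_product (B : cstarAlg R)
    (iota : (arr G -> A) -> B) : Prop :=
  [/\ forall (c : C) f h, cc_alg f -> cc_alg h ->
        iota (fun g => c *: f g + h g) = c *: iota f + iota h,
      forall f h, cc_alg f -> cc_alg h ->
        iota (cross_mul f h) = cmul (iota f) (iota h),
      forall f, cc_alg f -> iota (cross_star f) = cstar (iota f),
      forall f (c : C), cc_alg f -> 0 <= c ->
        (`|iota f| <= c <-> reduced_norm_le f c) &
      closure (iota @` cc_alg) = [set: B]].

Variables (W : gSpace G) (Z : set W) (E : kCycle W A).

(* Gamma_c(G, r^*E), with its Gamma_c(G, r^*A)-valued inner product and right
   action *)
Definition cc_mod : set (arr G -> E) :=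
  cc_section (@rng G) (@mod_lt _ _ _ E) setT.

Definition cross_ip (u v : arr G -> E) (g : arr G) : A :=
  \sum_(k \in [set k | rng k = rng g])
    gaut k (ip (u (ginv k)) (v (gmul (ginv k) g))).

Definition cross_hact (u : arr G -> E) (f : arr G -> A) (g : arr G) : E :=
  \sum_(k \in [set k | rng k = rng g]) hact (u k) (gaut k (f (gmul (ginv k) g))).

Definition cutoff (c : W -> C) : Prop :=
  [/\ forall z, 0 <= c z,
      {within Z, continuous c},
      exists2 K : set W, compact K & forall z, Z z -> ~ K z -> c z = 0 &
      forall z, Z z ->
        \sum_(g \in [set g | rng g = anchor z]) c (gact (ginv g) z) = 1].

(* the projection of C_c(G, r^*C_0(Z)) given by a cutoff function, at
   g and z in Z with rng g = anchor z *)
Definition cutoff_proj (c : W -> C) (g : arr G) (z : W) : C :=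
  sqrtC (c z) * sqrtC (c (gact (ginv g) z)).

(* v is the image of u under the integrated form of (krep, kV) at p in
   C_c(G, r^*C_0(Z)).  As krep is defined on C_0(Z) and p g only on the fibre
   of Z over rng g, an extension b g of p g to an element of C_0(Z) is used. *)
Definition integrated_rep (p : arr G -> W -> C) (u v : arr G -> E) : Prop :=
  forall b : arr G -> W -> C,
    (forall g, C0 Z (b g) /\
       forall z, Z z -> anchor z = rng g -> b g z = p g z) ->
    forall g, eq_mod E (rng g) (v g)
      (\sum_(k \in [set k | rng k = rng g])
         krep (b k) (kV k (u (gmul (ginv k) g)))).

(* E' is the image of E under the reduced descent, followed by the Kasparov
   product with the class of the projection p = cutoff_proj c, that is the
   pull-back along the *-homomorphism C -> C_0(Z) x|_r G, 1 |-> p.  The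
   Hilbert B-module of E' is the completion of Gamma_c(G, r^*E), embedded by
   jota. *)
Definition assembles_to (B : gAlg R ptG) (iota : (arr G -> A) -> B)
    (E' : kCycle pt B) : Prop :=
  exists (c : W -> C) (jota : (arr G -> E) -> E'),
    cutoff c /\
    [/\ forall (l : C) u v, cc_mod u -> cc_mod v ->
          jota (fun g => l *: u g + v g) = l *: jota u + jota v,
        forall u v, cc_mod u -> cc_mod v ->
          ip (jota u) (jota v) = iota (cross_ip u v),
        forall u f, cc_mod u -> cc_alg f ->
          jota (cross_hact u f) = hact (jota u) (iota f) &
        closure (jota @` cc_mod) = [set: E']] /\
    [/\ forall u, cc_mod u -> kF (jota u) = jota (fun g => kF (u g)),
        forall u, cc_mod u -> kgr (jota u) = jota (fun g => kgr (u g)) &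
        forall (f : pt -> C) u v, cc_mod u -> cc_mod v ->
          integrated_rep (cutoff_proj c) u v ->
          krep f (jota u) = f tt *: jota v].

End CrossedProduct.

(* The assembly map of G with coefficients in A is an isomorphism, in both
   degrees.  It is additive on cycles, so this says that it is injective and
   surjective on classes.  Neither the universal proper G-space W nor the model
   (B, iota) of the crossed product matters, as they are unique up to
   G-homotopy equivalence and isomorphism. *)
Definition baum_connes (R : realType) (G : groupoid) (A : gAlg R G) : Prop :=
  exists (W : gSpace G) (B : gAlg R ptG) (iota : (arr G -> A) -> B),
    [/\ universal_proper R W, is_reduced_crossed_product iota &
    forall odd : bool,
      (forall (Z0 Z1 : set W) (E0 E1 : kCycle W A) (E0' E1' : kCycle pt B),
         ktop_cycle Z0 E0 odd -> ktop_cycle Z1 E1 odd ->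
         assembles_to Z0 E0 iota E0' -> assembles_to Z1 E1 iota E1' ->
         k_cycle E0' odd -> k_cycle E1' odd ->
         k_eq odd E0' E1' -> ktop_eq odd Z0 E0 Z1 E1) /\
      (forall E' : kCycle pt B, k_cycle E' odd ->
         exists (Z : set W) (E : kCycle W A) (E1 : kCycle pt B),
           [/\ ktop_cycle Z E odd, assembles_to Z E iota E1,
               k_cycle E1 odd & k_eq odd E1 E'])].

Definition baum_connes_with_coefficients (R : realType) (G : groupoid) : Prop :=
  forall A : gAlg R G, baum_connes A.

(* The Stone-Cech compactification of the discrete set D: ultrafilters on D,
   with the topology with base the sets {u | A \in u} for A a subset of D. *)
Definition stoneCech (D : choiceType) : Type := {u : set_system D | UltraFilter u}.

Section StoneCech.
Variable D : choiceType.

HB.instance Definition _ := gen_eqMixin (stoneCech D).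
HB.instance Definition _ := gen_choiceMixin (stoneCech D).

Definition sc_basic (A : set D) : set (stoneCech D) := [set u | sval u A].

Lemma sc_basic_cover : \bigcup_(A in [set: set D]) sc_basic A = setT.
Proof.
rewrite predeqE => u; split => // _; exists setT => //.
by have FF := svalP u; exact: filterT.
Qed.

Lemma sc_basic_join (A B : set D) (u : stoneCech D) : [set: set D] A ->
  [set: set D] B -> sc_basic A u -> sc_basic B u ->
  exists K, [/\ [set: set D] K, sc_basic K u & sc_basic K `<=` sc_basic A `&` sc_basic B].
Proof.
move=> _ _ uA uB; have FF := svalP u.
exists (A `&` B); split => //; first exact: filterI.
move=> v vAB; have Fv := svalP v.
by split; apply: filterS vAB => x [].
Qed.

HB.instance Definition _ :=
  isBaseTopological.Build (stoneCech D) sc_basic_cover sc_basic_join.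

Lemma open_sc_basic (A : set D) : open (sc_basic A).
Proof. by exists [set A] => //; rewrite bigcup_set1. Qed.

Definition sc_point (x : D) : stoneCech D := exist _ _ (principal_filter_ultra x).

Lemma closure_sc_pointE (A : set D) : closure (sc_point @` A) = sc_basic A.
Proof.
rewrite predeqE => u; have FF := svalP u; split.
  move=> uA; have [//|uA'] := in_ultra_setVsetC A FF.
  have /uA : nbhs u (sc_basic (~` A)).
    by apply: open_nbhs_nbhs; split => //; exact: open_sc_basic.
  by move=> [_ [[x Ax <-]]] /principal_filterP.
move=> uA U; rewrite nbhsE => -[_ [[I _ <-] [B IB uB]] sU].
have /filter_ex [x [Ax Bx]] : sval u (A `&` B) by exact: filterI.
exists (sc_point x); split; first by exists x.
by apply: sU; exists B => //; apply/principal_filterP.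
Qed.

End StoneCech.

Section StoneCechMap.
Variables (D D' : choiceType) (f : D -> D').

Lemma ultra_fmap (u : set_system D) : UltraFilter u -> UltraFilter (f @ u).
Proof.
move=> UF; split => [|H HF sH]; first exact: fmap_proper_filter.
rewrite eqEsubset; split => // B HB.
have [//|uB] := in_ultra_setVsetC (f @^-1` B) UF.
have : H (~` B) by apply: sH.
by move=> /(filterI HB); rewrite setICr => /filter_ex[].
Qed.

(* the continuous extension of f *)
Definition sc_map (u : stoneCech D) : stoneCech D' :=
  exist _ (f @ sval u) (ultra_fmap (svalP u)).

End StoneCechMap.

Section CoarseGroupoid.
Variables (R : realType) (X : metricType R).
Local Notation bX := (stoneCech X).
Local Notation bXX := (stoneCech (X * X)%type).

Definition entourage_le (r : R) : set (X * X) := [set p | mdist p.1 p.2 <= r].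

Definition coarse_arrows : set bXX :=
  \bigcup_(r in [set r : R | 0 < r]) closure (@sc_point _ @` entourage_le r).

Local Notation GX := (set_type coarse_arrows).

Definition cg_swap (p : X * X) : X * X := (p.2, p.1).
Definition cg_diag (x : X) : X * X := (x, x).

Lemma cg_inv_subproof (g : GX) : sc_map cg_swap (set_val g) \in coarse_arrows.
Proof.
apply/mem_set; have /set_mem [r r0] := valP g.
rewrite closure_sc_pointE => gr; exists r => //; rewrite closure_sc_pointE.
have FF := svalP (val g); apply: filterS gr => -[x y].
by rewrite /entourage_le /= metric_sym.
Qed.

Lemma cg_unit_subproof (u : bX) : sc_map cg_diag u \in coarse_arrows.
Proof.
apply/mem_set; exists 1 => //=; rewrite closure_sc_pointE.
have FF := svalP u; apply: filterS (filterT : sval u setT) => x _.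
by rewrite /entourage_le /= mdistxx.
Qed.

Definition cg_comp (S T : set (X * X)) : set (X * X) :=
  [set p | exists y, S (p.1, y) /\ T (y, p.2)].

(* The pair groupoid has range fst and source snd.
   The continuous extension of (x, y)(y, z) = (x, z): the product k of g and h
   is the limit of the products of composable pairs tending to (g, h), hence
   it is in the closure of ST for all S in g and T in h. *)
Definition cg_mul (g h : GX) : GX :=
  xget g [set k | forall S T, sval (set_val g) S -> sval (set_val h) T ->
                    sval (set_val k) (cg_comp S T)].

Definition coarse_groupoid : groupoid :=
  @Groupoid GX bX
    (fun g => sc_map snd (set_val g))
    (fun g => sc_map fst (set_val g))
    cg_mul
    (fun g => SigSub (cg_inv_subproof g))
    (fun u => SigSub (cg_unit_subproof u)).

End CoarseGroupoid.

Definition coarse_baum_connes_with_coefficients (R : realType)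
    (X : metricType R) : Prop :=
  exists Y : metricType R,
    [/\ uniformly_discrete Y, ulf Y, bij_coarsely_equivalent X Y &
        baum_connes_with_coefficients R (coarse_groupoid Y)].

(* Main.v *)
(* Both algebras are instances, for [p = fst] and [p = id], of the algebra [Roe p]
   attached to a map [p : I -> X]. It contains the rank one operators, so an
   isomorphism [phi : Roe p -> Roe q] is conjugation by a unitary [U], given by
   [U v = phi (|v><e|) eta] for a basis vector [e] and a unit vector [eta] in the
   range of the projection [phi (|e><e|)].

   Write [P_x] and [Q_y] for the projections onto the fibres. A family of operators
   [a_M], additive in [M] and strongly continuous, all of which are quasi-local, is
   uniformly quasi-local (gliding hump). Applied to the sign multipliers of [Y] cut
   down to one vector per fibre of [X], this says that [U^* u U e_x] is concentrated
   on a ball [B] around [x], of bounded cardinality and independent of the choice of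
   signs [u]. On the other hand some choice of signs gives
     [|P_B U^* u U e_x|^2 <= sum_y |P_B U^* Q_y U e_x|^2],
   so that [P_B U^* Q_y] cannot be small for all [y]: every [x] is near an [x'] with
   [|Q_y P_x'| >= d] for some [y] and a uniform [d]. This replaces any use of
   property A or of the Baum-Connes conjecture.

   Choosing such a [y] defines a map from [X] to [Y], and symmetrically one from [Y]
   to [X]. Uniform quasi-locality of the partial sums of [sum_n |v'_n><v_n|] shows
   that these maps are coarse and inverse to each other up to bounded distance; the
   sequences involved can be taken injective because the rows of an element of the
   Roe algebra are compact. *)

Require Import Defs.
From HB Require Import structures.
From mathcomp Require Import all_boot all_order all_algebra finmap.
From mathcomp Require Import complex.
From mathcomp Require Import all_classical all_reals all_analysis.
From mathcomp Require Import ring lra.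
Set Implicit Arguments.
Unset Strict Implicit.
Unset Printing Implicit Defensive.

Import Order.TTheory GRing.Theory Num.Theory.
Import numFieldNormedType.Exports.

Local Open Scope classical_set_scope.
Local Open Scope ring_scope.

(** * Real-valued modulus *)

Section ComplexNorm.
Variable R : realType.
Local Notation C := (Cplx R).

Definition RtoC (x : R) : C := real_complex R x.
Definition re (z : C) : R := complex.Re z.
Fact nc_key : unit. Proof. by []. Qed.
(** The modulus with values in [R] rather than in the complex field, so that estimates live in an
    ordered field where [lra] applies. *)
Definition nc (z : C) : R := locked_with nc_key (fun z : C => re `|z|) z.

HB.instance Definition _ :=
  GRing.isZmodMorphism.Build R C RtoC (raddfB (real_complex R)).
HB.instance Definition _ :=
  GRing.isMonoidMorphism.Build R C RtoC (rmorphism_monoidP (real_complex R)).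

Lemma RtoC_le (x y : R) : (RtoC x <= RtoC y) = (x <= y).
Proof. exact: lecR. Qed.
Lemma RtoC_lt (x y : R) : (RtoC x < RtoC y) = (x < y).
Proof. exact: ltcR. Qed.
Lemma RtoC_re (z : C) : 0 <= z -> RtoC (re z) = z.
Proof. by move=> z0; apply: RRe_real; exact: ger0_real. Qed.
Lemma RtoCK : cancel RtoC re. Proof. by []. Qed.
Lemma ncE (z : C) : `|z| = RtoC (nc z).
Proof. by rewrite /nc locked_withE RtoC_re. Qed.
Lemma nc_ge0 z : 0 <= nc z.
Proof. by rewrite -RtoC_le -ncE rmorph0. Qed.
Lemma ncM z w : nc (z * w) = nc z * nc w.
Proof. by apply: complexI; rewrite -/(RtoC _) -ncE normrM !ncE -rmorphM. Qed.
Lemma ncD z w : nc (z + w) <= nc z + nc w.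
Proof. by rewrite -RtoC_le rmorphD /= -!ncE ler_normD. Qed.
Lemma nc0 : nc 0 = 0. Proof. by rewrite /nc locked_withE normr0. Qed.
Lemma nc1 : nc 1 = 1. Proof. by rewrite /nc locked_withE normr1. Qed.
Lemma ncN z : nc (- z) = nc z. Proof. by rewrite /nc !locked_withE normrN. Qed.
Lemma nc_eq0 z : nc z = 0 -> z = 0.
Proof. by move=> h; apply: normr0_eq0; rewrite ncE h rmorph0. Qed.
Lemma nc_RtoC x : nc (RtoC x) = `|x|.
Proof.
apply: complexI; rewrite -/(RtoC _) -ncE.
have [x0|x0] := leP 0 x; first by rewrite !ger0_norm // -(rmorph0 RtoC) RtoC_le.
by rewrite !ltr0_norm ?rmorphN // -(rmorph0 RtoC) RtoC_lt.
Qed.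
Lemma ncJ z : nc (z^*) = nc z. Proof. by rewrite /nc !locked_withE norm_conjC. Qed.
Lemma conj_RtoC x : (RtoC x)^* = RtoC x.
Proof. by apply: conj_Creal; apply/complex_realP; exists x. Qed.
Lemma mul_conj z : z * z^* = RtoC (nc z ^+ 2).
Proof. by rewrite -normCK ncE rmorphXn. Qed.
Lemma reN z : re (- z) = - re z. Proof. by case: z. Qed.
Lemma re_le z : re z <= nc z.
Proof.
apply: (le_trans (ler_norm _)); rewrite -RtoC_le -ncE; exact: normc_ge_Re.
Qed.
Lemma RtoC_sqrt (x : R) : 0 <= x -> sqrtC (RtoC x) = RtoC (Num.sqrt x).
Proof.
move=> x0; rewrite -{1}(sqr_sqrtr x0) rmorphXn sqrCK //.
by rewrite -(rmorph0 RtoC) RtoC_le sqrtr_ge0.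
Qed.
End ComplexNorm.

(** * The Hilbert space of square-summable families *)

Section EllTwoTheory.
Variables (R : realType) (I : choiceType).
Local Notation C := (Cplx R).
Local Notation vec := (I -> C).
Implicit Types (f g : vec) (J K : {fset I}).

Definition ps f J : R := \sum_(i <- J) nc (f i) ^+ 2.
(* [l2], [sqn], [nrm] and [dot] are locked because [done] would otherwise unfold
   them down to filters and to the field structure of [R[i]]. *)
Fact l2_key : unit. Proof. by []. Qed.
Definition l2 f : Prop := locked_with l2_key (@ell2 R I) f.
Lemma l2E : l2 = @ell2 R I :> (vec -> Prop).
Proof. by rewrite /l2 locked_withE. Qed.
Definition sqn f : R := locked_with l2_key (fun f => sup (range (ps f))) f.
Lemma sqnE f : sqn f = sup (range (ps f)).
Proof. by rewrite /sqn locked_withE. Qed.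
Definition nrm f : R := locked_with l2_key (fun f => Num.sqrt (sqn f)) f.
Lemma nrmE f : nrm f = Num.sqrt (sqn f).
Proof. by rewrite /nrm locked_withE. Qed.
Definition dot f g : C := locked_with l2_key (@l2dot R I) f g.
Lemma dotE f g : dot f g = l2dot f g.
Proof. by rewrite /dot locked_withE. Qed.

Lemma ps_ge0 f J : 0 <= ps f J.
Proof. by apply: sumr_ge0 => i _; exact: sqr_ge0. Qed.

Lemma ler_fsum (F : I -> R) J K : (forall i, 0 <= F i) -> (J `<=` K)%fset ->
  \sum_(i <- J) F i <= \sum_(i <- K) F i.
Proof.
move=> F0 JK; have -> : \sum_(i <- J) F i = \sum_(i <- K) if i \in J then F i else 0.
  rewrite -(big_fset_incl _ JK) => [|i _ /negbTE -> //].
  by apply: eq_big_seq => i ->.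
by apply: ler_sum => i _; case: ifP.
Qed.

Lemma ps_le f J K : (J `<=` K)%fset -> ps f J <= ps f K.
Proof. by apply: ler_fsum => i; exact: sqr_ge0. Qed.

#[global] Instance fsf_filter : ProperFilter (@finite_sets_filter I).
Proof.
apply: filter_from_proper; last by move=> J _; exists J => /=.
apply: filter_from_filter; first by exists fset0.
move=> J K _ _; exists (J `|` K)%fset => // L /=.
by rewrite fsubUset => /andP[].
Qed.

Definition cvgs (F : vec) (l : C) : Prop :=
  (\sum_(i <- J) F i) @[J --> @finite_sets_filter I] --> l.

Lemma sum_normE f J : \sum_(i <- J) `|f i| ^+ 2 = RtoC (ps f J).
Proof. by rewrite rmorph_sum; apply: eq_bigr => i _; rewrite ncE -rmorphXn. Qed.

Lemma ps_has_sup f (M : R) : (forall J, ps f J <= M) -> has_sup (range (ps f)).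
Proof.
move=> fM; split; first by exists (ps f fset0), fset0.
by exists M => _ [J _ <-].
Qed.

(** Monotone convergence for nets: the partial sums increase with the finite set, so once one of
    them is within [e] of the supremum, so are all the later ones. *)
Lemma ps_cvg f (M : R) : (forall J, ps f J <= M) ->
  cvgs (fun i => `|f i| ^+ 2) (RtoC (sqn f)).
Proof.
move=> fM; have hs := ps_has_sup fM.
apply/cvgrPdist_lt => e e0.
have re0 : 0 < re e by rewrite -RtoC_lt rmorph0 RtoC_re ?ltW.
have [_ [K _ <-] hK] := sup_adherent re0 hs.
exists K => // J /= KJ; rewrite sqnE.
rewrite sum_normE -rmorphB ncE nc_RtoC -[e]RtoC_re ?ltW // RtoC_lt.
have : ps f J <= sup (range (ps f)) by apply: (sup_ubound (proj2 hs)); exists J.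
move=> h; rewrite ger0_norm ?subr_ge0 //.
have := ps_le f KJ; lra.
Qed.

(** A convergent net need not be bounded, but here every [J] lies in some [K] joined with [J], where
    [K] is a stage after which the sums stay within 1 of the limit, and partial sums are
    monotone. *)
Lemma l2P f : l2 f <-> exists M : R, forall J, ps f J <= M.
Proof.
rewrite l2E; split=> [cf|[M fM]]; last by apply/cvg_ex; exists (RtoC (sqn f)); exact: ps_cvg fM.
have /cvg_ex [l] := cf.
move=> /cvgrPdist_lt /(_ 1 ltr01) [K _ hK].
exists (nc l + 1) => J.
have := hK (K `|` J)%fset (fsubsetUl _ _).
rewrite /= sum_normE ncE -(rmorph1 (@RtoC R)) RtoC_lt => /ltW h.
apply: (le_trans (ps_le f (fsubsetUr K J))).
rewrite -[ps _ _]ger0_norm ?ps_ge0 // -nc_RtoC.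
set z := RtoC _ in h *.
have -> : z = l + (- (l - z)) by rewrite opprB addrC subrK.
by apply: (le_trans (ncD _ _)); rewrite ncN lerD2l.
Qed.

Lemma ps_sqn f J : l2 f -> ps f J <= sqn f.
Proof. by move=> /l2P [M fM]; rewrite sqnE; apply: (sup_ubound (proj2 (ps_has_sup fM))); exists J. Qed.

Lemma sqn_le f (M : R) : (forall J, ps f J <= M) -> sqn f <= M.
Proof.
move=> fM; rewrite sqnE; apply: ge_sup; first by exists (ps f fset0), fset0.
by move=> _ [J _ <-].
Qed.

Lemma sqn_adh f (e : R) : l2 f -> 0 < e -> exists J, sqn f - e < ps f J.
Proof.
move=> /l2P [M fM] e0.
by have [_ [K _ <-] hK] := sup_adherent e0 (ps_has_sup fM); rewrite sqnE; exists K.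
Qed.

Lemma cvgs_sqn f : l2 f -> cvgs (fun i => `|f i| ^+ 2) (RtoC (sqn f)).
Proof. by move=> /l2P [M]; exact: ps_cvg. Qed.

Lemma usumE (F : vec) l : cvgs F l -> usum F = l.
Proof. by move=> h; apply: cvg_lim => //; exact: norm_hausdorff. Qed.

Lemma sqn_ge0 f : l2 f -> 0 <= sqn f.
Proof. by move=> hf; apply: (le_trans (ps_ge0 f fset0)); exact: ps_sqn. Qed.

Lemma nrm_ge0 f : 0 <= nrm f. Proof. by rewrite nrmE sqrtr_ge0. Qed.

Lemma nrm_sqr f : l2 f -> nrm f ^+ 2 = sqn f.
Proof. by move=> hf; rewrite nrmE sqr_sqrtr // sqn_ge0. Qed.

Lemma l2normE f : l2 f -> l2norm f = RtoC (nrm f).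
Proof.
by move=> hf; rewrite nrmE /l2norm (usumE (cvgs_sqn hf)) RtoC_sqrt // sqn_ge0.
Qed.

Lemma cvg_ext (S T : {fset I} -> C) (l : C) : S =1 T ->
  S J @[J --> @finite_sets_filter I] --> l -> T J @[J --> @finite_sets_filter I] --> l.
Proof. by move=> /funext ->. Qed.

Lemma cvgsP (c : C) (F G : vec) (l m : C) : cvgs F l -> cvgs G m ->
  cvgs (fun i => c * F i + G i) (c * l + m).
Proof.
move=> hF hG; have FF : Filter (@finite_sets_filter I) by exact: filter_filter.
have h1 := @cvgMl_tmp C {fset I} (@finite_sets_filter I) FF _ c _ hF.
have h2 := @cvgD C C {fset I} (@finite_sets_filter I) FF _ _ _ _ h1 hG.
suff e : (fun J : {fset I} => c * \sum_(i <- J) F i + \sum_(i <- J) G i) =1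
    (fun J : {fset I} => \sum_(i <- J) (c * F i + G i)) by exact: (cvg_ext e h2).
move=> J; by rewrite big_split /= -mulr_sumr.
Qed.

Lemma l2_0 : l2 (0 : vec).
Proof.
by apply/l2P; exists 0 => J; rewrite /ps big1 // => i _; rewrite nc0 expr0n.
Qed.

Lemma l2_lin (c : C) f g : l2 f -> l2 g -> l2 (c *: f + g).
Proof.
move=> /l2P[M fM] /l2P[N gN]; apply/l2P.
exists (2 * (nc c ^+ 2 * M + N)) => J.
apply: (@le_trans _ _ (\sum_(i <- J) 2 * (nc c ^+ 2 * nc (f i) ^+ 2 + nc (g i) ^+ 2))).
  apply: ler_sum => i _.
  have := ncD (c * f i) (g i); rewrite ncM.
  have := nc_ge0 (c * f i + g i); rewrite -[(c *: f + g) i]/(c * f i + g i).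
  set a := nc (_ + _); set b := nc c; set d := nc (f i); set e := nc (g i) => a0 ha.
  have : a ^+ 2 <= (b * d + e) ^+ 2 by rewrite ler_sqr ?nnegrE // (le_trans a0).
  have := sqr_ge0 (b * d - e); lra.
rewrite -mulr_sumr big_split /= -mulr_sumr.
rewrite ler_pM2l //; apply: lerD; last exact: gN.
by apply: ler_wpM2l (fM J); exact: sqr_ge0.
Qed.

Lemma l2D f g : l2 f -> l2 g -> l2 (f + g).
Proof. by move=> hf hg; rewrite -[f]scale1r; exact: l2_lin. Qed.
Lemma l2Z c f : l2 f -> l2 (c *: f).
Proof. by move=> hf; have := @l2_lin c f 0 hf l2_0; rewrite addr0. Qed.
Lemma l2N f : l2 f -> l2 (- f).
Proof. by rewrite -scaleN1r; exact: l2Z. Qed.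
Lemma l2B f g : l2 f -> l2 g -> l2 (f - g).
Proof. by move=> hf hg; apply: l2D => //; exact: l2N. Qed.

(** Polarization: the product is one quarter of the sum of [c * |f i + c * g i|^2] over the four
    fourth roots of unity [c], and each of these families is already known to be summable. *)
Lemma cvgs_dot0 f g : l2 f -> l2 g -> exists l, cvgs (fun i => f i * (g i)^*) l.
Proof.
move=> hf hg.
have h (c : C) : exists l, cvgs (fun i => `|f i + c * g i| ^+ 2) l.
  have := cvgs_sqn (l2D hf (l2Z c hg)) => /[dup] hh _; eexists; exact: hh.
have hz : cvgs (fun=> 0) (0 : C).
  rewrite /cvgs; under eq_fun do rewrite big1 //; exact: cvg_cst.
have [l1 h1] := h 1; have [l2 h2] := h (-1).
have [l3 h3] := h 'i; have [l4 h4] := h (- 'i).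
have hs := @cvgsP 4^-1 _ _ _ _ h1 (@cvgsP (- 4^-1) _ _ _ _ h2
  (@cvgsP ('i / 4) _ _ _ _ h3 (@cvgsP (- ('i / 4)) _ _ _ _ h4 hz))).
eexists; move: hs; congr (cvgs _ _); apply/funext => i.
rewrite !normCK !rmorphD !rmorphM !rmorphN !rmorph1 /= conjCi.
have i2 : 'i * 'i = -1 :> C by rewrite -expr2 sqrCi.
set z := f i; set w := g i; set zb := z^*; set wb := w^*; set j : C := 'i in i2 *.
by field: i2.
Qed.

Lemma cvgs_dot f g : l2 f -> l2 g ->
  cvgs (fun i => f i * (g i)^*) (dot f g).
Proof. by move=> hf hg; have [l hl] := cvgs_dot0 hf hg; rewrite dotE /l2dot (usumE hl). Qed.

Lemma dotPl c f g h : l2 f -> l2 g -> l2 h ->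
  dot (c *: f + g) h = c * dot f h + dot g h.
Proof.
move=> hf hg hh; rewrite dotE; apply: usumE.
have := @cvgsP c _ _ _ _ (cvgs_dot hf hh) (cvgs_dot hg hh).
congr (cvgs _ _); apply/funext => i.
by rewrite -[(c *: f + g) i]/(c * f i + g i) mulrDl mulrA.
Qed.

Lemma dotC f g : l2 f -> l2 g -> dot f g = (dot g f)^*.
Proof.
move=> hf hg; rewrite dotE; apply: usumE.
have := cvgs_dot hg hf => /cvgrPdist_lt h.
apply/cvgrPdist_lt => e e0; apply: filterS (h e e0) => J /=.
rewrite -norm_conjC rmorphB /= rmorph_sum /=.
congr (`| _ - _ | < e); apply: eq_bigr => i _.
by rewrite rmorphM /= conjCK mulrC.
Qed.

Lemma dotff f : l2 f -> dot f f = RtoC (sqn f).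
Proof.
move=> hf; rewrite dotE; apply: usumE; have := cvgs_sqn hf; congr (cvgs _ _).
by apply/funext => i; rewrite normCK.
Qed.

Lemma dotPr c f g h : l2 f -> l2 g -> l2 h ->
  dot h (c *: f + g) = c^* * dot h f + dot h g.
Proof.
move=> hf hg hh; rewrite dotC // ?dotPl //; last exact: l2_lin.
by rewrite rmorphD rmorphM /= -!dotC.
Qed.

Lemma dotDl f g h : l2 f -> l2 g -> l2 h ->
  dot (f + g) h = dot f h + dot g h.
Proof. by move=> hf hg hh; rewrite -[f in LHS]scale1r dotPl // mul1r. Qed.
Lemma dotDr f g h : l2 f -> l2 g -> l2 h ->
  dot h (f + g) = dot h f + dot h g.
Proof. by move=> hf hg hh; rewrite -[f in LHS]scale1r dotPr // rmorph1 mul1r. Qed.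
Lemma dot0l h : l2 h -> dot 0 h = 0.
Proof.
move=> hh; apply: (addrI (dot 0 h)); rewrite -dotDl ?addr0 //; exact: l2_0.
Qed.
Lemma dot0r h : l2 h -> dot h 0 = 0.
Proof. by move=> hh; rewrite dotC ?dot0l ?rmorph0 //; exact: l2_0. Qed.
Lemma dotZl c f h : l2 f -> l2 h -> dot (c *: f) h = c * dot f h.
Proof.
by move=> hf hh; rewrite -[c *: f]addr0 dotPl ?dot0l ?addr0 //; exact: l2_0.
Qed.
Lemma dotZr c f h : l2 f -> l2 h -> dot h (c *: f) = c^* * dot h f.
Proof.
by move=> hf hh; rewrite -[c *: f]addr0 dotPr ?dot0r ?addr0 //; exact: l2_0.
Qed.

Lemma sqnD f g : l2 f -> l2 g ->
  sqn (f + g) = sqn f + sqn g + 2 * re (dot f g).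
Proof.
move=> hf hg; apply: (@complexI R).
rewrite -!/(RtoC _) -dotff; last exact: l2D.
have hfg := l2D hf hg.
rewrite dotDl // !dotDr // !dotff // !rmorphD rmorphM rmorph_nat /= (dotC hg hf).
suff -> : 2 * RtoC (re (dot f g)) = dot f g + (dot f g)^*.
  by ring.
by have := addcJ (dot f g).
Qed.

Lemma sqnZ c f : l2 f -> sqn (c *: f) = nc c ^+ 2 * sqn f.
Proof.
move=> hf; apply: (@complexI R); have hcf := l2Z c hf.
rewrite -!/(RtoC _) -dotff // dotZl // dotZr // dotff // mulrA mul_conj.
by rewrite -rmorphM.
Qed.

Lemma nrmZ c f : l2 f -> nrm (c *: f) = nc c * nrm f.
Proof.
move=> hf; by rewrite !nrmE sqnZ // sqrtrM ?sqr_ge0 // sqrtr_sqr ger0_norm // nc_ge0.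
Qed.

Lemma nrmN f : l2 f -> nrm (- f) = nrm f.
Proof. by move=> hf; rewrite -scaleN1r nrmZ // ncN nc1 mul1r. Qed.

Lemma sqn0 : sqn 0 = 0.
Proof. by apply: (@complexI R); rewrite -/(RtoC _) -dotff ?dot0l //; exact: l2_0. Qed.
Lemma nrm0 : nrm 0 = 0. Proof. by rewrite nrmE sqn0 sqrtr0. Qed.

Lemma sqn_eq0 f : l2 f -> sqn f = 0 -> f = 0.
Proof.
move=> hf h; apply/funext => i; apply: nc_eq0.
have := ps_sqn [fset i]%fset hf; rewrite h /ps big_seq_fset1 => hi.
by apply/eqP; rewrite -sqrf_eq0 eq_le hi sqr_ge0.
Qed.
Lemma nrm_eq0 f : l2 f -> nrm f = 0 -> f = 0.
Proof. by move=> hf h; apply: sqn_eq0 => //; rewrite -nrm_sqr // h expr0n. Qed.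

Lemma cauchy_schwarz f g : l2 f -> l2 g -> nc (dot f g) <= nrm f * nrm g.
Proof.
move=> hf hg.
have [g0|g0] := eqVneq (nrm g) 0.
  by rewrite (nrm_eq0 hg g0) dot0r // nc0 nrm0 mulr0.
have gp : 0 < sqn g by rewrite -nrm_sqr // exprn_even_gt0.
set d := dot f g.
(* The coefficient for which [f + c *: g] is orthogonal to [g]. *)
pose c := - (d * RtoC (sqn g)^-1).
have := sqn_ge0 (l2D hf (l2Z c hg)).
rewrite sqnD //; last exact: l2Z.
rewrite sqnZ // dotZr // -/d /c rmorphN rmorphM /= conj_RtoC.
rewrite mulNr reN ncN ncM nc_RtoC.
have -> : d^* * RtoC (sqn g)^-1 * d = RtoC (nc d ^+ 2 * (sqn g)^-1).
  by rewrite rmorphM /= -mul_conj; ring.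
rewrite RtoCK ger0_norm ?invr_ge0 ?(ltW gp) // => h.
have : nc d ^+ 2 <= sqn f * sqn g.
  suff : nc d ^+ 2 / sqn g <= sqn f by rewrite ler_pdivrMr.
  move: h; rewrite exprMn [X in _ * X * _]expr2.
  have -> : nc d ^+ 2 * ((sqn g)^-1 * (sqn g)^-1) * sqn g = nc d ^+ 2 / sqn g.
    by field; rewrite gt_eqF.
  lra.
rewrite -!nrm_sqr // -exprMn ler_sqr ?nnegrE ?nc_ge0 //.
by rewrite mulr_ge0 ?nrm_ge0.
Qed.

Lemma ler_nrmD f g : l2 f -> l2 g -> nrm (f + g) <= nrm f + nrm g.
Proof.
move=> hf hg; rewrite -ler_sqr ?nnegrE ?addr_ge0 ?nrm_ge0 //.
rewrite nrm_sqr; last exact: l2D.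
rewrite sqnD // -!nrm_sqr //.
have := le_trans (re_le _) (cauchy_schwarz hf hg); lra.
Qed.

Lemma ler_nrmB f g : l2 f -> l2 g -> nrm (f - g) <= nrm f + nrm g.
Proof. by move=> hf hg; rewrite -(nrmN hg); apply: ler_nrmD => //; exact: l2N. Qed.

Lemma nrm_le_ps f (M : R) : 0 <= M -> (forall J, ps f J <= M ^+ 2) -> nrm f <= M.
Proof.
move=> M0 h; rewrite nrmE -(ger0_norm M0) -sqrtr_sqr; apply: ler_wsqrtr.
exact: sqn_le.
Qed.

End EllTwoTheory.

(** * Restriction of vectors to subsets of the index set, and basis vectors *)

Section Restriction.
Variables (R : realType) (I : choiceType).
Local Notation C := (Cplx R).
Local Notation vec := (I -> C).
Local Notation op := (vec -> vec).
Implicit Types (f g : vec) (J : {fset I}) (S : set I).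

Lemma sqn_mono f g : l2 g -> (forall i, nc (f i) <= nc (g i)) ->
  l2 f /\ sqn f <= sqn g.
Proof.
move=> hg h; have hle J : ps f J <= sqn g.
  apply: le_trans (ps_sqn J hg); apply: ler_sum => i _.
  by rewrite ler_sqr ?nnegrE ?nc_ge0.
by split; [apply/l2P; exists (sqn g) | exact: sqn_le].
Qed.

Definition res S f : vec := fun i => if `[< S i >] then f i else 0.

Lemma resE S f i : S i -> res S f i = f i.
Proof. by rewrite /res => /asboolT ->. Qed.
Lemma resF S f i : ~ S i -> res S f i = 0.
Proof. by rewrite /res => /asboolF ->. Qed.

Lemma nc_res S f i : nc (res S f i) <= nc (f i).
Proof. by rewrite /res; case: ifP => // _; rewrite nc0 nc_ge0. Qed.
Lemma l2_res S f : l2 f -> l2 (res S f).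
Proof. by move=> hf; have [] := sqn_mono hf (nc_res S f). Qed.
Lemma sqn_res_le S f : l2 f -> sqn (res S f) <= sqn f.
Proof. by move=> hf; have [] := sqn_mono hf (nc_res S f). Qed.
Lemma nrm_mono f g : l2 g -> (forall i, nc (f i) <= nc (g i)) -> nrm f <= nrm g.
Proof. by move=> hg h; rewrite !nrmE ler_wsqrtr //; have [] := sqn_mono hg h. Qed.
Lemma nrm_res_le S f : l2 f -> nrm (res S f) <= nrm f.
Proof. by move=> hf; apply: nrm_mono => // i; exact: nc_res. Qed.
Lemma nrm_res_sub S S' f : l2 f -> S `<=` S' -> nrm (res S f) <= nrm (res S' f).
Proof.
move=> hf sS; apply: nrm_mono; first exact: l2_res.
move=> i; have [Si|Si] := pselect (S i); first by rewrite !resE //; exact: sS.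
by rewrite resF // nc0 nc_ge0.
Qed.

Lemma res_lin S (c : C) f g : res S (c *: f + g) = c *: res S f + res S g.
Proof.
apply/funext => i; rewrite -[RHS]/(c * res S f i + res S g i) /res.
by case: ifP => // _; rewrite mulr0 addr0.
Qed.
Lemma resD S f g : res S (f + g) = res S f + res S g.
Proof. by rewrite -[f in LHS]scale1r res_lin scale1r. Qed.
Lemma res0 S : res S (0 : vec) = 0.
Proof. by apply/funext => i; rewrite /res; case: ifP. Qed.
Lemma resZ S (c : C) f : res S (c *: f) = c *: res S f.
Proof. by rewrite -[c *: f]addr0 res_lin res0 addr0. Qed.
Lemma resB S f g : res S (f - g) = res S f - res S g.
Proof. by rewrite resD -scaleN1r resZ scaleN1r. Qed.
Lemma res_res S S' f : res S (res S' f) = res (S `&` S') f.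
Proof.
apply/funext => i; rewrite /res asbool_and.
by case: `[< S i >]; case: `[< S' i >].
Qed.
Lemma resC S f : res S f + res (~` S) f = f.
Proof.
apply/funext => i; rewrite -[LHS]/(res S f i + res (~` S) f i).
have [Si|Si] := pselect (S i); first by rewrite resE // resF ?addr0.
by rewrite resF // resE // add0r.
Qed.
Lemma res_id S f : (forall i, ~ S i -> f i = 0) -> res S f = f.
Proof.
move=> h; apply/funext => i; have [Si|Si] := pselect (S i); first exact: resE.
by rewrite resF // h.
Qed.
Lemma res_eq0 S f : (forall i, S i -> f i = 0) -> res S f = 0.
Proof.
move=> h; apply/funext => i; have [Si|Si] := pselect (S i); first by rewrite resE ?h.
by rewrite resF.
Qed.

Lemma dot_eq f g f' g' : (forall i, f i * (g i)^* = f' i * (g' i)^*) ->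
  dot f g = dot f' g'.
Proof. by move=> h; rewrite !dotE /l2dot; congr usum; apply/funext. Qed.

Lemma dot_res S f g : dot (res S f) g = dot f (res S g).
Proof.
apply: dot_eq => i; rewrite /res; case: ifP => // _.
by rewrite rmorph0 mul0r mulr0.
Qed.
Lemma dot_res2 S f g : dot (res S f) (res S g) = dot f (res S g).
Proof. by rewrite dot_res res_res setIid. Qed.
Lemma dot_disj f g : (forall i, f i = 0 \/ g i = 0) -> dot f g = 0.
Proof.
move=> h; rewrite -[RHS](@dot0l _ _ (0 : vec)); last exact: l2_0.
by apply: dot_eq => i; rewrite mul0r; have [->|->] := h i; rewrite ?rmorph0 ?mul0r ?mulr0.
Qed.

Lemma sqn_resC S f : l2 f -> sqn f = sqn (res S f) + sqn (res (~` S) f).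
Proof.
move=> hf; rewrite -{1}(resC S f) sqnD; [|exact: l2_res..].
rewrite dot_disj ?mulr0 ?addr0 // => i.
by have [Si|Si] := pselect (S i); [right|left]; rewrite resF.
Qed.

Lemma sqn_resU S S' f : l2 f -> S `&` S' = set0 ->
  sqn (res (S `|` S') f) = sqn (res S f) + sqn (res S' f).
Proof.
move=> hf dS; rewrite (sqn_resC S (l2_res _ hf)) !res_res; congr (sqn (res _ _) + sqn (res _ _)).
  by rewrite setIUr setIid setUidl //; exact: subIsetl.
rewrite setIUr setICl set0U; apply/seteqP; split=> [i []//|i S'i]; split => // Si.
by have : (S `&` S') i by []; rewrite dS.
Qed.

Lemma l2_tail f (e : R) : l2 f -> 0 < e ->
  exists J, nrm (res [set i | i \notin J] f) <= e.
Proof.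
move=> hf e0; have [J hJ] := sqn_adh hf (exprn_gt0 2 e0); exists J.
rewrite nrmE -(ger0_norm (ltW e0)) -sqrtr_sqr ler_wsqrtr //.
have := sqn_resC [set i | i \in J] hf.
have -> : ~` [set i | i \in J] = [set i | i \notin J].
  by apply/seteqP; split => i /= /negP.
have : ps f J <= sqn (res [set i | i \in J] f).
  apply: le_trans (ps_sqn J (l2_res _ hf)); rewrite /ps le_eqVlt; apply/orP; left.
  by apply/eqP; apply: eq_big_seq => i iJ; rewrite resE.
lra.
Qed.

Definition delta (i0 : I) : vec := fun i => if i == i0 then 1 else 0.

Lemma delta_fin i0 J : ps (delta i0) J <= 1.
Proof.
rewrite (le_trans (ps_le _ (fsubsetUr [fset i0]%fset J))) //.
rewrite /ps -(big_fset_incl _ (fsubsetUl [fset i0]%fset J)).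
  by rewrite big_seq_fset1 /delta eqxx nc1 expr1n.
by move=> i _; rewrite inE /delta => /negbTE ->; rewrite nc0 expr0n.
Qed.
Lemma l2_delta i0 : l2 (delta i0).
Proof. by apply/l2P; exists 1; exact: delta_fin. Qed.
Lemma nrm_delta i0 : nrm (delta i0) = 1.
Proof.
have h : sqn (delta i0) = 1; last by rewrite nrmE h sqrtr1.
apply/eqP; rewrite eq_le sqn_le; last exact: delta_fin.
have := ps_sqn [fset i0]%fset (l2_delta i0).
by rewrite /ps big_seq_fset1 /delta eqxx nc1 expr1n.
Qed.

Lemma sum_res_le (X : choiceType) (p : I -> X) (s : seq X) f : l2 f -> uniq s ->
  \sum_(x <- s) sqn (res [set i | p i = x] f) = sqn (res [set i | p i \in s] f).
Proof.
move=> hf; elim: s => [_|x s IH /= /andP[xs us]].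
  by rewrite big_nil res_eq0 ?sqn0.
rewrite big_cons IH // -sqn_resU //.
  congr (sqn (res _ f)); apply/seteqP; split => i /=; rewrite inE.
    by case=> [->|->]; rewrite ?eqxx ?orbT.
  by case/orP => [/eqP|]; [left|right].
by apply/seteqP; split => // i [/= ->]; rewrite (negbTE xs).
Qed.

Lemma sum_sqn_res_le (X : choiceType) (p : I -> X) (s : seq X) f : l2 f -> uniq s ->
  \sum_(x <- s) sqn (res [set i | p i = x] f) <= sqn f.
Proof. by move=> hf us; rewrite sum_res_le // sqn_res_le. Qed.

End Restriction.

(** * Bounded operators *)

Section Operators.
Variables (R : realType) (I : choiceType).
Local Notation C := (Cplx R).
Local Notation vec := (I -> C).
Local Notation op := (vec -> vec).
Implicit Types (f g : vec) (T : op).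

Definition bounded_map T : Prop :=
  [/\ forall f, ~ l2 f -> T f = 0,
      forall f, l2 f -> l2 (T f),
      forall (c : C) f g, l2 f -> l2 g -> T (c *: f + g) = c *: T f + T g &
      exists2 M : R, 0 <= M & forall f, l2 f -> nrm (T f) <= M * nrm f].

Lemma RtoC_le_nc (x : R) (z : C) : 0 <= x -> RtoC x <= z -> x <= nc z.
Proof.
move=> x0 h; rewrite -RtoC_le -ncE ger0_norm //.
by apply: le_trans h; rewrite -(rmorph0 (@RtoC R)) RtoC_le.
Qed.

Lemma bopP T : bounded_op T <-> bounded_map T.
Proof.
rewrite /bounded_op /= -l2E; split=> [[h1 h2 h3 [M hM]]|[h1 h2 h3 [M _ hM]]]; split => //.
  exists (nc M) => [|f hf]; first exact: nc_ge0.
  have := hM f hf; rewrite (l2normE hf) (l2normE (h2 f hf)).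
  move=> /(RtoC_le_nc (nrm_ge0 _)); rewrite ncM nc_RtoC ger0_norm //.
  exact: nrm_ge0.
exists (RtoC M) => f hf; rewrite (l2normE hf) (l2normE (h2 f hf)).
by rewrite -rmorphM RtoC_le hM.
Qed.

Lemma op_adjointP (S T : op) : op_adjoint S T <->
  forall f g, l2 f -> l2 g -> dot (T f) g = dot f (S g).
Proof.
by rewrite /op_adjoint -l2E; split=> h f g hf hg; have := h f g hf hg; rewrite !dotE.
Qed.

Lemma bop0 T : bounded_map T -> T 0 = 0.
Proof.
move=> [_ _ h _]; apply: (addrI (T 0)).
by have := h 1 0 0 (@l2_0 _ _) (@l2_0 _ _); rewrite !scale1r !addr0.
Qed.
Lemma bopD T f g : bounded_map T -> l2 f -> l2 g -> T (f + g) = T f + T g.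
Proof. by move=> [_ _ h _] hf hg; have := h 1 f g hf hg; rewrite !scale1r. Qed.
Lemma bopZ T (c : C) f : bounded_map T -> l2 f -> T (c *: f) = c *: T f.
Proof.
move=> hT hf; have [_ _ h _] := hT.
by have := h c f 0 hf (@l2_0 _ _); rewrite (bop0 hT) !addr0.
Qed.
Lemma bop_l2 T f : bounded_map T -> l2 f -> l2 (T f).
Proof. by move=> [_ h _ _]; exact: h. Qed.

Lemma norm_closureP (A : set op) T : A `<=` bounded_map -> norm_closure A T <->
  bounded_map T /\ forall e : R, 0 < e -> exists2 S, A S &
    forall f, l2 f -> nrm (T f - S f) <= e * nrm f.
Proof.
move=> Ab; split=> [[/bopP bT h]|[bT h]].
  split; first exact: bT.
  move=> e e0; have [|S AS hS] := h (RtoC e).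
    by rewrite -(rmorph0 (@RtoC R)) RtoC_lt.
  exists S => // f hf; have := hS f; rewrite -l2E => /(_ hf).
  have hTS : l2 (T f - S f) by apply: l2B; apply: bop_l2 => //; exact: Ab.
  by rewrite (l2normE hf) (l2normE hTS) -rmorphM RtoC_le.
split; first exact/bopP.
move=> e e0; have [|S AS hS] := h (re e).
  by rewrite -RtoC_lt rmorph0 RtoC_re // ltW.
exists S => // f; rewrite -l2E => hf; have := hS f hf.
have hTS : l2 (T f - S f) by apply: l2B; apply: bop_l2 => //; exact: Ab.
by rewrite (l2normE hf) (l2normE hTS) -RtoC_le rmorphM /= RtoC_re // ltW.
Qed.

Lemma bop_res (S : set I) T : bounded_map T -> bounded_map (res S \o T).
Proof.
move=> hT; have [h1 h2 h3 [M M0 hM]] := hT; split => /=.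
- by move=> f hf; rewrite h1 // res0.
- by move=> f hf; apply: l2_res; exact: h2.
- by move=> c f g hf hg; rewrite h3 // res_lin.
- exists M => // f hf; apply: le_trans (hM f hf); apply: nrm_res_le; exact: h2.
Qed.

(** The operator [|v><w|], set to 0 off [l2] as [bounded_map] demands. *)
Definition rank1 (v w : vec) : op :=
  fun f => if `[< l2 f >] then dot f w *: v else 0.

Lemma rank1E v w f : l2 f -> rank1 v w f = dot f w *: v.
Proof. by rewrite /rank1 => /asboolT ->. Qed.
Lemma rank1F v w f : ~ l2 f -> rank1 v w f = 0.
Proof. by rewrite /rank1 => /asboolF ->. Qed.

Lemma bop_rank1 v w : l2 v -> l2 w -> bounded_map (rank1 v w).
Proof.
move=> hv hw; split.
- by move=> f; exact: rank1F.
- by move=> f hf; rewrite rank1E //; exact: l2Z.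
- move=> c f g hf hg; rewrite !rank1E //; last exact: l2_lin.
  by rewrite dotPl // scalerDl scalerA.
- exists (nrm w * nrm v) => [|f hf]; first by rewrite mulr_ge0 ?nrm_ge0.
  rewrite rank1E // nrmZ //; have := cauchy_schwarz hf hw => h.
  by rewrite mulrAC [nrm w * _]mulrC ler_wpM2r ?nrm_ge0.
Qed.

Lemma rank1_adjoint v w : l2 v -> l2 w -> op_adjoint (rank1 w v) (rank1 v w).
Proof.
move=> hv hw; apply/op_adjointP => f g hf hg; rewrite !rank1E //.
by rewrite dotZl // dotZr // -dotC // mulrC.
Qed.

End Operators.

Lemma homo_ge_id (k : nat -> nat) : {homo k : m n / (m < n)%N} -> forall n, (n <= k n)%N.
Proof. by move=> hk; elim=> // n IH; apply: leq_ltn_trans IH (hk _ _ _). Qed.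

(** * Compactness of rank one operators *)

Section Compact.
Variables (R : realType) (I : choiceType).
Local Notation C := (Cplx R).
Local Notation vec := (I -> C).
Local Notation op := (vec -> vec).
Implicit Types (f g : vec) (T : op).

Lemma bolzano_weierstrass_homo (u : nat -> R) (M : R) : (forall n, `|u n| <= M) ->
  exists2 k : nat -> nat, {homo k : m n / (m < n)%N} &
  exists a : R, forall e : R, 0 < e -> exists N, forall n, (N <= n)%N -> `|u (k n) - a| <= e.
Proof.
move=> hu.
have [|k ki /cvg_ex[a ha]] := @bolzano_weierstrass R u.
  exists M; split; first exact: num_real.
  by move=> x Mx n _ /=; apply: le_trans (hu n) (ltW Mx).
exists k; first by move=> m n mn; have := leW_mono ki m n; rewrite !ltEnat /= => ->.
exists a => e e0; have /cvgrPdist_le /(_ e e0) [N _ hN] := ha.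
by exists N => n Nn; rewrite distrC; exact: hN.
Qed.

Lemma nc_re_im (z : C) : nc z <= `|complex.Re z| + `|complex.Im z|.
Proof.
case: z => a b /=.
rewrite -RtoC_le -ncE; have := normc_def (a +i* b)%C => /= ->.
rewrite -/(RtoC _) RtoC_le -(ger0_norm (addr_ge0 (normr_ge0 a) (normr_ge0 b))).
rewrite -sqrtr_sqr ler_wsqrtr // sqrrD !real_normK ?num_real //.
by rewrite -addrA lerD2l addrC lerDl mulrn_wge0 // mulr_ge0.
Qed.

Lemma nc_ge_im (z : C) : `|complex.Im z| <= nc z.
Proof.
rewrite -RtoC_le -ncE; case: z => a b /=; have := normc_def (a +i* b)%C => /= ->.
by rewrite -/(RtoC _) RtoC_le -sqrtr_sqr ler_wsqrtr // lerDr sqr_ge0.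
Qed.

(** The images of the unit ball are multiples of [v] with coefficients bounded by [nrm w];
    Bolzano-Weierstrass is applied to the real parts, then along that subsequence to the imaginary
    parts. The formula for [T] is assumed on [l2] only, so that blocks, which may be nonzero
    elsewhere, are covered. *)
Lemma compact_rank1 T v w : l2 v -> l2 w ->
  (forall f, l2 f -> T f = dot f w *: v) -> compact_op T.
Proof.
move=> hv hw hT; rewrite /compact_op -l2E => u hu.
have ul2 n : l2 (u n) by have [] := hu n.
have un1 n : nrm (u n) <= 1.
  by have [_] := hu n; rewrite l2normE // -(rmorph1 (@RtoC R)) RtoC_le.
pose z n : C := dot (u n) w.
have hz n : nc (z n) <= nrm w.
  apply: (le_trans (cauchy_schwarz (ul2 n) hw)).
  by rewrite -[X in _ <= X]mul1r ler_wpM2r ?nrm_ge0.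
have [|k1 k1i [a ha]] := @bolzano_weierstrass_homo (fun n => complex.Re (z n)) (nrm w).
  move=> n; apply: le_trans (hz n); rewrite -RtoC_le -ncE; exact: normc_ge_Re.
have [|k2 k2i [b hb]] := @bolzano_weierstrass_homo (fun n => complex.Im (z (k1 n))) (nrm w).
  move=> n; apply: le_trans (hz (k1 n)); exact: nc_ge_im.
pose k := k1 \o k2; exists k; split; first by move=> m n mn; apply: k1i; exact: k2i.
pose c : C := (a +i* b)%C.
exists (c *: v); first exact: l2Z.
have h (e : R) : 0 < e -> exists N, forall n, (N <= n)%N -> nc (z (k n) - c) <= e.
  move=> e0; have e20 : 0 < e / 2 by rewrite divr_gt0.
  have [N hN] := ha _ e20; have [N' hN'] := hb _ e20.
  exists (maxn N N') => n; rewrite geq_max => /andP[Nn N'n].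
  apply: le_trans (nc_re_im _) _.
  have := hN (k2 n) (leq_trans Nn (homo_ge_id k2i n)); have := hN' n N'n.
  rewrite /k /c /=; case: (z (k1 (k2 n))) => x y /=; lra.
apply/cvgrPdist_lt => e e0.
have re0 : 0 < re e by rewrite -RtoC_lt rmorph0 RtoC_re ?ltW.
have nv : 0 < nrm v + 1 by rewrite ltr_pwDr ?nrm_ge0.
have [|N hN] := h (re e / 2 / (nrm v + 1)); first by rewrite !divr_gt0.
exists N => // n /= Nn; rewrite sub0r normrN hT //.
rewrite -scalerBl -/(z _) l2normE; last exact: l2Z.
rewrite nrmZ // ncE nc_RtoC -[e]RtoC_re ?ltW // RtoC_lt.
rewrite ger0_norm ?mulr_ge0 ?nc_ge0 ?nrm_ge0 //.
have := hN n Nn; rewrite ler_pdivlMr // => H.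
have : nc (z (k n) - c) * nrm v <= nc (z (k n) - c) * (nrm v + 1).
  by rewrite ler_wpM2l ?nc_ge0 // lerDl.
move: re0 H; set X := _ * (_ + _); lra.
Qed.
End Compact.

(** * Roe algebras of a fibred index set *)

Section Propagation.
Variables (R : realType) (X : metricType R) (I : choiceType) (p : I -> X).
Local Notation C := (Cplx R).
Local Notation vec := (I -> C).
Local Notation op := (vec -> vec).
Implicit Types (f g : vec) (T : op).

Definition fib (x : X) : set I := [set i | p i = x].

Lemma fiber_projE x f : fiber_proj p x f = res (fib x) f.
Proof.
apply/funext => i; rewrite /fiber_proj /res /fib /=.
by case: eqP => h; [rewrite asboolT | rewrite asboolF].
Qed.

Definition prop_le T (r : R) : Prop := forall x y f, l2 f -> r < mdist x y ->
  res (fib y) (T (res (fib x) f)) = 0.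

Lemma propagationP T : (propagation p T < +oo)%E <-> exists r, prop_le T r.
Proof.
split=> [hlt|[r hr]].
  have hub x y f : l2 f -> block p T x y f <> 0 -> ((mdist x y)%:E <= propagation p T)%E.
    move=> hf nz; apply: ereal_sup_ubound; exists x, y; split => //.
    by exists f => //; rewrite -l2E.
  (* The supremum may be [-oo], in which case [fine] returns 0; then every block vanishes on [l2]
     and any bound is valid. *)
  exists (fine (propagation p T)) => x y f hf rlt; apply: contrapT => nz.
  have := hub x y f hf; rewrite /block !fiber_projE => /(_ nz).
  move: hlt rlt; case: (propagation p T) => //= s _ + h.
  by rewrite lee_fin in h; rewrite ltNge h.
apply: (@le_lt_trans _ _ r%:E); last exact: ltry.
apply: ge_ereal_sup => t [x [y [[f]]]]; rewrite -l2E => hf nz ->; move: nz.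
rewrite lee_fin /block !fiber_projE => nz; rewrite leNgt; apply/negP => rlt.
by apply: nz; exact: hr.
Qed.

Lemma nrm_le0 f : l2 f -> (forall e, 0 < e -> nrm f <= e) -> f = 0.
Proof.
move=> hf h; apply: nrm_eq0 => //; apply/eqP; rewrite eq_le nrm_ge0 andbT.
by apply/ler_addgt0Pr => e e0; rewrite add0r; apply: h.
Qed.

Lemma prop_le_seq T r y (s : seq X) f : bounded_map T -> prop_le T r -> l2 f ->
  (forall x, x \in s -> r < mdist x y) -> (forall i, p i \notin s -> f i = 0) ->
  res (fib y) (T f) = 0.
Proof.
move=> bT hr; elim: s f => [|x s IH] f hf hs fs.
  have -> : f = 0 by apply/funext => i; exact: fs.
  by rewrite (bop0 bT) res0.
rewrite -(resC (fib x) f) (bopD bT) ?resD; [|exact: l2_res..].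
rewrite hr ?add0r //; last by rewrite hs ?mem_head.
apply: IH; first exact: l2_res.
  by move=> z zs; rewrite hs // inE zs orbT.
move=> i pis; have [pix|pix] := pselect (p i = x); first by rewrite resF.
by rewrite resE // fs // inE negb_or pis andbT; apply/eqP.
Qed.

(** [prop_le] concerns one source fibre at a time. A vector spread over infinitely many fibres is
    cut to a finite index set, which meets finitely many fibres, and boundedness of [T] controls the
    remaining tail. *)
Lemma prop_le_far T r y f : bounded_map T -> prop_le T r -> l2 f ->
  (forall i, mdist (p i) y <= r -> f i = 0) -> res (fib y) (T f) = 0.
Proof.
move=> bT hr hf far; have [_ _ _ [M M0 hM]] := bT.
apply: nrm_le0 => [|e e0]; first by apply/l2_res/(bop_l2 bT).
have M1 : 0 < M + 1 by rewrite ltr_wpDl.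
have [J hJ] := l2_tail hf (divr_gt0 e0 M1).
set S := [set i | i \notin J] in hJ.
rewrite -(resC S f) (bopD bT) ?resD; [|exact: l2_res..].
rewrite (@prop_le_seq _ r y [seq x <- map p J | r < mdist x y] (res (~` S) f)) //.
- rewrite addr0; apply: (le_trans (nrm_res_le _ _)).
    by apply: (bop_l2 bT); exact: l2_res.
  apply: (le_trans (hM _ (l2_res _ hf))).
  move: hJ; rewrite ler_pdivlMr // => hJ; apply: le_trans hJ.
  by rewrite mulrC ler_wpM2l ?nrm_ge0 // lerDl.
- exact: l2_res.
- by move=> x; rewrite mem_filter => /andP[].
move=> i; rewrite mem_filter negb_and -leNgt => /orP[h|h].
  by rewrite /res far //; case: ifP.
by rewrite resF // => nS; apply: nS; rewrite /S /=; apply: contra h; exact: map_f.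
Qed.

Definition roe_gen : set op := [set T | [/\ bounded_op T,
    (propagation p T < +oo)%E & forall x y : X, compact_op (block p T x y)]].
Definition Roe : set op := norm_closure roe_gen.

Lemma RoeP T : Roe T <-> bounded_map T /\ forall e : R, 0 < e -> exists2 S, roe_gen S &
    forall f, l2 f -> nrm (T f - S f) <= e * nrm f.
Proof. by apply: norm_closureP => S [/bopP]. Qed.

Lemma Roe_bop T : Roe T -> bounded_map T. Proof. by move=> /RoeP[]. Qed.

(** A weak form of quasi-locality at precision [e] and scale [r]: only vectors carried by a single
    fibre are tested. *)
Definition quasi_local T (e r : R) : Prop := forall x f, l2 f ->
  (forall i, p i <> x -> f i = 0) ->
  nrm (res [set i | r < mdist x (p i)] (T f)) <= e * nrm f.

Lemma quasi_local_weaken T e r r' : bounded_map T -> quasi_local T e r -> r <= r' -> quasi_local T e r'.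
Proof.
move=> bT h rr x f hf fx; apply: le_trans (h x f hf fx).
apply: nrm_res_sub; first exact: bop_l2.
by move=> i /=; exact: le_lt_trans.
Qed.

(** A finite propagation operator [S] within [e] of [T] contributes nothing beyond its propagation,
    so only the error [T - S] is seen there. *)
Lemma Roe_quasi_local T e : Roe T -> 0 < e -> exists r, quasi_local T e r.
Proof.
move=> /RoeP[bT h] /h[S [/bopP bS /propagationP[r hr] _] hS].
exists r => x f hf fx; have hTS : l2 (T f - S f) by apply: l2B; apply: bop_l2.
suff -> : res [set i | r < mdist x (p i)] (T f) =
          res [set i | r < mdist x (p i)] (T f - S f).
  by apply: le_trans (hS f hf); exact: nrm_res_le.
rewrite resB [X in _ - X]res_eq0 ?subr0 // => i /= rlt.
have := hr x (p i) f hf rlt; rewrite (@res_id _ _ (fib x) f fx) => /(congr1 (@^~ i)).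
by rewrite resE.
Qed.

Lemma compact_res (S : set I) T : (forall f, l2 f -> l2 (T f)) ->
  compact_op T -> compact_op (res S \o T).
Proof.
move=> bT; rewrite /compact_op -l2E => cT u hu.
have [k [ki [g hg lg]]] := cT u hu.
exists k; split => //; exists (res S g); first exact: l2_res.
have hd n : l2 (T (u (k n)) - g) by apply: l2B => //; apply: bT; have [] := hu (k n).
apply/cvgrPdist_lt => e e0.
move/cvgrPdist_lt: lg => /(_ e e0) [N _ hN]; exists N => // n Nn.
apply: le_lt_trans (hN n Nn); rewrite !sub0r !normrN /= -resB.
rewrite !l2normE //; last exact: l2_res.
rewrite !ncE !nc_RtoC RtoC_le !ger0_norm ?nrm_ge0 //; exact: nrm_res_le.
Qed.

Lemma res_comm (S S' : set I) f : res S (res S' f) = res S' (res S f).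
Proof. by rewrite !res_res setIC. Qed.

(** [res S] commutes with the fibre projections, so composing with it increases no propagation and
    keeps the blocks compact, for an arbitrary set [S]. *)
Lemma Roe_res (S : set I) T : Roe T -> Roe (res S \o T).
Proof.
move=> /RoeP[bT h]; apply/RoeP; split; first exact: bop_res.
move=> e /h[A [/bopP bA /propagationP[r hr] cA] hA].
exists (res S \o A).
  split; first exact/bopP/bop_res.
    by apply/propagationP; exists r => x y f hf rlt /=; rewrite res_comm hr // res0.
  move=> x y; have -> : block p (res S \o A) x y = res S \o block p A x y.
    by apply/funext => f; rewrite /block /= !fiber_projE res_comm.
  apply: compact_res; last exact: cA.
  by move=> f hf; rewrite /block !fiber_projE; apply/l2_res/(bop_l2 bA)/l2_res.
move=> f hf /=; rewrite -resB; apply: le_trans (hA f hf).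
by apply: nrm_res_le; apply: l2B; apply: bop_l2.
Qed.

End Propagation.

(** * Rank one operators and partial translations in the Roe algebra *)

Section RoeElements.
Variables (R : realType) (X : metricType R) (I : choiceType) (p : I -> X).
Local Notation C := (Cplx R).
Local Notation vec := (I -> C).
Local Notation op := (vec -> vec).
Implicit Types (f g : vec) (T : op).

Lemma block_rank1 x y v w f : l2 f ->
  block p (rank1 v w) x y f = dot f (res (fib p x) w) *: res (fib p y) v.
Proof.
move=> hf; rewrite /block !fiber_projE rank1E; last exact: l2_res.
by rewrite resZ dot_res.
Qed.

Lemma rank1_gen (J K : {fset I}) v w : l2 v -> l2 w ->
  roe_gen p (rank1 (res [set i | i \in J] v) (res [set i | i \in K] w)).
Proof.
move=> hv hw; set v' := res _ v; set w' := res _ w.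
have hv' : l2 v' by exact: l2_res.
have hw' : l2 w' by exact: l2_res.
split; first exact/bopP/bop_rank1; last first.
  move=> x y; apply: (@compact_rank1 _ _ _ (res (fib p y) v') (res (fib p x) w')).
  - exact: l2_res.
  - exact: l2_res.
  - by move=> f hf; exact: block_rank1.
(* A sum of nonnegative terms dominates each of them, so this bounds every distance between the
   fibres met by [K] and those met by [J]. *)
apply/propagationP; exists (\sum_(i <- J) \sum_(k <- K) mdist (p k) (p i)).
move=> x y f hf rlt; have := block_rank1 x y v' w' hf.
rewrite /block !fiber_projE => ->.
have [[i [iJ piy]]|nJ] := pselect (exists i, i \in J /\ p i = y); last first.
  rewrite [res (fib p y) v']res_eq0 ?scaler0 // => i piy.
  by rewrite /v' resF // => iJ; apply: nJ; exists i.
have [[k [kK pkx]]|nK] := pselect (exists k, k \in K /\ p k = x); last first.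
  rewrite [res (fib p x) w']res_eq0 ?dot0r ?scale0r // => k pkx.
  by rewrite /w' resF // => kK; apply: nK; exists k.
exfalso; move: rlt; apply/negP; rewrite -leNgt -pkx -piy.
rewrite (big_fsetD1 _ iJ) /= (big_fsetD1 _ kK) /= -addrA lerDl.
by rewrite addr_ge0 // sumr_ge0 // => *; rewrite ?sumr_ge0 // => *; exact: mdist_ge0.
Qed.

Lemma Roe_rank1 v w : l2 v -> l2 w -> Roe p (rank1 v w).
Proof.
move=> hv hw; apply/RoeP; split; first exact: bop_rank1.
(* Cutting both vectors with tails of norm at most [t] costs at most [t * (nrm v + nrm w)]; the
   [+ 1] keeps the denominator positive. *)
move=> e e0; have m0 : 0 < nrm v + nrm w + 1 by rewrite ltr_wpDl ?addr_ge0 ?nrm_ge0.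
have t0 := divr_gt0 e0 m0; set t := e / _ in t0.
have [J hJ] := l2_tail hv t0; have [K hK] := l2_tail hw t0.
have eC (L : {fset I}) : ~` [set i | i \in L] = [set i | i \notin L].
  by apply/seteqP; split => i /= /negP.
exists (rank1 (res [set i | i \in J] v) (res [set i | i \in K] w)).
  exact: rank1_gen.
move=> f hf; rewrite !rank1E //.
set v' := res _ v; set w' := res _ w.
have hv' : l2 v' by exact: l2_res.
have hw' : l2 w' by exact: l2_res.
have ev : v - v' = res [set i | i \notin J] v.
  by rewrite -[v in LHS](resC [set i | i \in J] v) eC addrC addKr.
have ew : w - w' = res [set i | i \notin K] w.
  by rewrite -[w in LHS](resC [set i | i \in K] w) eC addrC addKr.
have -> : dot f w *: v - dot f w' *: v' =
  dot f (w - w') *: v + dot f w' *: (v - v').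
  have -> : dot f (w - w') = dot f w - dot f w'.
    rewrite dotDr //; last exact: l2N.
    by rewrite -[- w']scaleN1r dotZr // rmorphN rmorph1 mulN1r.
  by rewrite scalerBl scalerBr addrA subrK.
rewrite ev ew; set v2 := res _ v; set w2 := res _ w.
have hv2 : l2 v2 by exact: l2_res.
have hw2 : l2 w2 by exact: l2_res.
apply: (le_trans (ler_nrmD (l2Z _ hv) (l2Z _ hv2))).
rewrite !nrmZ //.
have h1 := cauchy_schwarz hf hw2; have h2 := cauchy_schwarz hf hw'.
have h3 : nrm w' <= nrm w := nrm_res_le _ hw.
have -> : e = t * (nrm v + nrm w + 1) by rewrite /t divfK ?gt_eqF.
have a1 : nc (dot f w2) * nrm v <= nrm f * t * nrm v.
  apply: ler_wpM2r; first exact: nrm_ge0.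
  by apply: le_trans h1 _; rewrite ler_wpM2l ?nrm_ge0.
have a2 : nc (dot f w') * nrm v2 <= nrm f * nrm w * t.
  apply: ler_pM; rewrite ?nc_ge0 ?nrm_ge0 //.
  by apply: le_trans h2 _; rewrite ler_wpM2l ?nrm_ge0.
have a3 : 0 <= t * nrm f by rewrite mulr_ge0 ?nrm_ge0 // ltW.
lra.
Qed.

(* f |-> sum_y <f, w y> v y, where v y lives on the fibre of y *)
Definition trans (v w : X -> vec) : op := fun f i =>
  if `[< l2 f >] then dot f (w (p i)) * v (p i) i else 0.

Section Translation.
Variables (v w : X -> vec) (s : X -> X) (D : set X) (r : R).
Hypotheses (hv : forall y, l2 (v y) /\ nrm (v y) <= 1)
  (hw : forall y, l2 (w y) /\ nrm (w y) <= 1)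
  (sinj : forall y y', D y -> D y' -> s y = s y' -> y = y')
  (w0 : forall y, ~ D y -> w y = 0)
  (ws : forall y i, p i <> s y -> w y i = 0)
  (sr : forall y, D y -> mdist (s y) y <= r).

Lemma transE f i : l2 f -> trans v w f i = dot f (w (p i)) * v (p i) i.
Proof. by rewrite /trans => /asboolT ->. Qed.

(** By Cauchy-Schwarz the part of the image on the fibre of [y] has squared norm at most that of [f]
    on the fibre of [s y]. These source fibres are disjoint because [s] is injective on [D], so the
    contributions add up to at most [sqn f]. *)
Lemma trans_ps f J : l2 f -> ps (trans v w f) J <= sqn f.
Proof.
move=> hf; pose u := undup (map p J).
have -> : ps (trans v w f) J =
    \sum_(y <- u) nc (dot f (w y)) ^+ 2 * \sum_(i <- J | p i == y) nc (v y i) ^+ 2.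
  transitivity (\sum_(i <- J) \sum_(y <- u | p i == y)
      nc (dot f (w y)) ^+ 2 * nc (v y i) ^+ 2).
    apply: eq_big_seq => i iJ; rewrite transE // ncM exprMn.
    rewrite (eq_bigl (pred1 (p i))); last by move=> y; rewrite eq_sym.
    by rewrite -big_filter filter_pred1_uniq ?undup_uniq ?mem_undup ?map_f // big_seq1.
  under eq_bigr do rewrite big_mkcond; rewrite exchange_big /=.
  apply: eq_bigr => y _; rewrite mulr_sumr [RHS]big_mkcond.
  by apply: eq_bigr => i _; case: ifP.
have h1 : \sum_(y <- u) nc (dot f (w y)) ^+ 2 *
      \sum_(i <- J | p i == y) nc (v y i) ^+ 2 <=
    \sum_(y <- u | `[< D y >]) sqn (res [set i | p i = s y] f).
  rewrite [leRHS]big_mkcond; apply: ler_sum => y _.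
  case: asboolP => Dy; last by rewrite w0 // dot0r // nc0 expr0n mul0r.
  have [hvy nvy] := hv y; have [hwy nwy] := hw y.
  have b1 : \sum_(i <- J | p i == y) nc (v y i) ^+ 2 <= 1.
    apply: (@le_trans _ _ (ps (v y) J)).
      by rewrite big_mkcond; apply: ler_sum => i _; case: ifP => // _; exact: sqr_ge0.
    apply: le_trans (ps_sqn J hvy) _; rewrite -nrm_sqr // expr_le1 ?nrm_ge0 //.
  have b2 : nc (dot f (w y)) ^+ 2 <= sqn (res [set i | p i = s y] f).
    have -> : w y = res [set i | p i = s y] (w y) by rewrite res_id // => i; exact: ws.
    rewrite -dot_res -nrm_sqr; last exact: l2_res.
    rewrite ler_sqr ?nnegrE ?nc_ge0 ?nrm_ge0 //.
    apply: (le_trans (cauchy_schwarz (l2_res _ hf) hwy)).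
    by rewrite -[leRHS]mulr1 ler_wpM2l ?nrm_ge0.
  apply: le_trans b2; rewrite -[leRHS]mulr1 ler_wpM2l ?sqr_ge0 //.
apply: (le_trans h1).
rewrite -big_filter -(big_map s xpredT (fun x => sqn (res [set i | p i = x] f))).
apply: sum_sqn_res_le => //; rewrite map_inj_in_uniq ?filter_uniq ?undup_uniq //.
by move=> y y'; rewrite !mem_filter => /andP[/asboolP Dy _] /andP[/asboolP Dy' _]; exact: sinj.
Qed.

Lemma trans_nrm f : l2 f -> l2 (trans v w f) /\ nrm (trans v w f) <= nrm f.
Proof.
move=> hf; split; first by apply/l2P; exists (sqn f) => J; exact: trans_ps.
by apply: nrm_le_ps (nrm_ge0 _) _ => J; rewrite nrm_sqr // trans_ps.
Qed.

Lemma bop_trans : bounded_map (trans v w).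
Proof.
split.
- by move=> f nf; apply/funext => i; rewrite /trans asboolF.
- by move=> f /trans_nrm[].
- move=> c f g hf hg; apply/funext => i.
  rewrite -[RHS]/(c * trans v w f i + trans v w g i) !transE //; last exact: l2_lin.
  by have [hwi _] := hw (p i); rewrite dotPl // mulrDl mulrA.
- by exists 1 => // f hf; rewrite mul1r; have [] := trans_nrm hf.
Qed.

Lemma Roe_trans : Roe p (trans v w).
Proof.
apply/RoeP; split; first exact: bop_trans.
(* No approximation takes place: the operator is itself a generator, with propagation at most [r]
   and blocks of rank at most one. *)
move=> e e0; exists (trans v w); last first.
  move=> f hf; rewrite subrr nrm0 mulr_ge0 ?nrm_ge0 // ltW //.
have blockE x y f : l2 f -> res (fib p y) (trans v w (res (fib p x) f)) =
    dot f (res (fib p x) (w y)) *: res (fib p y) (v y).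
  move=> hf; apply/funext => i.
  rewrite -[RHS]/(_ * res (fib p y) (v y) i).
  have [piy|piy] := pselect (fib p y i); last by rewrite !resF ?mulr0.
  rewrite !resE // transE; last exact: l2_res.
  by rewrite dot_res piy.
split; first exact/bopP/bop_trans.
- apply/propagationP; exists r => x y f hf rlt; rewrite blockE //.
  have [Dy|Dy] := pselect (D y); last by rewrite w0 // res0 dot0r // scale0r.
  rewrite [res (fib p x) (w y)]res_eq0 ?dot0r ?scale0r // => i pix.
  apply: ws; rewrite pix => xs; move: rlt; apply/negP.
  by rewrite -leNgt xs sr.
move=> x y; apply: (@compact_rank1 _ _ _ (res (fib p y) (v y)) (res (fib p x) (w y))).
- by apply: l2_res; have [] := hv y.
- by apply: l2_res; have [] := hw y.
by move=> f hf; rewrite /block !fiber_projE blockE.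
Qed.

End Translation.
End RoeElements.

Lemma ulf_seq (R : realType) (X : metricType R) (r : R) : ulf X -> 0 < r ->
  exists N : nat, forall x : X, exists s : seq X, [/\ uniq s, (size s <= N)%N &
    forall z, (z \in s) = (mdist x z <= r)].
Proof.
move=> uX r0; have [N hN] := uX r r0; exists N => x.
have fA : finite_set [set y | mdist x y <= r].
  by apply/finite_set_leP; exists N; exact: hN.
exists (fset_set [set y | mdist x y <= r]); split; first exact: fset_uniq.
  by apply: geq_card_fset_set; exact: hN.
move=> z.
by rewrite in_fset_set //; apply/idP/idP => [/set_mem|] //; exact: mem_set.
Qed.

(** * Orthonormal sequences and norm limits of their images *)

Section Orthonormal.
Variables (R : realType) (I : choiceType).
Local Notation C := (Cplx R).
Local Notation vec := (I -> C).
Local Notation op := (vec -> vec).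
Implicit Types (f g : vec) (T : op).

Definition ortho (z : nat -> vec) : Prop :=
  (forall n, l2 (z n) /\ nrm (z n) = 1) /\
  forall m n, m <> n -> dot (z m) (z n) = 0.

Lemma ortho_sub z k : ortho z -> {homo k : m n / (m < n)%N} -> ortho (z \o k).
Proof.
move=> [z1 z2] hk; split => [n|m n mn /=]; first exact: z1.
apply: z2 => e; apply: mn; apply/eqP; rewrite eqn_leq.
by apply/andP; split; rewrite leqNgt; apply/negP => /hk; rewrite e ltnn.
Qed.

Lemma ortho_sum z m : ortho z ->
  [/\ l2 (\sum_(i < m) z i), sqn (\sum_(i < m) z i) = m%:R &
    forall n, (m <= n)%N -> dot (\sum_(i < m) z i) (z n) = 0].
Proof.
move=> [z1 z2]; elim: m => [|m [h1 h2 h3]].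
  rewrite big_ord0 sqn0; split=> // [|n _]; first exact: l2_0.
  by rewrite dot0l //; have [] := z1 n.
have [zm nm] := z1 m; rewrite big_ord_recr /=; split; first exact: l2D.
  by rewrite sqnD // h2 h3 // mulr0 addr0 -(nrm_sqr zm) nm expr1n natr1.
move=> n mn; have [zn _] := z1 n; rewrite dotDl // h3 ?(ltnW mn) // add0r z2 //.
by move=> e; rewrite e ltnn in mn.
Qed.

(** Weaker than [bounded_map], so as to include blocks: a vector outside [l2] may have a
    square-summable restriction to one fibre, and a block need not kill it. *)
Definition lop T : Prop := [/\ forall f, l2 f -> l2 (T f),
  forall f g, l2 f -> l2 g -> T (f + g) = T f + T g &
  exists2 M : R, 0 <= M & forall f, l2 f -> nrm (T f) <= M * nrm f].

(** An orthonormal sequence tends weakly to 0, hence so does its image. Concretely, the sum of [m]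
    late terms has norm [sqrt m], while its image is within [m * nrm g / 2] of [m *: g]; thus
    [m * nrm g / 2 <= M * sqrt m] for all [m], which forces [g = 0]. *)
Lemma ortho_lim0 T z g : lop T -> ortho z -> l2 g ->
  (forall e, 0 < e -> exists N, forall n, (N <= n)%N -> nrm (T (z n) - g) <= e) ->
  g = 0.
Proof.
move=> [T1 T2 [M M0 T3]] oz hg hlim; apply: nrm_eq0 => //; apply: contrapT => /eqP ng0.
have g0 : 0 < nrm g by rewrite lt_neqAle eq_sym ng0 nrm_ge0.
have [N hN] := hlim _ (divr_gt0 g0 (ltr0Sn _ 1)).
pose u n := z (N + n)%N.
have ou : ortho u.
  by apply: (ortho_sub (k := addn N)) oz _ => m n; rewrite ltn_add2l.
have [u1 _] := ou.
have T0 : T 0 = 0.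
  by apply: (addrI (T 0)); rewrite -T2 ?addr0 //; exact: l2_0.
have hT m : nrm (T (\sum_(i < m) u i) - m%:R *: g) <= m%:R * (nrm g / 2).
  elim: m => [|m IH]; first by rewrite big_ord0 T0 scale0r subrr nrm0 mul0r.
  have [s1 _ _] := ortho_sum m ou; have [um _] := u1 m.
  rewrite big_ord_recr /= T2 // -natr1 scalerDl scale1r opprD addrACA.
  apply: le_trans (ler_nrmD _ _) _.
  - by apply: l2B; [exact: T1 | exact: l2Z].
  - by apply: l2B => //; exact: T1.
  by rewrite -[X in X * _]natr1 mulrDl mul1r lerD // hN // leq_addr.
have hM m : m%:R * (nrm g / 2) <= M * Num.sqrt m%:R.
  have [s1 s2 _] := ortho_sum m ou.
  have h1 := hT m; have h2 := T3 _ s1.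
  have nE : nrm (\sum_(i < m) u i) = Num.sqrt m%:R by rewrite nrmE s2.
  rewrite nE in h2.
  have hTs := T1 _ s1.
  have : nrm (m%:R *: g) <= nrm (T (\sum_(i < m) u i)) + nrm (T (\sum_(i < m) u i) - m%:R *: g).
    set a := T _; set b := _ *: g; rewrite -[b in leLHS](subKr a).
    by apply: ler_nrmB => //; apply: l2B => //; exact: l2Z.
  rewrite nrmZ // -(rmorph_nat (@RtoC R)) nc_RtoC ger0_norm ?ler0n //.
  rewrite rmorph_nat; lra.
pose c := 2 * M / nrm g.
have c0 : 0 <= c by rewrite divr_ge0 ?nrm_ge0 ?mulr_ge0.
have [m hm] : exists m : nat, c < m%:R.
  by exists (Num.Def.archi_bound c); apply: archi_boundP.
(* Using a square number of terms removes the square root and gives [m <= c], against the choice of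
   [m]. *)
have := hM (m ^ 2)%N; rewrite natrX sqrtr_sqr ger0_norm // => h.
have m0 : 0 < m%:R :> R by apply: le_lt_trans hm.
have : m%:R <= c.
  rewrite /c ler_pdivlMr //.
  have : m%:R * (nrm g / 2) <= M.
    by rewrite -(ler_pM2r m0) mulrAC -expr2.
  lra.
by rewrite leNgt hm.
Qed.

End Orthonormal.

(** * Compactness of the rows of an element of the Roe algebra *)

Section RoeCompact.
Variables (R : realType) (X : metricType R) (I : choiceType) (p : I -> X).
Local Notation C := (Cplx R).
Local Notation vec := (I -> C).
Local Notation op := (vec -> vec).
Implicit Types (f g : vec) (T : op).

Lemma lop_block T x y : bounded_map T -> lop (block p T x y).
Proof.
move=> bT; have [h1 h2 h3 [M M0 hM]] := bT; split.
- by move=> f hf; rewrite /block !fiber_projE; apply/l2_res/h2/l2_res.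
- move=> f g hf hg; rewrite /block !fiber_projE resD (bopD bT) ?resD //; exact: l2_res.
- exists M => // f hf; rewrite /block !fiber_projE.
  apply: le_trans (nrm_res_le _ (h2 _ (l2_res _ hf))) _.
  apply: le_trans (hM _ (l2_res _ hf)) _; rewrite ler_wpM2l //; exact: nrm_res_le.
Qed.

Lemma block_to0 T x y z : bounded_map T -> compact_op (block p T x y) -> ortho z ->
  exists2 k, {homo k : m n / (m < n)%N} & forall e, 0 < e ->
    exists N, forall n, (N <= n)%N -> nrm (block p T x y (z (k n))) <= e.
Proof.
move=> bT; rewrite /compact_op -l2E => cT oz; have [z1 _] := oz.
have [|k [ki [g hg lg]]] := cT z.
  by move=> n; have [hz nz] := z1 n; rewrite l2normE // nz rmorph1.
have lop_b := lop_block x y bT; have [b1 _ _] := lop_b.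
have lim e : 0 < e -> exists N, forall n, (N <= n)%N -> nrm (block p T x y (z (k n)) - g) <= e.
  move=> e0; have e0' : 0 < RtoC e by rewrite -(rmorph0 (@RtoC R)) RtoC_lt.
  move/cvgrPdist_lt: lg => /(_ _ e0') [N _ hN]; exists N => n /hN /=.
  rewrite sub0r normrN l2normE; last by apply: l2B => //; apply: b1; have [] := z1 (k n).
  by rewrite ncE nc_RtoC RtoC_lt ger0_norm ?nrm_ge0 // => /ltW.
have g0 : g = 0 by apply: (ortho_lim0 lop_b (ortho_sub oz ki) hg).
by exists k => // e /lim [N hN]; exists N => n /hN; rewrite g0 subr0.
Qed.

(** Subsequences are extracted successively, one for each source fibre in [s]. *)
Lemma blocks_to0 T y (s : seq X) z : bounded_map T -> (forall x, compact_op (block p T x y)) ->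
  ortho z -> exists2 k, {homo k : m n / (m < n)%N} & forall e, 0 < e ->
    exists N, forall n, (N <= n)%N ->
      nrm (res (fib p y) (T (res [set i | p i \in s] (z (k n))))) <= e.
Proof.
move=> bT cT oz; elim: s => [|x s [k ki hk]].
  exists id => // e e0; exists 0%N => n _.
  by rewrite [res [set i | _] _]res_eq0 // (bop0 bT) res0 nrm0 ltW.
have [xs|xs] := boolP (x \in s).
  exists k => // e /hk[N hN]; exists N => n /hN.
  congr (nrm (res _ (T (res _ _))) <= e); apply/seteqP; split => i /=; rewrite inE.
    by move=> ->; rewrite orbT.
  by move=> /orP[/eqP ->|].
have ozk := ortho_sub oz ki.
have [k' ki' hk'] := block_to0 bT (cT x) ozk.
exists (k \o k') => [m n mn /=|e e0]; first exact/ki/ki'.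
have e20 : 0 < e / 2 by rewrite divr_gt0.
have [N hN] := hk _ e20; have [N' hN'] := hk' _ e20.
exists (maxn N N') => n; rewrite geq_max => /andP[Nn Nn'].
have := hN (k' n) (leq_trans Nn (homo_ge_id ki' n)); have := hN' n Nn'.
rewrite /block !fiber_projE /=; set f := z _.
have hf : l2 f by have [z1 _] := oz; have [] := z1 (k (k' n)).
have -> : res [set i | p i \in x :: s] f = res (fib p x) f + res [set i | p i \in s] f.
  rewrite -(resC (fib p x) (res [set i | p i \in x :: s] f)) !res_res.
  congr (res _ f + res _ f); apply/seteqP; split => i /=; rewrite ?inE.
  - by case.
  - by move=> pix; split => //; rewrite pix eqxx.
  - by case=> pix /orP[/eqP //|].
  - move=> pis; split; last by rewrite pis orbT.
    by move=> pix; move: xs; rewrite -pix pis.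
rewrite (bopD bT) ?resD; [|exact: l2_res..] => h1 h2.
apply: le_trans (ler_nrmD _ _) _; [by apply/l2_res/(bop_l2 bT)/l2_res..|].
lra.
Qed.

(** Up to [d / 3], [T] is a generator [S]; by finite propagation and local finiteness the row of [S]
    at [y] involves finitely many compact blocks, so along a subsequence it drops below [d / 3]. The
    row of [T] is then at most [2 * d / 3] at some term. *)
Lemma Roe_row_compact T y (d : R) z : ulf X -> Roe p T -> 0 < d -> ortho z ->
  ~ forall n, d <= nrm (res (fib p y) (T (z n))).
Proof.
move=> uX /RoeP[bT hT] d0 oz hd; have d30 : 0 < d / 3 by rewrite divr_gt0.
have [S [/bopP bS /propagationP[r hr] cS] hS] := hT _ d30.
have [s hs] : exists s : seq X, forall x, mdist x y <= r -> x \in s.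
  have r1 : 0 < Num.max r 1 by rewrite lt_max ltr01 orbT.
  have [N hN] := ulf_seq uX r1; have [s [_ _ hs]] := hN y.
  by exists s => x hx; rewrite hs metric_sym le_max hx.
have [k ki hk] := blocks_to0 s bS (fun x => cS x y) oz.
have [N hN] := hk _ d30; have := hN N (leqnn N).
have [z1 _] := oz; have [] := z1 (k N); have := hd (k N).
set f := z (k N) => h1 hf nf h2.
have e1 : res (fib p y) (S (res (~` [set i | p i \in s]) f)) = 0.
  apply: (prop_le_far bS hr (l2_res _ hf)) => i ir.
  by rewrite resF //= => h; apply: h; exact: hs.
have e2 : res (fib p y) (S f) = res (fib p y) (S (res [set i | p i \in s] f)).
  by rewrite -{1}(resC [set i | p i \in s] f) (bopD bS) ?resD ?e1 ?addr0 //; exact: l2_res.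
rewrite -e2 in h2.
have h3 := hS f hf; rewrite nf mulr1 in h3.
have hTf := bop_l2 bT hf; have hSf := bop_l2 bS hf.
have h4 := nrm_res_le (fib p y) (l2B hTf hSf).
have : nrm (res (fib p y) (T f)) <= nrm (res (fib p y) (T f - S f)) + nrm (res (fib p y) (S f)).
  have -> : res (fib p y) (T f) = res (fib p y) (T f - S f) + res (fib p y) (S f).
    by rewrite -resD subrK.
  by apply: ler_nrmD; apply: l2_res => //; exact: l2B.
lra.
Qed.

End RoeCompact.

(** * Uniform quasi-locality *)

Section UniformQuasiLocality.
Variables (R : realType) (X : metricType R) (I : choiceType) (p : I -> X).
Local Notation C := (Cplx R).
Local Notation vec := (I -> C).
Local Notation op := (vec -> vec).
Implicit Types (f g : vec) (T : op) (M P : set nat).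

Lemma quasi_localD T S U e e' r : bounded_map S -> bounded_map U -> quasi_local p S e r -> quasi_local p U e' r ->
  (forall f, l2 f -> T f = S f + U f) -> quasi_local p T (e + e') r.
Proof.
move=> bS bU hS hU TE x f hf fx; rewrite TE // resD mulrDl.
apply: le_trans (ler_nrmD _ _) _; [by apply/l2_res/bop_l2..|].
by apply: lerD; [exact: hS | exact: hU].
Qed.

Lemma quasi_localB T S U e e' r : bounded_map S -> bounded_map U -> quasi_local p S e r -> quasi_local p U e' r ->
  (forall f, l2 f -> T f = S f - U f) -> quasi_local p T (e + e') r.
Proof.
move=> bS bU hS hU TE x f hf fx; rewrite TE // resB mulrDl.
apply: le_trans (ler_nrmB _ _) _; [by apply/l2_res/bop_l2..|].
by apply: lerD; [exact: hS | exact: hU].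
Qed.

Variable a : set nat -> op.
Hypotheses (a_bop : forall M, bounded_map (a M))
  (a_ql : forall M e, 0 < e -> exists r, quasi_local p (a M) e r)
  (a_add : forall M P f, l2 f -> M `&` P = set0 -> a (M `|` P) f = a M f + a P f)
  (a_tail : forall f e, l2 f -> 0 < e -> exists n, forall M,
     (forall k, M k -> (n <= k)%N) -> nrm (a M f) <= e).

Lemma a_cut n M f : l2 f -> a M f = a (M `&` `I_n) f + a (M `\` `I_n) f.
Proof.
move=> hf; rewrite -a_add //; last by rewrite setDE setIACA setICr setI0.
by rewrite setUIDK.
Qed.

(** Induction on [n]: the part of [M] beyond [I_n] is either empty or the singleton of [n], so only
    two further operators have to be accommodated. *)
Lemma uniform_quasi_local_fin n e : 0 < e -> exists r, forall M, M `<=` `I_n -> quasi_local p (a M) e r.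
Proof.
elim: n e => [|n IH] e e0.
  have [r hr] := a_ql set0 e0; exists r => M; rewrite II0 => M0.
  by have -> : M = set0 by apply/seteqP; split.
have e20 : 0 < e / 2 by rewrite divr_gt0.
have [r hr] := IH _ e20; have [r1 hr1] := a_ql set0 e20.
have [r2 hr2] := a_ql [set n] e20.
pose r' := Num.max r (Num.max r1 r2); exists r' => M Mn.
have -> : e = e / 2 + e / 2 by rewrite -splitr.
apply: (quasi_localD (a_bop (M `&` `I_n)) (a_bop (M `\` `I_n)) _ _ (a_cut n M)).
  by apply: (quasi_local_weaken (a_bop _) (hr _ (@subIsetr _ _ _))); rewrite le_max lexx.
have [Mn1|Mn1] := pselect (M n).
  have -> : M `\` `I_n = [set n].
    apply/seteqP; split => k /= => [[/Mn /= kn nk]|->]; last by split => //; rewrite ltnn.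
    by apply/eqP; rewrite eqn_leq -ltnS kn leqNgt; apply/negP.
  by apply: (quasi_local_weaken (a_bop _) hr2); rewrite !le_max lexx !orbT.
have -> : M `\` `I_n = set0.
  apply/seteqP; split => k //= [Mk nk]; apply: Mn1.
  suff -> : n = k by []; apply/eqP; rewrite eqn_leq.
  by have /= := Mn _ Mk; rewrite ltnS => ->; rewrite leqNgt; move/negP: nk => ->.
by apply: (quasi_local_weaken (a_bop _) hr1); rewrite !le_max lexx !orbT.
Qed.

(** Gliding hump. If uniformity failed, one could assemble a single set [M] for which [a M] violates
    quasi-locality with constant [e0 / 4] at every integer scale, against [a_ql]. *)
Lemma uniform_quasi_local e0 : 0 < e0 -> exists r, forall M, quasi_local p (a M) e0 r.
Proof.
move=> e00; apply: contrapT => nql.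
have nq r : exists M, ~ quasi_local p (a M) e0 r.
  by apply: contrapT => h; apply: nql; exists r => M; apply: contrapT => h'; apply: h; exists M.
have e20 : 0 < e0 / 2 by rewrite divr_gt0.
have e40 : 0 < e0 / 4 by rewrite divr_gt0.
have e80 : 0 < e0 / 8 by rewrite divr_gt0.
(* A bad set can be found with any prescribed initial segment: removing the new segment and
   restoring the old one cost [e0 / 4] each, which leaves a defect of [e0 / 2] out of [e0]. *)
have step1 n P r : exists2 M, M `&` `I_n = P `&` `I_n & ~ quasi_local p (a M) (e0 / 2) r.
  have [r1 hr1] := uniform_quasi_local_fin n e40.
  have [M hM] := nq (Num.max r r1).
  pose M' := (P `&` `I_n) `|` (M `\` `I_n).
  have M'n : M' `&` `I_n = P `&` `I_n.
    by rewrite /M' setIUl -setIA setIid setDE -setIA setICl setI0 setU0.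
  have M'D : M' `\` `I_n = M `\` `I_n.
    by rewrite /M' setDUl !setDE -setIA setICr setI0 set0U -setIA setIid.
  exists M' => // qM'; apply: hM.
  have q1 : quasi_local p (a (M' `\` `I_n)) (e0 / 2 + e0 / 4) (Num.max r r1).
    apply: (quasi_localB (a_bop M') (a_bop (M' `&` `I_n))).
    - by apply: (quasi_local_weaken (a_bop _) qM'); rewrite le_max lexx.
    - by apply: (quasi_local_weaken (a_bop _) (hr1 _ (@subIsetr _ _ _))); rewrite le_max lexx orbT.
    by move=> f hf; rewrite (a_cut n M') // addrC addKr.
  have -> : e0 = (e0 / 4) + (e0 / 2 + e0 / 4) by lra.
  rewrite M'D in q1.
  apply: (quasi_localD (a_bop (M `&` `I_n)) (a_bop (M `\` `I_n)) _ q1 (a_cut n M)).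
  by apply: (quasi_local_weaken (a_bop _) (hr1 _ (@subIsetr _ _ _))); rewrite le_max lexx orbT.
(* The defect is witnessed by one vector [f]. By [a_tail] the indices beyond some [N] change [a M f]
   by at most [2 * (e0 / 8)] times [nrm f], so every set with the same trace on [I_N] keeps a defect
   of [e0 / 4]. *)
have step2 (q : (nat * set nat) * nat) : exists q' : nat * set nat,
    [/\ (q.1.1 < q'.1)%N, q'.2 `&` `I_(q.1.1) = q.1.2 `&` `I_(q.1.1) &
     forall M, M `&` `I_(q'.1) = q'.2 `&` `I_(q'.1) -> ~ quasi_local p (a M) (e0 / 4) q.2%:R].
  case: q => -[n P] k /=.
  have [M Mn nqM] := step1 n P k%:R.
  have [x [f [hf fx hlt]]] : exists x f, [/\ l2 f, forall i, p i <> x -> f i = 0 &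
      e0 / 2 * nrm f < nrm (res [set i | k%:R < mdist x (p i)] (a M f))].
    apply: contrapT => h; apply: nqM => x f hf fx; rewrite leNgt; apply/negP => hlt.
    by apply: h; exists x, f.
  have f0 : 0 < nrm f.
    rewrite lt_neqAle nrm_ge0 andbT; apply/eqP => nf0.
    move: hlt; rewrite (nrm_eq0 hf (esym nf0)) (bop0 (a_bop M)) res0 nrm0 mulr0.
    by rewrite ltxx.
  have [m hm] := a_tail hf (mulr_gt0 e80 f0).
  exists (maxn n.+1 m, M) => /=; split => //; first by rewrite leq_max ltnSn.
  move=> M' hM' qM'; have := qM' x f hf fx.
  set N := maxn _ _ in hM'; set S := [set i | _].
  have tl M1 : nrm (a (M1 `\` `I_N) f) <= e0 / 8 * nrm f.
    apply: hm => j [_ /= /negP]; rewrite -leqNgt; apply: leq_trans.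
    exact: leq_maxr.
  have E : a M f = a M' f - a (M' `\` `I_N) f + a (M `\` `I_N) f.
    by rewrite (a_cut N M) // (a_cut N M') // hM' addrK.
  have l2a M1 : l2 (a M1 f) by exact: bop_l2.
  have : nrm (res S (a M f)) <= nrm (res S (a M' f)) + e0 / 8 * nrm f + e0 / 8 * nrm f.
    rewrite E resD resB.
    apply: le_trans (ler_nrmD _ _) _; [by apply: l2B; exact: l2_res|exact: l2_res|].
    apply: lerD; last exact: le_trans (nrm_res_le _ (l2a _)) (tl M).
    apply: le_trans (ler_nrmB _ _) _; [exact: l2_res..|].
    by rewrite lerD2l; exact: le_trans (nrm_res_le _ (l2a _)) (tl M').
  move: hlt; rewrite -/S; lra.
have [F hF] := choice step2.
pose g := fix g k := if k is k'.+1 then F (g k', k') else (0%N, set0).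
have gS k : g k.+1 = F (g k, k) by [].
have g1 k : ((g k).1 < (g k.+1).1)%N by rewrite gS; have [] := hF (g k, k).
have gk k : (k <= (g k).1)%N by elim: k => // k IH; exact: leq_ltn_trans IH (g1 k).
have gmono m d : ((g m).1 <= (g (m + d)%N).1)%N.
  by elim: d => [|d IH]; rewrite ?addn0 // addnS; apply: leq_trans IH (ltnW (g1 _)).
have gagree m d j : (j < (g m).1)%N -> (g (m + d)%N).2 j <-> (g m).2 j.
  move=> jm; elim: d => [|d IH]; first by rewrite addn0.
  rewrite -IH addnS gS; have [_ + _] := hF (g (m + d)%N, (m + d)%N) => /=.
  have jmd : (j < (g (m + d)%N).1)%N by exact: leq_trans jm (gmono _ _).
  move=> /seteqP[h1 h2]; split => h.
    by have [] := h1 j (conj h jmd).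
  by have [] := h2 j (conj h jmd).
pose M := [set j | (g j.+1).2 j].
have Mn k : ~ quasi_local p (a M) (e0 / 4) k%:R.
  have [_ _] := hF (g k, k); apply; rewrite -gS.
  have hj j : (j < (g k.+1).1)%N -> M j <-> (g k.+1).2 j.
    move=> jk; rewrite /M /=; have [jk'|kj] := leqP j k.
      have := @gagree j.+1 (k - j)%N j (gk j.+1).
      by rewrite addSn subnKC // => ->.
    have := @gagree k.+1 (j - k)%N j jk.
    by rewrite addSn subnKC // ltnW.
  by apply/seteqP; split => j /= [Mj jk]; split => //; apply/(hj _ jk).
have [r hr] := a_ql M e40.
apply: (Mn (Num.Def.archi_bound `|r|)); apply: (quasi_local_weaken (a_bop M) hr).
apply: le_trans (ler_norm r) (ltW _); exact: archi_boundP.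
Qed.

End UniformQuasiLocality.

(** * Spatial implementation of isomorphisms *)

(** [U] and [V] are mutually adjoint unitaries between the [l2] spaces, and conjugation by them
    exchanges [A] and [B]. The last two fields avoid the composite of [U], [a] and [V] because
    nothing constrains [U] and [V] off [l2]. *)
Record intertwines (R : realType) (I J : choiceType)
    (A : set ((I -> Cplx R) -> I -> Cplx R)) (B : set ((J -> Cplx R) -> J -> Cplx R))
    (U : (I -> Cplx R) -> J -> Cplx R) (V : (J -> Cplx R) -> I -> Cplx R) : Prop :=
  Intertwines {
  int_l2 : forall v, l2 v -> l2 (U v);
  int_l2V : forall w, l2 w -> l2 (V w);
  int_lin : forall (c : Cplx R) v w, l2 v -> l2 w -> U (c *: v + w) = c *: U v + U w;
  int_UK : forall v, l2 v -> V (U v) = v;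
  int_VK : forall w, l2 w -> U (V w) = w;
  int_dot : forall v w, l2 v -> l2 w -> dot (U v) w = dot v (V w);
  int_AB : forall a, A a -> exists2 b, B b & forall v, l2 v -> b (U v) = U (a v);
  int_BA : forall b, B b -> exists2 a, A a & forall v, l2 v -> b (U v) = U (a v)
}.

Section IntertwinesTheory.
Variables (R : realType) (I J : choiceType).
Local Notation C := (Cplx R).
Variables (A : set ((I -> C) -> I -> C)) (B : set ((J -> C) -> J -> C)).
Variables (U : (I -> C) -> J -> C) (V : (J -> C) -> I -> C).
Hypotheses (bA : forall a, A a -> bounded_map a) (bB : forall b, B b -> bounded_map b).
Hypothesis UV : intertwines A B U V.

Lemma intertwines_sym : intertwines B A V U.
Proof.
case: UV => Ul Vl Ulin UK VK Ud AB BA; split => //.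
- move=> c v w hv hw; rewrite -[RHS]UK; last by apply: l2_lin; exact: Vl.
  by rewrite Ulin ?VK //; exact: Vl.
- move=> v w hv hw; rewrite [LHS]dotC //; last exact: Vl.
  by rewrite -Ud // -dotC //; exact: Ul.
- move=> b Bb; have [a Aa h] := BA b Bb; exists a => // w hw.
  rewrite -{2}(VK w hw) h; last exact: Vl.
  by rewrite UK //; apply: (bop_l2 (bA Aa)); exact: Vl.
- move=> a Aa; have [b Bb h] := AB a Aa; exists b => // w hw.
  rewrite -{2}(VK w hw) h; last exact: Vl.
  by rewrite UK //; apply: (bop_l2 (bA Aa)); exact: Vl.
Qed.

Lemma int_nrm v : l2 v -> nrm (U v) = nrm v.
Proof.
case: UV => Ul Vl Ulin UK VK Ud AB BA hv; rewrite !nrmE; congr Num.sqrt.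
apply: (@complexI R); rewrite -!/(RtoC _) -!dotff ?Ud ?UK //; exact: Ul.
Qed.
Lemma int_D v w : l2 v -> l2 w -> U (v + w) = U v + U w.
Proof. by move=> hv hw; have := int_lin UV 1 hv hw; rewrite !scale1r. Qed.
Lemma int_0 : U 0 = 0.
Proof.
by apply: (addrI (U 0)); rewrite -int_D ?addr0 //; exact: l2_0.
Qed.
Lemma int_Z c v : l2 v -> U (c *: v) = c *: U v.
Proof.
by move=> hv; have := int_lin UV c hv (@l2_0 _ _); rewrite int_0 !addr0.
Qed.
Lemma int_B v w : l2 v -> l2 w -> U (v - w) = U v - U w.
Proof.
move=> hv hw; rewrite int_D //; last exact: l2N.
by rewrite -scaleN1r int_Z // scaleN1r.
Qed.
End IntertwinesTheory.

Section Implementation.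
Variables (R : realType) (X Y : metricType R) (I J : choiceType).
Variables (p : I -> X) (q : J -> Y).
Local Notation C := (Cplx R).

Lemma dot_delta (K : choiceType) (k : K) : dot (delta R k) (delta R k) = 1.
Proof.
rewrite dotff; last exact: l2_delta.
by rewrite -nrm_sqr ?nrm_delta ?expr1n ?rmorph1 //; exact: l2_delta.
Qed.

Lemma rank1_comp (K : choiceType) (v w v' w' f : K -> C) :
  l2 v -> l2 w -> l2 v' -> l2 w' ->
  (rank1 v w \o rank1 v' w') f = dot v' w *: rank1 v w' f.
Proof.
move=> hv hw hv' hw' /=; have [hf|nf] := pselect (l2 f).
  have h := @rank1E _ _ v' w' f hf; rewrite [in LHS]h !rank1E //; last exact: l2Z.
  by rewrite dotZl // !scalerA mulrC.
rewrite !(rank1F _ _ nf) scaler0 rank1E; last exact: l2_0.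
by rewrite dot0l // scale0r.
Qed.

Lemma star_iso_intertwines (i0 : I) : star_isomorphic (Roe p) (Roe q) ->
  exists U V, intertwines (Roe p) (Roe q) U V.
Proof.
move=> [phi [phiAB phiI phiS] hphi].
pose d := delta R i0; have hd : l2 d by exact: l2_delta.
have h0 (K : choiceType) : l2 (0 : K -> C) by exact: l2_0.
pose z : (I -> C) -> I -> C := rank1 0 0.
have zE f : z f = 0 by rewrite /z /rank1; case: ifP => // _; rewrite scaler0.
have Rr (v w : I -> C) : l2 v -> l2 w -> Roe p (rank1 v w) by exact: Roe_rank1.
have Rz : Roe p z by exact: Rr.
have phiP (c : C) S T f : Roe p S -> Roe p T ->
    phi (fun f => c *: S f + T f) f = c *: phi S f + phi T f.
  by move=> hS hT; have [-> _ _] := hphi S T c hS hT.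
(* [z] is the zero operator, written as a rank one operator to place it in [Roe p]; linearity
   applied to [-1 *: z + z = z] yields the claim. *)
have phiz f : phi z f = 0.
  have := phiP (-1) z z f Rz Rz.
  have -> : (fun f => -1 *: z f + z f) = z by apply/funext => g; rewrite zE scaler0 addr0.
  by rewrite scaleN1r addNr.
have phiM S T f : Roe p S -> Roe p T -> phi (S \o T) f = phi S (phi T f).
  by move=> hS hT; have [_ -> _] := hphi S T 0 hS hT.
have phib S : Roe p S -> bounded_map (phi S) by move=> hS; apply: (@Roe_bop _ _ _ q); exact: phiAB.
have phiZ (c : C) S f : Roe p S -> phi (fun f => c *: S f) f = c *: phi S f.
  move=> hS; have := phiP c S z f hS Rz; rewrite phiz addr0 => <-.
  by congr (phi _ f); apply/funext => g; rewrite zE addr0.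
pose e := phi (rank1 d d).
have be : bounded_map e by apply: phib; exact: Rr.
have phiR v w v' w' f : l2 v -> l2 w -> l2 v' -> l2 w' ->
    phi (rank1 v w) (phi (rank1 v' w') f) = dot v' w *: phi (rank1 v w') f.
  move=> hv hw hv' hw'; rewrite -phiM; [|exact: Rr..].
  rewrite -phiZ; last exact: Rr.
  by congr (phi _ f); apply/funext => g; exact: rank1_comp.
(* By injectivity of [phi], the image of a nonzero projection is not the zero operator. *)
have [eta heta eeta] : exists2 eta, l2 eta & e eta <> 0.
  apply: contrapT => h.
  have ez : e = phi z.
    apply/funext => g; rewrite phiz; have [hg|ng] := pselect (l2 g).
      by apply: contrapT => h'; apply: h; exists g.
    by have [-> //] := be.
  have : rank1 d d = z.
    by apply: phiI; [apply/mem_set; exact: Rr | exact/mem_set | exact: ez].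
  move=> /(congr1 (fun T => T d i0)); rewrite rank1E // zE dot_delta scale1r.
  by rewrite /d /delta eqxx => /eqP; rewrite oner_eq0.
have l2e := bop_l2 be heta.
pose n := nrm (e eta).
have n0 : n != 0 by apply/eqP => /(nrm_eq0 l2e).
pose eta0 : J -> C := RtoC n^-1 *: e eta.
have heta0 : l2 eta0 by exact: l2Z.
have nn : nrm eta0 = 1.
  rewrite nrmZ // nc_RtoC ger0_norm ?invr_ge0 ?nrm_ge0 // mulVf //.
have eeta0 : e eta0 = eta0.
  by rewrite /eta0 (bopZ _ be) // /e phiR // dot_delta scale1r.
pose U v := phi (rank1 v d) eta0.
have Ul v : l2 v -> l2 (U v) by move=> hv; apply: bop_l2 => //; apply: phib; exact: Rr.
(* Moving [phi (rank1 v d)] across the inner product leaves [phi (rank1 d v)], whose product with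
   [phi (rank1 w d)] is the multiple [dot w v] of [e], and [e] fixes the unit vector [eta0]. *)
have Uiso v w : l2 v -> l2 w -> dot (U v) (U w) = dot v w.
  move=> hv hw; have [_ _] := hphi _ _ 0 (Rr d v hd hv) (Rr v d hv hd).
  move=> /(_ (rank1_adjoint hv hd)) /op_adjointP; rewrite /U => ->//; last exact: Ul.
  rewrite phiR // -/e eeta0 dotZr // dotff // -(nrm_sqr heta0) nn expr1n rmorph1 mulr1.
  by rewrite -dotC.
have UA a v : Roe p a -> l2 v -> phi a (U v) = U (a v).
  move=> ha hv; rewrite /U -phiM; [|exact: ha|exact: Rr].
  congr (phi _ eta0); apply/funext => f /=; have ba := Roe_bop ha.
  have [hf|nf] := pselect (l2 f); last by rewrite !(rank1F _ _ nf) (bop0 ba).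
  by rewrite !rank1E // (bopZ _ ba).
(* The operator [rank1 w (U d)] lies in [Roe q], hence equals [phi a] for some [a]; it sends the
   unit vector [U d] to [w], and it sends [U d] to [U (a d)]. *)
have Usurj w : l2 w -> exists v, l2 v /\ U v = w.
  move=> hw; have hUd := Ul _ hd.
  have [a ha ea] := phiS _ (Roe_rank1 q hw hUd).
  exists (a d); split; first exact: (bop_l2 (Roe_bop ha)).
  by rewrite -UA // ea rank1E // Uiso // dot_delta scale1r.
have Ulin (c : C) v w : l2 v -> l2 w -> U (c *: v + w) = c *: U v + U w.
  move=> hv hw; rewrite /U -phiP; [|exact: Rr..].
  congr (phi _ eta0); apply/funext => f.
  have [hf|nf] := pselect (l2 f); last by rewrite !(rank1F _ _ nf) scaler0 addr0.
  by rewrite !rank1E // scalerDr !scalerA [c * _]mulrC.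
have Uinj v w : l2 v -> l2 w -> U v = U w -> v = w.
  move=> hv hw Uvw; apply/eqP; rewrite -subr_eq0; apply/eqP.
  have hvw := l2B hv hw; apply: sqn_eq0 => //; apply: (@complexI R).
  rewrite -!/(RtoC _) -dotff // -Uiso // addrC -scaleN1r Ulin // Uvw scaleN1r addNr.
  by rewrite dot0l //; exact: h0.
have hex w : exists v, l2 w -> l2 v /\ U v = w.
  have [hw|nw] := pselect (l2 w); last by exists 0.
  by have [v hv] := Usurj w hw; exists v.
have [V hV] := choice hex.
have Vl w : l2 w -> l2 (V w) by move=> /hV[].
have VK w : l2 w -> U (V w) = w by move=> /hV[].
exists U, V; split => //.
- by move=> v hv; apply: Uinj => //; [apply: Vl; exact: Ul | rewrite VK //; exact: Ul].
- by move=> v w hv hw; rewrite -{1}(VK w hw) Uiso //; exact: Vl.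
- by move=> a ha; exists (phi a); [exact: phiAB | move=> v hv; exact: UA].
move=> b Bb; have [a ha ea] := phiS _ Bb; exists a => // v hv.
by rewrite -UA // ea.
Qed.
End Implementation.

(** * Links between points of X and of Y *)

(** The space is a countable union of finite balls. The numbering lets multipliers on [Y] be indexed
    by sets of natural numbers, as the gliding hump requires. *)
Lemma ulf_injection (R : realType) (Y : metricType R) : ulf Y ->
  exists iota : Y -> nat, injective iota.
Proof.
move=> uY; have [[y0]|nY] := pselect (exists y : Y, True); last first.
  by exists (fun=> 0%N) => y; case: nY; exists y.
have cY : countable (\bigcup_(n in [set: nat]) [set y | mdist y0 y <= n.+1%:R]).
  apply: bigcup_countable => // n _; apply: finite_set_countable.
  apply/finite_set_leP; have [N hN] := uY n.+1%:R (ltr0Sn _ _).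
  by exists N; exact: hN.
have eY : \bigcup_(n in [set: nat]) [set y | mdist y0 y <= n.+1%:R] = [set: Y].
  apply/seteqP; split => // y _; exists (Num.Def.archi_bound (mdist y0 y)) => //=.
  apply: ltW; apply: lt_trans (archi_boundP (mdist_ge0 _ _)) _.
  by rewrite ltr_nat.
rewrite eY in cY; have /countable_injP[f fi] := cY.
by exists f => y y' e; apply: fi => //; exact: mem_set.
Qed.

Section Links.
Variables (R : realType) (X Y : metricType R) (I J : choiceType).
Variables (p : I -> X) (q : J -> Y).
Local Notation C := (Cplx R).
Variables (U : (I -> C) -> J -> C) (V : (J -> C) -> I -> C).
Hypothesis UV : intertwines (Roe p) (Roe q) U V.

Definition unit_at (K : choiceType) (Z : Type) (k : K -> Z) (z : Z) (v : K -> C) : Prop :=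
  [/\ l2 v, nrm v = 1 & forall i, k i <> z -> v i = 0].

(** The vectors [v] and [w] certify that the component of [U] from the fibre of [x] to the fibre of
    [y] has norm at least [d]. *)
Definition link (d : R) x y v w : Prop :=
  [/\ unit_at p x v, unit_at q y w & d <= nc (dot (U v) w)].

Lemma unit_scale (K : choiceType) (Z : Type) (k : K -> Z) (z : Z) (v : K -> C) :
  l2 v -> 0 < nrm v -> (forall i, k i <> z -> v i = 0) ->
  unit_at k z (RtoC (nrm v)^-1 *: v).
Proof.
move=> hv v0 vz; split; first exact: l2Z.
  by rewrite nrmZ // nc_RtoC ger0_norm ?invr_ge0 ?nrm_ge0 // mulVf // gt_eqF.
by move=> i /vz vi; rewrite -[LHS]/(_ * v i) vi mulr0.
Qed.

(** With [v] the part of [V w] on the fibre of [x], [dot (U v) w] is the squared norm of [v]; after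
    normalizing both vectors the coefficient is [nrm v / nrm w]. *)
Lemma link_of_res d x y w : 0 < d -> l2 w -> (forall j, q j <> y -> w j = 0) ->
  d * nrm w < nrm (res (fib p x) (V w)) -> exists v' w', link d x y v' w'.
Proof.
move=> d0 hw wy hlt; have hV := int_l2V UV hw.
set v := res _ (V w) in hlt; have hv : l2 v by exact: l2_res.
have v0 : 0 < nrm v by apply: le_lt_trans hlt; rewrite mulr_ge0 ?nrm_ge0 // ltW.
have w0 : 0 < nrm w.
  rewrite lt_neqAle nrm_ge0 andbT; apply/eqP => nw0.
  have VD := intertwines_sym (@Roe_bop _ _ _ p) UV.
  move: v0; rewrite /v (nrm_eq0 hw (esym nw0)) (int_0 VD) res0 nrm0.
  by rewrite ltxx.
exists (RtoC (nrm v)^-1 *: v), (RtoC (nrm w)^-1 *: w); split.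
- by apply: unit_scale => // i pix; rewrite /v resF.
- exact: unit_scale.
rewrite (int_Z UV) // dotZl; [|exact: (int_l2 UV)|exact: l2Z].
rewrite dotZr //; last exact: (int_l2 UV).
rewrite (int_dot UV) // {2}/v dot_res -dot_res2 -/v dotff // conj_RtoC.
rewrite !ncM !nc_RtoC !ger0_norm ?invr_ge0 ?nrm_ge0 ?sqn_ge0 //.
rewrite -nrm_sqr // [X in _ * X]mulrC mulrA expr2 mulKf ?gt_eqF //.
by rewrite ler_pdivlMr // ltW.
Qed.

Lemma nrm_res_seq (K : choiceType) (Z : choiceType) (k : K -> Z) (s : seq Z) (f : K -> C) (e : R) :
  l2 f -> (forall z, z \in s -> nrm (res [set i | k i = z] f) <= e) -> 0 <= e ->
  nrm (res [set i | k i \in s] f) <= (size s)%:R * e.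
Proof.
move=> hf + e0; elim: s => [|z s IH] h; first by rewrite res_eq0 // nrm0 mul0r.
have IH' : nrm (res [set i | k i \in s] f) <= (size s)%:R * e.
  by apply: IH => z' zs; apply: h; rewrite inE zs orbT.
have hz := h z (mem_head _ _).
set S := [set i | k i \in z :: s].
have hS : l2 (res S f) by exact: l2_res.
have h1 := nrm_res_sub (S := S `&` [set i | k i = z]) hf (@subIsetr _ _ _).
have h2 : nrm (res (S `&` ~` [set i | k i = z]) f) <= nrm (res [set i | k i \in s] f).
  by apply: nrm_res_sub => // i [+ ne]; rewrite /S /= inE => /orP[/eqP e1|//]; case: (ne e1).
rewrite -(resC [set i | k i = z] (res S f)) !res_res ![_ `&` S]setIC.
apply: le_trans (ler_nrmD _ _) _; [exact: l2_res..|].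
rewrite /= -natr1 mulrDl mul1r; lra.
Qed.

(** The cross terms of the two expansions are opposite, so one of them is nonpositive. *)
Lemma greedy_step (K : choiceType) (f g : K -> C) : l2 f -> l2 g ->
  sqn (f + g) <= sqn f + sqn g \/ sqn (f - g) <= sqn f + sqn g.
Proof.
move=> hf hg; rewrite !sqnD //; last exact: l2N.
have -> : sqn (- g) = sqn g.
  by rewrite -scaleN1r sqnZ // ncN nc1 expr1n mul1r.
have -> : re (dot f (- g)) = - re (dot f g).
  by rewrite -scaleN1r dotZr // rmorphN rmorph1 mulN1r reN.
by have [h|h] := leP (re (dot f g)) 0; [left|right]; lra.
Qed.

Definition signed (M : set Y) (s : seq Y) (f : J -> C) : J -> C := fun j =>
  if q j \in s then (if `[< M (q j) >] then f j else - f j) else 0.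

(** A symmetry in the form [2P - 1]: this reduces sign multipliers to the projections [res], whose
    conjugates are uniformly quasi-local. *)
Lemma signed_res (M : set Y) s f : signed M s f =
  2 *: res [set j | q j \in s /\ M (q j)] f - res [set j | q j \in s] f.
Proof.
apply/funext => j; rewrite -[RHS]/(2 * res _ f j - res _ f j) /signed.
case: ifPn => js; last by rewrite !resF ?mulr0 ?subr0 //= ?(negbTE js) // => -[].
case: asboolP => Mj; first by rewrite !resE // mulr2n mulrDl mul1r addrK.
by rewrite resF ?resE // ?mulr0 ?sub0r // => -[].
Qed.

Lemma l2_signed M s f : l2 f -> l2 (signed M s f).
Proof. by move=> hf; rewrite signed_res; apply: l2B; [apply/l2Z/l2_res|exact: l2_res]. Qed.

(** The sign of each fibre is chosen in turn so that its cross term with the sum built so far is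
    nonpositive, in place of averaging over all signs. *)
Lemma greedy_signs (K : choiceType) (L : (J -> C) -> K -> C) s f : l2 f -> uniq s ->
  L 0 = 0 -> (forall g, l2 g -> l2 (L g)) ->
  (forall g h, l2 g -> l2 h -> L (g + h) = L g + L h) ->
  (forall g h, l2 g -> l2 h -> L (g - h) = L g - L h) ->
  exists M, sqn (L (signed M s f)) <= \sum_(y <- s) sqn (L (res (fib q y) f)).
Proof.
move=> hf us L0 Ll LD LB; elim: s us => [_|y s IH /= /andP[ys us]].
  by exists setT; rewrite (_ : signed _ _ _ = 0) ?L0 ?sqn0 ?big_nil.
have [M hM] := IH us; rewrite big_cons.
set G := L (res (fib q y) f).
have lf := l2_res (fib q y) hf; have ls := l2_signed M s hf.
have lG : l2 G by exact: Ll.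
have lS : l2 (L (signed M s f)) by exact: Ll.
have [h|h] := greedy_step lS lG.
  exists (M `|` [set y]).
  have -> : signed (M `|` [set y]) (y :: s) f = signed M s f + res (fib q y) f.
    apply/funext => j; rewrite -[RHS]/(signed M s f j + res (fib q y) f j) /signed inE.
    have [e|/eqP ne] := eqVneq (q j) y.
      by rewrite e (negbTE ys) add0r /= resE // asboolT //; right.
    rewrite /= (resF (S := fib q y)) // addr0; case: ifP => // _.
    by congr (if _ then _ else _); apply/asboolP/asboolP => [[]//|]; left.
  by rewrite LD //; apply: le_trans h _; rewrite addrC lerD2l.
exists (M `\ y).
have -> : signed (M `\ y) (y :: s) f = signed M s f - res (fib q y) f.
  apply/funext => j; rewrite -[RHS]/(signed M s f j - res (fib q y) f j) /signed inE.
  have [e|/eqP ne] := eqVneq (q j) y.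
    by rewrite e (negbTE ys) sub0r /= resE // asboolF // => -[_]; apply.
  rewrite /= (resF (S := fib q y)) // subr0; case: ifP => // _.
  by congr (if _ then _ else _); apply/asboolP/asboolP => [[]//|].
by rewrite LB //; apply: le_trans h _; rewrite addrC lerD2l.
Qed.

End Links.

(** * Existence of a link near every point *)

Section LinkExistence.
Variables (R : realType) (X Y : metricType R) (I J : choiceType).
Variables (p : I -> X) (q : J -> Y).
Local Notation C := (Cplx R).
Variables (U : (I -> C) -> J -> C) (V : (J -> C) -> I -> C).
Hypotheses (uX : ulf X) (uY : ulf Y).
Hypothesis UV : intertwines (Roe p) (Roe q) U V.

Lemma dot_delta_ne (i j : I) : i <> j -> dot (delta R i) (delta R j) = 0.
Proof.
move=> ij; apply: dot_disj => k; rewrite /delta.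
have [ki|] := eqVneq k i; last by left.
by right; case: eqP => // kj; case: ij; rewrite -ki.
Qed.

(* Conjugating the multipliers [res S] by [U] and cutting down by the projection
   onto the span of the [delta (sec x)] gives a family in [Roe p]. *)
Lemma multiplier_family (sec : X -> I) (iota : Y -> nat) : cancel sec p ->
  exists a : set nat -> (I -> C) -> I -> C, forall M, Roe p (a M) /\
    forall v, l2 v -> U (a M v) = res [set j | M (iota (q j))]
      (U (trans p (fun x => delta R (sec x)) (fun x => delta R (sec x)) v)).
Proof.
move=> secK; set T0 := trans _ _ _.
have hd x : l2 (delta R (sec x)) /\ nrm (delta R (sec x)) <= 1.
  by split; [exact: l2_delta | rewrite nrm_delta].
(* [res S] alone may have noncompact blocks; composed with the image of [T0] it stays in the Roe
   algebra by [Roe_res]. *)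
have RT0 : Roe p T0.
  apply: (Roe_trans (s := id) (D := setT) (r := 0) hd hd) => //.
  - by move=> y nT; exfalso; apply: nT.
  - by move=> y i piy; rewrite /delta; case: eqP => // e; case: piy; rewrite e secK.
  - by move=> y _; rewrite mdistxx.
have [b0 hb0 b0U] := int_AB UV RT0.
have hex M : exists a, Roe p a /\
    forall v, l2 v -> U (a v) = res [set j | M (iota (q j))] (U (T0 v)).
  have hb := Roe_res [set j | M (iota (q j))] hb0.
  have [a ha aU] := int_BA UV hb; exists a; split => // v hv.
  by rewrite -aU //= b0U.
by have [a ha] := choice hex; exists a.
Qed.

(** Since [U] is isometric, the norm of [a M f] is that of a restriction of the one vector
    [U (T0 f)]. A finite set carries almost all of this vector, which gives the tail condition for
    sets [M] beyond the numbers of the fibres it meets. *)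
Lemma uniform_multipliers (sec : X -> I) (iota : Y -> nat) (a : set nat -> (I -> C) -> I -> C) :
  injective iota -> cancel sec p ->
  (forall M, Roe p (a M) /\ forall v, l2 v -> U (a M v) = res [set j | M (iota (q j))]
      (U (trans p (fun x => delta R (sec x)) (fun x => delta R (sec x)) v))) ->
  forall e, 0 < e -> exists r, forall M, quasi_local p (a M) e r.
Proof.
move=> ii secK; set T0 := trans _ _ _ => ha.
have hd x : l2 (delta R (sec x)) /\ nrm (delta R (sec x)) <= 1.
  by split; [exact: l2_delta | rewrite nrm_delta].
have T0l v : l2 v -> l2 (T0 v).
  move=> hv; have [] := @trans_nrm _ _ _ p _ _ id setT hd hd _ _ _ v hv => //.
    by move=> y nT; exfalso; apply: nT.
  by move=> y i piy; rewrite /delta; case: eqP => // e; case: piy; rewrite e secK.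
have ba M : bounded_map (a M) by have [/Roe_bop] := ha M.
have aE M v : l2 v -> U (a M v) = res [set j | M (iota (q j))] (U (T0 v)).
  by have [_] := ha M; apply.
have gl v : l2 v -> l2 (U (T0 v)) by move=> hv; exact/(int_l2 UV)/T0l.
have nE M v : l2 v -> nrm (a M v) = nrm (res [set j | M (iota (q j))] (U (T0 v))).
  by move=> hv; rewrite -(int_nrm UV) ?aE //; exact: bop_l2.
apply: uniform_quasi_local => //.
- move=> M e e0; exact: Roe_quasi_local (proj1 (ha M)) e0.
- move=> M P f hf MP; have h N := bop_l2 (ba N) hf.
  rewrite -(int_UK UV (h _)) aE // -[RHS](int_UK UV); last exact: l2D.
  congr V; rewrite (int_D UV) ?aE //.
  apply/funext => j; rewrite -[RHS]/(res _ _ j + res _ _ j).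
  have [Mj|Mj] := pselect (M (iota (q j))).
    rewrite [LHS]resE /=; last by left.
    rewrite [X in X + _]resE // [X in _ + X]resF ?addr0 //= => Pj.
    by have : (M `&` P) (iota (q j)) by []; rewrite MP.
  rewrite [X in X + _]resF // add0r.
  have [Pj|Pj] := pselect (P (iota (q j))).
    by rewrite [LHS]resE /=; [rewrite resE | right].
  by rewrite [LHS]resF /=; [rewrite resF | case].
move=> f e hf e0; have [K hK] := l2_tail (gl f hf) e0.
exists (\max_(j <- K) iota (q j)).+1 => M hM; rewrite nE //.
apply: le_trans hK; apply: nrm_res_sub; first exact: gl.
move=> j /= /hM; rewrite ltnNge => nle; apply/negP => jK; move/negP: nle; apply.
exact: (leq_bigmax_seq (F := fun j => iota (q j))).
Qed.

Lemma link_exists (sec : X -> I) : cancel sec p ->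
  exists d r, [/\ 0 < d, 0 < r & forall x, exists x' y v w,
    mdist x x' <= r /\ link p q U d x' y v w].
Proof.
move=> secK; have [iota ii] := ulf_injection uY.
have [a ha] := multiplier_family iota secK.
have [r0 hr0] := uniform_multipliers ii secK ha (divr_gt0 ltr01 (ltr0Sn R 7)).
have ba M : bounded_map (a M) by have [/Roe_bop] := ha M.
pose r := Num.max r0 1; have r1 : 0 < r by rewrite lt_max ltr01 orbT.
have hr M : quasi_local p (a M) (1 / 8) r by apply: (quasi_local_weaken (ba M) (hr0 M)); rewrite le_max lexx.
have [N hN] := ulf_seq uX r1.
(* The ball [B] around [x] has at most [N] points. If none of them has a link of strength [d], then
   [V w] restricted to [B] has norm at most [N * d <= 1 / 8] times that of [w], for [w] in a single
   fibre. *)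
pose d : R := 1 / 8 / N.+1%:R; have d0 : 0 < d by rewrite !divr_gt0.
exists d, r; split => // x; apply: contrapT => nlink.
have [s [us sN hs]] := hN x.
set z := delta R (sec x); have hz : l2 z by exact: l2_delta.
have nz : nrm z = 1 by exact: nrm_delta.
have hxi := int_l2 UV hz; set xi := U z in hxi.
have nxi : nrm xi = 1 by rewrite (int_nrm UV).
set B := [set i | p i \in s].
have Vsmall w y : l2 w -> (forall j, q j <> y -> w j = 0) ->
    nrm (res B (V w)) <= 1 / 8 * nrm w.
  move=> hw wy; have hV := int_l2V UV hw.
  have : nrm (res B (V w)) <= (size s)%:R * (d * nrm w).
    apply: nrm_res_seq => //; last by rewrite mulr_ge0 ?nrm_ge0 // ltW.
    move=> x' x's; rewrite leNgt; apply/negP => hlt.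
    have [v' [w' hl]] := link_of_res UV d0 hw wy hlt.
    by apply: nlink; exists x', y, v', w'; rewrite -hs.
  move/le_trans; apply; rewrite mulrA ler_wpM2r ?nrm_ge0 // /d mulrA.
  rewrite ler_pdivrMr ?ltr0n // mulrC ler_wpM2l ?divr_ge0 // ler_nat.
  exact: leqW.
have [K hK] := l2_tail hxi (divr_gt0 ltr01 (ltr0Sn R 7)).
(* Signs can be chosen greedily for finitely many fibres only; those listed here carry [xi] up to an
   error of norm [1 / 8]. *)
pose ys := undup (map q K).
set Q := [set j | q j \in ys].
have hQ : nrm (res (~` Q) xi) <= 1 / 8.
  apply: le_trans hK; apply: nrm_res_sub => // j /= nj; apply/negP => jK.
  by apply: nj; rewrite /Q /= /ys mem_undup map_f.
have VS := intertwines_sym (@Roe_bop _ _ _ p) UV.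
have VD := int_D VS; have VB := int_B VS; have V0 := int_0 VS; have Vl := int_l2V UV.
have [M hM] : exists M, sqn (res B (V (signed q M ys xi))) <=
    \sum_(y <- ys) sqn (res B (V (res (fib q y) xi))).
  apply: (@greedy_signs _ _ _ q _ (fun f => res B (V f)) ys xi hxi (undup_uniq _)).
  - by rewrite V0 res0.
  - by move=> g hg; apply: l2_res; exact: Vl.
  - by move=> g h hg hh; rewrite VD // resD.
  - by move=> g h hg hh; rewrite VB // resB.
set u := signed q M ys xi in hM; have hu : l2 u by exact: l2_signed.
have Bu : nrm (res B (V u)) <= 1 / 8.
  rewrite -ler_sqr ?nnegrE ?nrm_ge0 ?divr_ge0 // nrm_sqr; last exact/l2_res/Vl.
  apply: (le_trans hM).
  apply: (@le_trans _ _ (\sum_(y <- ys) (1 / 8) ^+ 2 * sqn (res (fib q y) xi))).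
    apply: ler_sum => y _; have hy := l2_res (fib q y) hxi.
    have hB : l2 (res B (V (res (fib q y) xi))) by exact/l2_res/Vl.
    rewrite -(nrm_sqr hy) -(nrm_sqr hB) -exprMn.
    rewrite ler_sqr ?nnegrE ?mulr_ge0 ?nrm_ge0 ?divr_ge0 //.
    by apply: (Vsmall _ y hy) => j qj; rewrite resF.
  rewrite -mulr_sumr -[leRHS]mulr1 ler_wpM2l ?sqr_ge0 //.
  apply: le_trans (sum_sqn_res_le q hxi (undup_uniq _)) _.
  by rewrite -nrm_sqr // nxi expr1n.
(* The numbers of the fibres that received the sign plus. *)
pose M1 := [set n | exists y, [/\ y \in ys, M y & iota y = n]].
have T0z : trans p (fun x => delta R (sec x)) (fun x => delta R (sec x)) z = z.
  apply/funext => i; rewrite transE // /z.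
  have [e|ne] := eqVneq i (sec x); first by rewrite e secK dot_delta mul1r.
  rewrite [in RHS]/delta (negbTE ne).
  have [e|ne'] := eqVneq (p i) x; last first.
    by rewrite dot_delta_ne ?mul0r // => /(congr1 p); rewrite !secK => /esym /eqP; apply/negP.
  by rewrite /delta e (negbTE ne) mulr0.
have [_ aU] := ha M1; have := aU z hz; rewrite T0z => aUz.
have haz := bop_l2 (ba M1) hz.
have resM : res [set j | M1 (iota (q j))] xi = res [set j | q j \in ys /\ M (q j)] xi.
  congr (res _ xi); apply/seteqP; split => j /=.
    by move=> [y [ys1 My /ii <-]].
  by move=> [ys1 My]; exists (q j).
(* The form [2P - 1] of the signs, using that [T0] fixes [z] and that restricting [xi] to [Q]
   amounts to subtracting its tail. *)
have uE : u = 2 *: U (a M1 z) - xi + res (~` Q) xi.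
  rewrite /u signed_res aUz -/xi resM -[X in _ = _ - X + _](resC Q) opprD addrA.
  by rewrite subrK.
set t := res (~` Q) xi in hQ uE; have ht : l2 t by exact: l2_res.
have hUa := int_l2 UV haz.
have Vu : V u = 2 *: a M1 z - z + V t.
  have h2 : l2 (2 *: U (a M1 z)) by exact: l2Z.
  rewrite uE VD ?VB ?(int_Z VS) ?(int_UK UV) //.
  exact: l2B.
set F := [set i | r < mdist x (p i)].
have BF : ~` B = F.
  by apply/seteqP; split => i; rewrite /B /F /= hs ltNge => /negP.
have Fz : res F z = 0.
  apply: res_eq0 => i; rewrite /F /= /z /delta; case: eqP => // ->.
  by rewrite secK mdistxx => /(lt_trans r1); rewrite ltxx.
(* Away from [B] the vector [z] vanishes, quasi-locality of [a M1] contributes [2 * (1 / 8)], and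
   the tail [t] another [1 / 8]. *)
have Fu : nrm (res F (V u)) <= 3 / 8.
  rewrite Vu resD resB resZ Fz subr0.
  apply: le_trans (ler_nrmD _ _) _; [exact/l2Z/l2_res|exact/l2_res/Vl|].
  rewrite nrmZ; last exact: l2_res.
  rewrite -(rmorph_nat (@RtoC R)) nc_RtoC ger0_norm //.
  have h1 := hr M1 x z hz; rewrite nz mulr1 in h1.
  have {}h1 : nrm (res F (a M1 z)) <= 1 / 8.
    by apply: h1 => i pix; rewrite /z /delta; case: eqP => // e; case: pix; rewrite e secK.
  have h2 : nrm (res F (V t)) <= 1 / 8.
    by apply: le_trans (nrm_res_le _ (Vl _ ht)) _; rewrite (int_nrm VS).
  lra.
have nV : nrm (V u) <= 1 / 8 + 3 / 8.
  rewrite -(resC B (V u)) BF; apply: le_trans (ler_nrmD _ _) _; [exact/l2_res/Vl..|].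
  exact: lerD.
rewrite (int_nrm VS) // in nV.
(* Changing signs preserves moduli, so [u - t] and [xi] have the same modulus everywhere. But
   [nrm u <= 1 / 2] and [nrm t <= 1 / 8], whereas [nrm xi = 1]. *)
have : nrm xi <= nrm u + nrm t.
  apply: (@le_trans _ _ (nrm (u - t))); last exact: ler_nrmB.
  apply: nrm_mono; first exact: l2B.
  move=> j; rewrite -[(u - t) j]/(u j - t j) /u /signed /t.
  have [jQ|jQ] := boolP (q j \in ys).
    rewrite resF ?subr0; last by move=> h; apply: h.
    by case: ifP => // _; rewrite ncN.
  by rewrite resE ?sub0r ?ncN //; apply/negP.
rewrite nxi; lra.
Qed.

End LinkExistence.

(** * Links at bounded distance *)

(** Dependent choice with memory of all previous terms; the size of the list makes the current index
    available to [Q]. *)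
Lemma greedy_sequence (T : eqType) (Q : seq T -> T -> Prop) :
  (forall s, exists x, Q s x) ->
  exists u : nat -> T, forall n, exists s, [/\ size s = n,
    forall m, (m < n)%N -> u m \in s & Q s (u n)].
Proof.
move=> /choice[F hF].
pose g := fix g n := if n is m.+1 then F (g m) :: g m else [::].
exists (fun n => F (g n)) => n; exists (g n); split => //.
  by elim: n => //= n ->.
elim: n => // n IH m; rewrite ltnS leq_eqVlt inE => /orP[/eqP->|/IH ->].
  by rewrite eqxx.
by rewrite orbT.
Qed.

Lemma seq_injective (T : eqType) (U : eqType) (k : T -> U) (u : nat -> T) :
  (forall m n, (m < n)%N -> k (u n) <> k (u m)) -> injective (k \o u).
Proof.
move=> h m n /= e; apply/eqP; rewrite eqn_leq; apply/andP; split; rewrite leqNgt.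
  by apply/negP => /h; apply.
by apply/negP => /h; apply.
Qed.

Lemma seq_bounded (R : realType) (T : eqType) (D : T -> R) (s : seq T) :
  exists B : R, forall x, x \in s -> D x <= B.
Proof.
elim: s => [|x s [B hB]]; first by exists 0.
exists (Num.max (D x) B) => y; rewrite inE le_max => /orP[/eqP ->|/hB ->].
  by rewrite lexx.
by rewrite orbT.
Qed.

(** As [D] is bounded on each fibre of [k1] and of [k2], asking for a large enough value of [D]
    automatically avoids the finitely many values of [k1] and [k2] already taken. *)
Lemma unbounded_sequence (R : realType) (T U1 U2 : eqType) (P : T -> Prop) (D : T -> R)
    (k1 : T -> U1) (k2 : T -> U2) :
  (forall c, exists B, forall t, P t -> k1 t = c -> D t <= B) ->
  (forall c, exists B, forall t, P t -> k2 t = c -> D t <= B) ->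
  (forall B, exists2 t, P t & B < D t) ->
  exists u : nat -> T, [/\ forall n, P (u n), injective (k1 \o u),
    injective (k2 \o u) & forall n, n%:R < D (u n)].
Proof.
move=> h1 h2 hD.
have hs (U : eqType) (k : T -> U) : (forall c, exists B, forall t, P t -> k t = c -> D t <= B) ->
    forall s : seq T, exists B, forall t t', P t -> t' \in s -> k t = k t' -> D t <= B.
  move=> h; elim=> [|x s [B hB]]; first by exists 0.
  have [B' hB'] := h (k x); exists (Num.max B B') => t t' Pt.
  rewrite inE le_max => /orP[/eqP -> /(hB' _ Pt) ->|ts /(hB _ _ Pt ts) -> //].
  by rewrite orbT.
have [|u hu] := @greedy_sequence T (fun s x => [/\ P x, (size s)%:R < D x,
    forall t, t \in s -> k1 x <> k1 t & forall t, t \in s -> k2 x <> k2 t]).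
  move=> s; have [B1 hB1] := hs _ _ h1 s; have [B2 hB2] := hs _ _ h2 s.
  have [t Pt] := hD (Num.max (size s)%:R (Num.max B1 B2)).
  rewrite !gt_max => /and3P[a1 a2 a3]; exists t; split => // t' ts e.
    by have := hB1 t t' Pt ts e; rewrite leNgt a2.
  by have := hB2 t t' Pt ts e; rewrite leNgt a3.
exists u; split.
- by move=> n; have [s [_ _ []]] := hu n.
- by apply: seq_injective => m n mn; have [s [_ /(_ m mn) ms [_ _ + _]]] := hu n; apply.
- by apply: seq_injective => m n mn; have [s [_ /(_ m mn) ms [_ _ _]]] := hu n; apply.
- by move=> n; have [s [<- _ []]] := hu n.
Qed.

Lemma index_of (T : Type) (u : nat -> T) : injective u ->
  exists k : T -> nat, forall n, k (u n) = n.
Proof.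
move=> ui; have h x : exists n, forall m, u m = x -> m = n.
  have [[m <-]|nm] := pselect (exists m, u m = x); first by exists m => m' /ui.
  by exists 0%N => m um; case: nm; exists m.
by have [k hk] := choice h; exists k => n; apply/esym/hk.
Qed.

Section LinksClose.
Variables (R : realType) (X Y : metricType R) (I J : choiceType).
Variables (p : I -> X) (q : J -> Y).
Local Notation C := (Cplx R).
Variables (U : (I -> C) -> J -> C) (V : (J -> C) -> I -> C).
Hypothesis UV : intertwines (Roe p) (Roe q) U V.

(* the partial sums, over n in M, of sum_n |v' n><v n| *)
Section Family.
Variables (x x' : nat -> X) (v v' : nat -> I -> C) (k' : X -> nat) (M : set nat).
Hypotheses (hv : forall n, unit_at p (x n) (v n))
  (hv' : forall n, unit_at p (x' n) (v' n))
  (hk' : forall n, k' (x' n) = n) (xi : injective x).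

(** [k'] is a left inverse of [x'] with arbitrary values off its range; the second condition selects
    the range. *)
Definition shift_dom : set X := [set y | M (k' y) /\ x' (k' y) = y].
Definition shift_fam (u : nat -> I -> C) (y : X) : I -> C :=
  if `[< shift_dom y >] then u (k' y) else 0.
Definition shift := trans p (shift_fam v') (shift_fam v).

Lemma shift_famT u y : shift_dom y -> shift_fam u y = u (k' y).
Proof. by rewrite /shift_fam => /asboolT ->. Qed.
Lemma shift_famF u y : ~ shift_dom y -> shift_fam u y = 0.
Proof. by rewrite /shift_fam => /asboolF ->. Qed.

Lemma shift_fam_le (z : nat -> X) (u : nat -> I -> C) y :
  (forall n, unit_at p (z n) (u n)) -> l2 (shift_fam u y) /\ nrm (shift_fam u y) <= 1.
Proof.
move=> hu; rewrite /shift_fam; case: ifP => _.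
  by have [h1 h2 _] := hu (k' y); rewrite h2.
by rewrite nrm0; split; first exact: l2_0.
Qed.

Lemma shift_inj y y' : shift_dom y -> shift_dom y' -> x (k' y) = x (k' y') -> y = y'.
Proof. by move=> [_ <-] [_ <-]; rewrite !hk' => /xi ->. Qed.

Lemma shift_supp y i : p i <> x (k' y) -> shift_fam v y i = 0.
Proof.
by rewrite /shift_fam; case: ifP => // _ h; have [_ _ ->] := hv (k' y).
Qed.

Lemma Roe_shift r : (forall n, mdist (x n) (x' n) <= r) -> Roe p shift.
Proof.
move=> hr; apply: (Roe_trans (s := x \o k') (D := shift_dom) (r := r)).
- by move=> y; exact: (shift_fam_le y hv').
- by move=> y; exact: (shift_fam_le y hv).
- exact: shift_inj.
- by move=> y; exact: shift_famF.
- exact: shift_supp.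
- by move=> y [_ e]; rewrite -{2}e /=.
Qed.

Lemma shift_nrm f : l2 f -> l2 (shift f) /\ nrm (shift f) <= nrm f.
Proof.
apply: (@trans_nrm _ _ _ p _ _ (x \o k') shift_dom).
- by move=> y; exact: (shift_fam_le y hv').
- by move=> y; exact: (shift_fam_le y hv).
- exact: shift_inj.
- by move=> y; exact: shift_famF.
- exact: shift_supp.
Qed.

Lemma shift_tail (S : set I) f : l2 f ->
  (forall n i, M n -> p i = x n -> S i) -> shift f = shift (res S f).
Proof.
move=> hf hS; apply/funext => i; rewrite /shift !transE //; last exact: l2_res.
rewrite dot_res; congr (dot f _ * _); apply/esym/res_id => j nSj.
have [[Mp e]|nD] := pselect (shift_dom (p i)); last by rewrite shift_famF.
rewrite shift_famT //; have [_ _ ->] // := hv (k' (p i)).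
by move=> e'; apply: nSj; exact: hS e'.
Qed.
End Family.

Lemma shiftU x' v v' k' (M P : set nat) f : l2 f -> M `&` P = set0 ->
  shift x' v v' k' (M `|` P) f = shift x' v v' k' M f + shift x' v v' k' P f.
Proof.
move=> hf MP; apply/funext => i.
rewrite -[RHS]/(shift _ _ _ _ M f i + shift _ _ _ _ P f i) /shift !transE //.
have [e|ne] := pselect (x' (k' (p i)) = p i); last first.
  by rewrite !(@shift_famF _ _ _ v') ?mulr0 ?addr0 // => -[].
have [Mi|Mi] := pselect (M (k' (p i))).
  have nP : ~ shift_dom x' k' P (p i).
    by move=> [Pi _]; have : (M `&` P) (k' (p i)) by []; rewrite MP.
  have MD : shift_dom x' k' M (p i) by [].
  have UD : shift_dom x' k' (M `|` P) (p i) by split => //; left.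
  by rewrite !(shift_famF _ nP) !(shift_famT _ MD) !(shift_famT _ UD) mulr0 addr0.
have nM : ~ shift_dom x' k' M (p i) by case.
rewrite !(shift_famF _ nM) mulr0 add0r.
have [Pi|Pi] := pselect (P (k' (p i))).
  have PD : shift_dom x' k' P (p i) by [].
  have UD : shift_dom x' k' (M `|` P) (p i) by split => //; right.
  by rewrite !(shift_famT _ PD) !(shift_famT _ UD).
have nP : ~ shift_dom x' k' P (p i) by case.
have nU : ~ shift_dom x' k' (M `|` P) (p i) by move=> [[]].
by rewrite !(shift_famF _ nP) !(shift_famF _ nU).
Qed.

Lemma shift1 (x' : nat -> X) v v' k' n f : l2 f -> (forall m, k' (x' m) = m) ->
  (forall m, unit_at p (x' m) (v' m)) ->
  shift x' v v' k' [set n] f = dot f (v n) *: v' n.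
Proof.
move=> hf hk' hv'; apply/funext => i; rewrite -[RHS]/(_ * v' n i) /shift transE //.
have [e|ne] := pselect (x' n = p i).
  have D : shift_dom x' k' [set n] (p i) by rewrite /shift_dom /= -e hk'.
  by rewrite !(shift_famT _ D) -e hk'.
have nD : ~ shift_dom x' k' [set n] (p i) by move=> [/= ->].
rewrite !(shift_famF _ nD) mulr0.
by have [_ _ ->] := hv' n; rewrite ?mulr0 // => /esym.
Qed.

(** The conjugates [b M] of the shifts are uniformly quasi-local in [M]. For [M] the singleton of
    [n], [b M] sends [w n] to [dot (V (w n)) (v n) *: U (v' n)]: the scalar has modulus at least
    [d], and [U (v' n)] has norm at least [d] on the fibre of [y' n]. The norm [d ^+ 2] found there
    exceeds the threshold [d ^+ 2 / 2], so [y' n] is within the uniform scale of [y n]. *)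
Lemma links_close d r (x x' : nat -> X) (y y' : nat -> Y) v v' w w' :
  0 < d -> injective x -> injective x' -> (forall n, mdist (x n) (x' n) <= r) ->
  (forall n, link p q U d (x n) (y n) (v n) (w n)) ->
  (forall n, link p q U d (x' n) (y' n) (v' n) (w' n)) ->
  exists B, forall n, mdist (y n) (y' n) <= B.
Proof.
move=> d0 xi xi' hr hl hl'.
have [k hk] := index_of xi; have [k' hk'] := index_of xi'.
have hv n : unit_at p (x n) (v n) by case: (hl n).
have hv' n : unit_at p (x' n) (v' n) by case: (hl' n).
pose T M := shift x' v v' k' M.
have RT M : Roe p (T M) by exact: (Roe_shift M hv hv' hk' xi hr).
have Tn M f : l2 f -> l2 (T M f) /\ nrm (T M f) <= nrm f.
  exact: (shift_nrm M hv hv' hk' xi).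
have [b hb] := choice (fun M => let: ex_intro2 b h1 h2 := int_AB UV (RT M) in
  ex_intro (fun b => Roe q b /\ forall v, l2 v -> b (U v) = U (T M v)) b (conj h1 h2)).
have bb M : bounded_map (b M) by exact: Roe_bop (proj1 (hb M)).
have bU M f : l2 f -> b M (U f) = U (T M f) by exact: (proj2 (hb M)).
have bE M g : l2 g -> b M g = U (T M (V g)).
  by move=> hg; rewrite -bU ?(int_VK UV) //; exact: (int_l2V UV).
have d20 : 0 < d ^+ 2 / 2 by rewrite divr_gt0 // exprn_gt0.
have [|||B hB] := @uniform_quasi_local _ _ _ q b bb _ _ _ _ d20.
- by move=> M e e0; exact: Roe_quasi_local (proj1 (hb M)) e0.
- move=> M P g hg MP; have hV := int_l2V UV hg; rewrite !bE //.
  by rewrite /T shiftU // (int_D UV) //; exact: (proj1 (Tn _ _ hV)).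
- move=> g e hg e0; have hV := int_l2V UV hg.
  have [K hK] := l2_tail hV e0.
  exists (\max_(i <- K) k (p i)).+1 => M hM.
  rewrite bE // (int_nrm UV); last exact: (proj1 (Tn _ _ hV)).
  rewrite /T (@shift_tail x x' v v' k' M hv [set i | i \notin K] _ hV).
    by apply: le_trans (proj2 (Tn _ _ (l2_res _ hV))) hK.
  move=> n i /hM nM pix /=; apply/negP => iK.
  have := leq_bigmax_seq (F := fun i => k (p i)) _ iK isT.
  by rewrite pix hk leqNgt nM.
exists B => n; rewrite leNgt; apply/negP => far.
have [[hvn nvn vs] [hwn nwn ws] hd] := hl n.
have [[hvn' nvn' vs'] [hwn' nwn' ws'] hd'] := hl' n.
have := hB [set n] (y n) (w n) hwn ws; rewrite nwn mulr1 bE // /T.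
have hV := int_l2V UV hwn; rewrite shift1 // (int_Z UV) // resZ.
set F := [set i | _]; have hU := int_l2 UV hvn'.
rewrite nrmZ; last exact: l2_res.
have c1 : d <= nc (dot (V (w n)) (v n)).
  by rewrite dotC // ncJ -(int_dot UV).
have c2 : d <= nrm (res F (U (v' n))).
  apply: (le_trans hd').
  have -> : w' n = res F (w' n).
    rewrite res_id // => j nF; apply: ws' => e; apply: nF.
    by rewrite /F /= e.
  rewrite -dot_res -[leRHS]mulr1 -nwn'; apply: cauchy_schwarz => //; exact: l2_res.
have c3 : d * d <= nc (dot (V (w n)) (v n)) * nrm (res F (U (v' n))).
  by apply: ler_pM => //; exact: ltW.
have : d * d / 2 < d * d by rewrite ltr_pdivrMr // ltr_pMr ?mulr_gt0 // ltr1n.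
rewrite expr2; lra.
Qed.

(** Otherwise the conjugate of the projection onto the span of the [v n] would fix the orthonormal
    sequence [U (v n)], every term of which has norm at least [d] on the fibre of [y]; this
    contradicts the compactness of rows. *)
Lemma links_fibre (uY : ulf Y) d y (x : nat -> X) v w : 0 < d -> injective x ->
  ~ forall n, link p q U d (x n) y (v n) (w n).
Proof.
move=> d0 xi hl; have [k hk] := index_of xi.
have hv n : unit_at p (x n) (v n) by case: (hl n).
have RT : Roe p (shift x v v k setT).
  by apply: (Roe_shift (r := 0) setT hv hv hk xi) => n; rewrite mdistxx.
have [b Rb bU] := int_AB UV RT.
have vv m n : m <> n -> dot (v m) (v n) = 0.
  move=> mn; apply: dot_disj => i; have [_ _ hm] := hv m; have [_ _ hn] := hv n.
  have [e|ne] := pselect (p i = x m); last by left; apply: hm.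
  by right; apply: hn; rewrite e => /xi.
have sv n : shift x v v k setT (v n) = v n.
  have [hvn nvn vs] := hv n.
  apply/funext => i; rewrite /shift transE //.
  have [e|ne] := pselect (x n = p i).
    have D : shift_dom x k setT (p i) by rewrite /shift_dom /= -e hk.
    rewrite !(shift_famT _ D) -e hk dotff // -nrm_sqr // nvn expr1n rmorph1 mul1r //.
  have vi0 : v n i = 0 by apply: vs => /esym.
  rewrite vi0; have [D|nD] := pselect (shift_dom x k setT (p i)); last first.
    by rewrite !(shift_famF _ nD) mulr0.
  rewrite !(shift_famT _ D) vv ?mul0r // => e; apply: ne.
  by have [_ <-] := D; rewrite -e.
apply: (@Roe_row_compact _ _ _ q b y d (U \o v) uY Rb d0).
  split => [n|m n mn] /=.
    have [hvn nvn _] := hv n; rewrite (int_nrm UV) //; split => //.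
    exact: (int_l2 UV).
  have [hm _ _] := hv m; have [hn _ _] := hv n.
  by rewrite (int_dot UV) ?(int_UK UV) ?vv //; exact: (int_l2 UV).
move=> n /=; have [[hvn _ _] [hwn nwn ws] hd] := hl n.
rewrite bU // sv; apply: (le_trans hd).
have -> : w n = res (fib q y) (w n) by rewrite res_id // => j; exact: ws.
have hU := int_l2 UV hvn.
by rewrite -dot_res -[leRHS]mulr1 -nwn; apply: cauchy_schwarz => //; exact: l2_res.
Qed.

End LinksClose.

(** * Coarse equivalences from links *)

(** [g \o t] is the candidate coarse equivalence: [t] moves each point a bounded distance to one
    that has a link, and [g] reads off the other end. The values of [g], [v] and [w] off [G] are
    arbitrary. *)
Record link_selection (R : realType) (X Y : metricType R) (I J : choiceType)
    (p : I -> X) (q : J -> Y) (U : (I -> Cplx R) -> J -> Cplx R)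
    (d r : R) (G : set X) (t : X -> X) (g : X -> Y)
    (v : X -> I -> Cplx R) (w : X -> J -> Cplx R) : Prop := LinkSelection {
  sel_pos : 0 < d;
  sel_near : forall x, mdist x (t x) <= r;
  sel_good : forall x, G (t x);
  sel_link : forall x, G x -> link p q U d x (g x) (v x) (w x)
}.

Section Selection.
Variables (R : realType) (X Y : metricType R) (I J : choiceType).
Variables (p : I -> X) (q : J -> Y).
Local Notation C := (Cplx R).
Variables (U : (I -> C) -> J -> C) (V : (J -> C) -> I -> C).
Hypotheses (uX : ulf X) (uY : ulf Y).
Hypothesis UV : intertwines (Roe p) (Roe q) U V.

Lemma link_sym d x y v w : link p q U d x y v w -> link q p V d y x w v.
Proof.
move=> [hv hw hd]; split => //; have [lv _ _] := hv; have [lw _ _] := hw.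
rewrite dotC // ?ncJ -?(int_dot UV) //; exact: (int_l2V UV).
Qed.

Lemma link_weak (K L : choiceType) (Z W : metricType R) (k : K -> Z) (l : L -> W)
    (T : (K -> C) -> L -> C) d e x y v w :
  e <= d -> link k l T d x y v w -> link k l T e x y v w.
Proof. by move=> ed [h1 h2 h3]; split => //; exact: le_trans h3. Qed.

Lemma unbounded_absurd (D : nat -> R) B :
  (forall n, n%:R < D n) -> (forall n, D n <= B) -> False.
Proof.
move=> h1 h2; have B0 : 0 <= B by apply: ltW (lt_le_trans (h1 0%N) (h2 0%N)).
have := lt_le_trans (h1 (Num.Def.archi_bound B)) (h2 _).
by rewrite ltNge (ltW (archi_boundP B0)).
Qed.

Lemma selection_exists (sec : X -> I) : cancel sec p ->
  exists d r G t g v w, link_selection p q U d r G t g v w.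
Proof.
move=> secK; have [d [r [d0 r0 h]]] := link_exists uX uY UV secK.
pose G := [set x | exists y v w, link p q U d x y v w].
have ht x : exists x', mdist x x' <= r /\ G x'.
  by have [x' [y [v [w [h1 h2]]]]] := h x; exists x'; split => //; exists y, v, w.
have hg x : exists D : Y * (I -> C) * (J -> C), G x -> link p q U d x D.1.1 D.1.2 D.2.
  have [[y [v [w hl]]]|nG] := pselect (G x); first by exists (y, v, w).
  (* A default is required off [G]; a link at a neighbouring point supplies an element of [Y]. *)
  by have [x' [y [v [w _]]]] := h x; exists (y, v, w).
have [t htt] := choice ht; have [D hD] := choice hg.
exists d, r, G, t, (fun x => (D x).1.1), (fun x => (D x).1.2), (fun x => (D x).2).
by split => // x; have [] := htt x.
Qed.

Lemma ball_bounded (Z : metricType R) (x : Z) (D : Z -> R) r : ulf Z ->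
  exists B, forall z, mdist x z <= r -> D z <= B.
Proof.
move=> uZ; have r1 : 0 < Num.max r 1 by rewrite lt_max ltr01 orbT.
have [N hN] := ulf_seq uZ r1; have [s [_ _ hs]] := hN x.
have [B hB] := seq_bounded D s; exists B => z hz; apply: hB.
by rewrite hs le_max hz.
Qed.

Section OneSelection.
Variables (d r : R) (G : set X) (t : X -> X) (g : X -> Y)
  (v : X -> I -> C) (w : X -> J -> C).
Hypothesis S : link_selection p q U d r G t g v w.

(** Were the images unbounded, finiteness of balls would give a sequence of pairs, injective in each
    coordinate, whose images drift apart, against [links_close]. *)
Lemma selection_coarse s : exists B, forall x x', mdist x x' <= s ->
  mdist (g (t x)) (g (t x')) <= B.
Proof.
(* The extra [2 * r] accounts for the displacement of both points by [t]. *)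
pose P := [set z : X * X | [/\ G z.1, G z.2 & mdist z.1 z.2 <= s + 2 * r]].
suff [B hB] : exists B, forall z, P z -> mdist (g z.1) (g z.2) <= B.
  exists B => x x' hxx; apply: (hB (t x, t x')); split => /=; [exact: (sel_good S)..|].
  have := metric_triangle (t x) x (t x'); have := metric_triangle x x' (t x').
  have := sel_near S x; have := sel_near S x'; rewrite (metric_sym x (t x)); lra.
apply: contrapT => nB.
have [|||u [Pu i1 i2 hu]] := @unbounded_sequence R _ X X P
    (fun z => mdist (g z.1) (g z.2)) fst snd.
- move=> c; have [B hB] := ball_bounded c (fun x => mdist (g c) (g x)) (s + 2 * r) uX.
  by exists B => -[a b] [/= _ _ hab] e; subst a; apply: hB.
- move=> c; have [B hB] := ball_bounded c (fun x => mdist (g x) (g c)) (s + 2 * r) uX.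
  by exists B => -[a b] [/= _ _ hab] e; subst b; apply: hB; rewrite metric_sym.
- move=> B; apply: contrapT => h; apply: nB; exists B => z Pz; rewrite leNgt.
  by apply/negP => hlt; apply: h; exists z.
have l1 n : link p q U d (u n).1 (g (u n).1) (v (u n).1) (w (u n).1).
  by have [/(sel_link S)] := Pu n.
have l2 n : link p q U d (u n).2 (g (u n).2) (v (u n).2) (w (u n).2).
  by have [_ /(sel_link S)] := Pu n.
have hd n : mdist (u n).1 (u n).2 <= s + 2 * r by have [] := Pu n.
have [B hB] := @links_close _ _ _ _ _ p q U V UV d (s + 2 * r) (fst \o u) (snd \o u)
  (fun n => g (u n).1) (fun n => g (u n).2) (fun n => v (u n).1) (fun n => v (u n).2)
  (fun n => w (u n).1) (fun n => w (u n).2) (sel_pos S) i1 i2 hd l1 l2.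
exact: (unbounded_absurd hu hB).
Qed.

Lemma selection_fibre c : exists s : seq X, forall x, G x -> g x = c -> x \in s.
Proof.
apply: contrapT => ns.
have [s|u hu] := @greedy_sequence X (fun s x => [/\ G x, g x = c & x \notin s]).
  apply: contrapT => h; apply: ns; exists s => x Gx gx.
  by apply: contrapT => /negP xs; apply: h; exists x.
have ui : injective u.
  apply: (@seq_injective X X id) => m n mn /= e.
  by have [s [_ /(_ m mn) ms [_ _]]] := hu n; rewrite e ms.
apply: (@links_fibre _ _ _ _ _ p q U V UV uY d c u (v \o u) (w \o u) (sel_pos S) ui) => n.
by have [s [_ _ [Gu gu _]]] := hu n; rewrite -gu; exact: (sel_link S Gu).
Qed.

End OneSelection.

(** Read backwards, a link at [x] goes from [g x] to [x]; the second selection links the nearby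
    point [t' (g x)] to [g' (t' (g x))]. Applied to [V], [links_close] bounds the distance between
    the two ends; the finite fibres of [g] and of [t' \o g] on [G] provide the injective
    sequences. *)
Lemma selection_back d r G t g v w d' r' G' t' g' v' w' :
  link_selection p q U d r G t g v w -> link_selection q p V d' r' G' t' g' v' w' ->
  exists B, forall x, mdist x (g' (t' (g (t x)))) <= B.
Proof.
move=> S S'.
suff [B hB] : exists B, forall x, G x -> mdist x (g' (t' (g x))) <= B.
  exists (r + B) => x; have := metric_triangle x (t x) (g' (t' (g (t x)))).
  have := sel_near S x; have := hB _ (sel_good S x); lra.
apply: contrapT => nB.
pose D x := mdist x (g' (t' (g x))).
(* A common strength for the links of both selections. *)
pose e := Num.min d d'.
have e0 : 0 < e by rewrite lt_min (sel_pos S) (sel_pos S').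
have [|||u [Pu i1 i2 hu]] := @unbounded_sequence R X Y Y G D g (t' \o g).
- move=> c; have [s hs] := selection_fibre S c; have [B hB] := seq_bounded D s.
  by exists B => x Gx gx; apply: hB; exact: hs.
(* Points sent to [c] by [t'] lie in a ball, hence are finite in number, and each has a finite fibre
   under [g]. *)
- move=> c; have r1 : 0 < Num.max r' 1 by rewrite lt_max ltr01 orbT.
  have [N hN] := ulf_seq uY r1; have [s [_ _ hs]] := hN c.
  have hB y : exists B, forall x, G x -> g x = y -> D x <= B.
    have [s' hs'] := selection_fibre S y; have [B hB] := seq_bounded D s'.
    by exists B => x Gx gx; apply: hB; exact: hs'.
  have [B hBB] := choice hB; have [M hM] := seq_bounded B s.
  exists M => x Gx tx; apply: (le_trans (hBB (g x) x Gx erefl)); apply: hM.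
  by rewrite hs le_max -tx metric_sym (sel_near S').
- move=> B; apply: contrapT => h; apply: nB; exists B => x Gx; rewrite leNgt.
  by apply/negP => hlt; apply: h; exists x.
have VU := intertwines_sym (@Roe_bop _ _ _ p) UV.
have l1 n : link q p V e (g (u n)) (u n) (w (u n)) (v (u n)).
  by apply: link_weak (link_sym (sel_link S (Pu n))); rewrite ge_min lexx.
have l2 n : link q p V e (t' (g (u n))) (g' (t' (g (u n))))
    (v' (t' (g (u n)))) (w' (t' (g (u n)))).
  by apply: link_weak (sel_link S' (sel_good S' _)); rewrite ge_min lexx orbT.
have [B hB] := @links_close _ _ _ _ _ q p V U VU e r' (g \o u) (t' \o g \o u)
  u (fun n => g' (t' (g (u n)))) (fun n => w (u n)) (fun n => v' (t' (g (u n))))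
  (fun n => v (u n)) (fun n => w' (t' (g (u n)))) e0 i1 i2
  (fun n => sel_near S' (g (u n))) l1 l2.
exact: (unbounded_absurd hu hB).
Qed.

End Selection.

(** * Coarse equivalence from an isomorphism of Roe algebras *)

Section Rigidity.
Variables (R : realType) (X Y : metricType R).
Local Notation C := (Cplx R).

Lemma coarse_equivalence_of_inverse (f : X -> Y) (h : Y -> X) (c c' : R) :
  (forall s, exists B, forall x x', mdist x x' <= s -> mdist (f x) (f x') <= B) ->
  (forall s, exists B, forall y y', mdist y y' <= s -> mdist (h y) (h y') <= B) ->
  (forall x, mdist x (h (f x)) <= c) -> (forall y, mdist y (f (h y)) <= c') ->
  coarse_equivalence f.
Proof.
move=> fc hc hf fh; split.
(* The sign of [B] is unknown, as the space may be empty, and the bound required is strict; hence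
   the absolute value and the [+ 1]. *)
- move=> s s0; have [B hB] := fc s; exists (`|B| + 1); first by rewrite ltr_wpDl.
  move=> x y /ltW /hB hxy; apply: (le_lt_trans hxy).
  by rewrite (le_lt_trans (ler_norm B)) // ltrDl.
- move=> r r0; have [B hB] := hc r; exists (`|B| + 2 * `|c| + 1).
    by rewrite ltr_wpDl // addr_ge0 // mulr_ge0.
  move=> x y hlt; rewrite ltNge; apply/negP => /hB hxy.
  have := metric_triangle x (h (f x)) y.
  have := metric_triangle (h (f x)) (h (f y)) y.
  have := hf x; have := hf y; rewrite (metric_sym y (h (f y))).
  have := ler_norm B; have := ler_norm c; lra.
apply: (@le_lt_trans _ _ c'%:E); last exact: ltry.
apply: ge_ereal_sup => _ [y _ <-].
apply: (@le_trans _ _ (mdist y (f (h y)))%:E); last by rewrite lee_fin.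
by apply: ereal_inf_lbound; exists (f (h y)) => //; exists (h y).
Qed.

Variables (I J : choiceType) (p : I -> X) (q : J -> Y).

(** On an empty index set there is only one operator, whereas [Roe q] contains both 0 and a nonzero
    projection. *)
Lemma star_iso_nonempty : star_isomorphic (Roe p) (Roe q) -> J -> (I -> False) -> False.
Proof.
move=> [phi [_ _ phiS] _] j0 nI.
have hd : l2 (delta R j0) by exact: l2_delta.
have h0 : l2 (0 : J -> C) by exact: l2_0.
have [a _ ea] := phiS _ (Roe_rank1 q hd hd).
have [b _ eb] := phiS _ (Roe_rank1 q h0 h0).
have ab : a = b by apply/funext => f; apply/funext => i; case: (nI i).
have : rank1 (delta R j0) (delta R j0) = rank1 0 0 by rewrite -ea -eb ab.
move=> /(congr1 (fun T => T (delta R j0) j0)); rewrite !rank1E // dot_delta scale1r scaler0.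
by rewrite /delta eqxx => /eqP; rewrite oner_eq0.
Qed.

Lemma Roe_rigid (sp : X -> I) (sq : Y -> J) : ulf X -> ulf Y ->
  cancel sp p -> cancel sq q -> star_isomorphic (Roe p) (Roe q) ->
  coarsely_equivalent X Y.
Proof.
move=> uX uY spK sqK iso.
(* The implementing unitary is built from a basis vector. Without one, both spaces are empty and the
   empty map is a coarse equivalence. *)
have [[i0 _]|nI] := pselect (exists i : I, True); last first.
  have nX (x : X) : False by apply: nI; exists (sp x).
  have nY (y : Y) : False.
    by apply: (star_iso_nonempty iso (sq y)) => i; apply: nI; exists i.
  exists (fun x => False_rect _ (nX x)); split.
  - by move=> s s0; exists 1 => // x; case: (nX x).
  - by move=> s s0; exists 1 => // x; case: (nX x).
  apply: (@le_lt_trans _ _ (0%R%:E)); last exact: ltry.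
  by apply: ge_ereal_sup => e [y _ _]; case: (nY y).
have [U [V UV]] := star_iso_intertwines i0 iso.
have VU := intertwines_sym (@Roe_bop _ _ _ p) UV.
have [d [r [G [t [g [v [w S]]]]]]] := selection_exists uX uY UV spK.
have [d' [r' [G' [t' [g' [v' [w' S']]]]]]] := selection_exists uY uX VU sqK.
have [c hc] := selection_back uY UV S S'.
have [c' hc'] := selection_back uX VU S' S.
exists (g \o t).
apply: (@coarse_equivalence_of_inverse _ (g' \o t') c c') => //.
- exact: (selection_coarse uX UV S).
- exact: (selection_coarse uY VU S').
Qed.

End Rigidity.

(** The fibres of the identity are one-dimensional, so all blocks have rank at most one and their
    compactness is automatic. *)
Lemma uniform_roe_algebraE (R : realType) (X : metricType R) :
  uniform_roe_algebra X = Roe (@id X).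
Proof.
rewrite /uniform_roe_algebra /Roe; congr norm_closure.
apply/seteqP; split => T; last by case.
move=> [bT pT]; split => // x y; have /bopP bT' := bT.
have hd : l2 (delta R x) by exact: l2_delta.
have resx f : res (fib (@id X) x) f = f x *: delta R x.
  apply/funext => z; rewrite -[RHS]/(f x * delta R x z) /delta.
  have [->|zx] := eqVneq z x; first by rewrite mulr1 resE.
  by rewrite mulr0 resF //; apply/eqP.
apply: (@compact_rank1 _ _ _ (res (fib (@id X) y) (T (delta R x))) (delta R x)) => //.
  by apply/l2_res/(bop_l2 bT').
move=> f hf; rewrite /block !fiber_projE resx (bopZ _ bT') // resZ.
congr (_ *: _); have -> : delta R x = res (fib (@id X) x) (delta R x).
  by rewrite resx /delta eqxx scale1r.
by rewrite -dot_res resx dotZl // dot_delta mulr1.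
Qed.

Theorem theorem1p5 (R : realType) (X : metricType R) :
  ulf X -> coarse_baum_connes_with_coefficients X ->
  roe_rigid X /\ uniform_roe_rigid X.
Proof.
move=> uX _; split => Y uY.
  (* The section picks the basis vector of index 0 in each copy of the coefficient space. *)
  exact: (@Roe_rigid R X Y _ _ fst fst (pair^~ 0%N) (pair^~ 0%N)).
rewrite !uniform_roe_algebraE.
exact: (@Roe_rigid R X Y _ _ id id id id).
Qed.
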